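(* Let $T>0$ and let $r\ge1$ be an integer. Consider the Volterra integral equation $$x(t)-\int_0^t H(t,\tau)x(\tau)\,d\tau=f(t),\qquad 0\le t\le T.$$ 1. Let $\gamma>0$. Suppose that $H(t,\tau)$ belongs to $Q^{*}_{r,\gamma}([0,T],1)$ with respect to each variable separately and that $f\in Q^{*}_{r,\gamma}([0,T],1)$. Then the unique solution $x(t)$ of the equation belongs to $Q^{*}_{r,\gamma}([0,T],M)$ for some constant $0<M<\infty$. 2. Let $0<\gamma\le1$ and let $A_1,A_2>0$ be constants. Suppose that $H(t,\tau)$ belongs to $B^{*}_{r,\gamma}([0,T],A_1)$ with respect to each variable separately and that $f\in B^{*}_{r,\gamma}([0,T],A_2)$. Then there exists a unique solution $x(t)$ of the equation, and $x\in B^{*}_{r,\gamma}([0,T],A)$ for some constant $A$.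
   Context: The class $Q^{*}_{r,\gamma}([0,T],M)$ consists of the functions $f$ on $[0,T]$ such that $$|f^{(k)}(t)|\le M,\quad 0\le k\le r,\ t\in[0,T],\qquad |f^{(k)}(t)|\le\frac{M}{t^{\,k-r-\zeta}},\quad r<k\le s,\ t\in(0,T],$$ where $s=r+\gamma$ and $\zeta=0$ if $\gamma$ is an integer, while if $\gamma$ is not an integer one writes $\gamma=[\gamma]+\mu$ with $0<\mu<1$ ($[\gamma]$ is the integer part) and puts $s=r+[\gamma]+1$, $\zeta=1-\mu$. For $r\in\{1,2,\ldots\}$, $0<\gamma\le1$ and a constant $A$ independent of the order $k$ of the derivative, the class $B^{*}_{r,\gamma}([0,T],A)$ consists of the functions $f$ on $[0,T]$ such that $$|f(t)|\le A,\quad t\in[0,T],$$ $$|f^{(k)}(t)|\le A^{k}k^{k},\quad 0<k\le r,\ t\in[0,T],\qquad |f^{(k)}(t)|\le\frac{A^{k}k^{k}}{t^{\,k-r-1+\gamma}},\quad r<k<\infty,\ t\in(0,T].$$ ''With respect to each variable separately'' means that for each fixed $\tau$ the function $t\mapsto H(t,\tau)$, and for each fixed $t$ the function $\tau\mapsto H(t,\tau)$, belongs to the stated class. Solutions are understood as continuous functions on $[0,T]$. *)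

(* Defs.v *)
From HB Require Import structures.
From mathcomp Require Import all_boot all_order all_algebra.
From mathcomp Require Import all_classical all_reals all_analysis.

Set Implicit Arguments.
Unset Strict Implicit.
Unset Printing Implicit Defensive.
Import Order.TTheory GRing.Theory Num.Theory.
Import numFieldNormedType.Exports.

Local Open Scope classical_set_scope.
Local Open Scope ring_scope.

(* Derivatives relative to the interval [0, T]: two-sided at interior points and
   one-sided at 0 and T, whereas the library's 'D_v f x and f^`() are two-sided
   everywhere.  Only the values of f on [0, T] matter. *)
Definition derivable_on (R : realType) (T : R) (f : R -> R) (t : R) : Prop :=
  cvg ((f u - f t) / (u - t) @[u --> within `[0, T] t^']).

Definition deriv_on (R : realType) (T : R) (f : R -> R) (t : R) : R :=
  lim ((f u - f t) / (u - t) @[u --> within `[0, T] t^']).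

(* [derivn_on T f k t] is meaningful only where the successive derivatives exist;
   its value at t > 0 depends only on the lower-order ones near t, so it is also
   the k-th derivative on (0, T] when some of these do not exist at 0. *)
Definition derivn_on (R : realType) (T : R) (f : R -> R) (k : nat) : R -> R :=
  iter k (deriv_on T) f.

Definition Q_order (R : realType) (r : nat) (gamma : R) : nat :=
  if gamma \is a Num.int then (r + Num.truncn gamma)%N
  else (r + Num.truncn gamma + 1)%N.

Definition Q_zeta (R : realType) (gamma : R) : R :=
  if gamma \is a Num.int then 0
  else 1 - (gamma - (Num.truncn gamma)%:R).

Definition Qstar (R : realType) (T : R) (r : nat) (gamma M : R)
    (f : R -> R) : Prop :=
  [/\ forall (k : nat) (t : R), (k < r)%N -> 0 <= t <= T ->
        derivable_on T (derivn_on T f k) t,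
      forall (k : nat) (t : R), (r <= k < Q_order r gamma)%N -> 0 < t <= T ->
        derivable_on T (derivn_on T f k) t,
      forall (k : nat) (t : R), (k <= r)%N -> 0 <= t <= T ->
        `|derivn_on T f k t| <= M
    & forall (k : nat) (t : R), (r < k <= Q_order r gamma)%N -> 0 < t <= T ->
        `|derivn_on T f k t| <= M / t `^ (k%:R - r%:R - Q_zeta gamma)].

Definition Bstar (R : realType) (T : R) (r : nat) (gamma A : R)
    (f : R -> R) : Prop :=
  [/\ forall (k : nat) (t : R), (k < r)%N -> 0 <= t <= T ->
        derivable_on T (derivn_on T f k) t,
      forall (k : nat) (t : R), (r <= k)%N -> 0 < t <= T ->
        derivable_on T (derivn_on T f k) t,
      forall t : R, 0 <= t <= T -> `|f t| <= A,
      forall (k : nat) (t : R), (0 < k <= r)%N -> 0 <= t <= T ->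
        `|derivn_on T f k t| <= A ^+ k * k%:R ^+ k
    & forall (k : nat) (t : R), (r < k)%N -> 0 < t <= T ->
        `|derivn_on T f k t| <=
          A ^+ k * k%:R ^+ k / t `^ (k%:R - r%:R - 1 + gamma)].

Definition separately (R : realType) (T : R) (P : (R -> R) -> Prop)
    (H : R -> R -> R) : Prop :=
  (forall tau : R, 0 <= tau <= T -> P (fun t => H t tau)) /\
  (forall t : R, 0 <= t <= T -> P (fun tau => H t tau)).

Definition volterra_solution (R : realType) (T : R) (H : R -> R -> R)
    (f x : R -> R) : Prop :=
  {within `[0, T], continuous x} /\
  forall t : R, 0 <= t <= T ->
    x t - \int[@lebesgue_measure R]_(tau in `[0, t]) (H t tau * x tau) = f t.

(* Functions on [0, T] are represented by total functions R -> R, so uniqueness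
   is equality on [0, T]. *)
Definition unique_volterra_solution (R : realType) (T : R) (H : R -> R -> R)
    (f x : R -> R) : Prop :=
  volterra_solution T H f x /\
  forall y : R -> R, volterra_solution T H f y ->
    forall t : R, 0 <= t <= T -> y t = x t.

(* Main.v *)
Require Import Defs.
From HB Require Import structures.
From mathcomp Require Import all_boot all_order all_algebra.
From mathcomp Require Import all_classical all_reals all_analysis.
From mathcomp Require Import ring lra measurable_realfun.

Set Implicit Arguments.
Unset Strict Implicit.
Unset Printing Implicit Defensive.
Import Order.TTheory GRing.Theory Num.Theory.
Import numFieldNormedType.Exports.

Local Open Scope classical_set_scope.
Local Open Scope ring_scope.

(* Differentiating x = f + int_0^t H(t, tau) x(tau) dtau repeatedly produces,
   besides int_0^t (d_t^k H)(t, tau) x(tau) dtau, boundary terms involving mixed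
   derivatives of H on the diagonal, about which the separate hypotheses say
   nothing directly.  They are controlled as follows.  Near a diagonal point
   (a, a), on a square of side rho, replace H by its Taylor polynomial of degree
   < N in t with coefficients interpolated in tau: pure derivatives of order N
   bounded by M make the error O(M rho^N).  Passing from rho to rho/2 changes the
   coefficient of order (i, j) by O(M rho^(N-i-j)), so for i + j < N these
   coefficients converge, and by a converse Taylor argument along the diagonal
   the limits differentiate like mixed derivatives.  All constants are of the
   form C^N i! j!, which is what the class B^* needs.  The order i + j = r costs
   a factor log(1/a); it is absorbed because the exponents k - r - zeta exceed
   the natural ones k - r - 1 (zeta < 1).

   With D_pq the mixed derivatives on the diagonal, the k-th derivative of x is
   f^(k) + int_0^t (d_t^k H) x + sum_(j < k) sum_(p, q) D_pq x^(j) with at most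
   2^(k-1-j) binom(k, j+1) terms for each j, all with p + q = k - 1 - j, and the
   bound x^(k) = O(M^k k!) follows by induction on k. *)

(** * Newton interpolation *)

(** The square at (a, a) has side comparable to a. Taylor's N! then cancels the N! in the bounds on
    pure derivatives of order N, and the powers of a come out by homogeneity. What remains must be
    exponential in N, since a factorial loss would destroy the B^* estimate; hence equally spaced
    nodes, whose Newton form costs only 8^N. The limiting coefficients come from a construction that
    depends on N, whereas one family of diagonal derivatives is needed for all orders. The converse
    Taylor argument therefore also identifies them with [Dmix], which is defined from H alone.
    Derivatives of top order exist only pointwise, with a bound but without continuity. For this
    reason Taylor remainders are derived from a monotonicity principle, and differentiation under
    the integral from dominated convergence. Both classes are handled through one class of finite
    smoothness s, with bounds A B^k k! times a power of t. Its constants for the solution do not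
    depend on s, so the B^* case follows by letting s be arbitrary. *)

Section NewtonInterpolation.
Variable R : realType.
Implicit Types (p : {poly R}) (c : R) (g : nat -> R) (N n k : nat).

(** The generalised binomial coefficient X (X - 1) ... (X - n + 1) / n!. *)
Definition binpoly n : {poly R} :=
  (n`!%:R)^-1 *: \prod_(i < n) ('X - (i%:R)%:P).

Definition fwd_diff g : nat -> R := fun k => g k.+1 - g k.

Definition newton N g : {poly R} :=
  \sum_(n < N) iter n fwd_diff g 0%N *: binpoly n.

Lemma horner_binpoly0 n : (binpoly n).[0] = (n == 0%N)%:R.
Proof.
rewrite /binpoly hornerZ horner_prod; case: n => [|n].
  by rewrite big_ord0 fact0 invr1 mulr1.
by rewrite big_ord_recl /= hornerXsubC subrr mul0r mulr0.
Qed.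

Lemma horner_binpoly n x :
  (binpoly n).[x] = (n`!%:R)^-1 * \prod_(i < n) (x - i%:R).
Proof.
rewrite /binpoly hornerZ horner_prod; congr (_ * _).
by apply: eq_bigr => i _; rewrite hornerXsubC.
Qed.

Lemma binpoly_0 : binpoly 0 = 1.
Proof. by rewrite /binpoly big_ord0 fact0 invr1 scale1r. Qed.

Lemma binpolyS n :
  binpoly n.+1 = (n.+1%:R)^-1 *: (binpoly n * ('X - (n%:R)%:P)).
Proof. by rewrite /binpoly big_ord_recr /= factS natrM invfM -scalerA -scalerAl. Qed.

Lemma size_binpoly n : (size (binpoly n) <= n.+1)%N.
Proof.
rewrite (leq_trans (size_scale_leq _ _))//.
by rewrite size_prod_XsubC /index_enum -enumT size_enum_ord.
Qed.

(** Pascal's rule as a polynomial identity: the forward difference lowers the index by one. *)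
Lemma horner_binpolyS n x :
  (binpoly n.+1).[x + 1] = (binpoly n.+1).[x] + (binpoly n).[x].
Proof.
rewrite !horner_binpoly big_ord_recl big_ord_recr /= subr0.
under eq_bigr => i _.
  rewrite /bump /= add1n -natr1 opprD addrACA subrr addr0.
  over.
set P := \prod_(i < n) _.
have n0 : (n`!%:R : R) != 0 by rewrite pnatr_eq0 -lt0n fact_gt0.
have n1 : (n.+1%:R : R) != 0 by rewrite pnatr_eq0.
rewrite factS natrM -[n.+1%:R]natr1.
field.
by rewrite n0 natr1 n1.
Qed.

Lemma size_newton N g : (size (newton N g) <= N)%N.
Proof.
rewrite (leq_trans (size_sum _ _ _))//; apply/bigmax_leqP => i _.
rewrite (leq_trans (size_scale_leq _ _))// (leq_trans (size_binpoly _))//.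
Qed.

Lemma iter_fwd_diff n g : iter n fwd_diff (fwd_diff g) = fwd_diff (iter n fwd_diff g).
Proof. by rewrite -iterSr iterS. Qed.

Lemma horner_newtonE N g x :
  (newton N g).[x] = \sum_(n < N) iter n fwd_diff g 0%N * (binpoly n).[x].
Proof. by rewrite horner_sum; apply: eq_bigr => i _; rewrite hornerZ. Qed.

(** By Pascal's rule, shifting the argument by 1 adds the Newton polynomial of the differences of g.
    This moves interpolation at node k to node k + 1, which is why N and g vary in the induction of
    [horner_newton]. *)
Lemma newtonS N g x :
  (newton N.+1 g).[x + 1] = (newton N.+1 g).[x] + (newton N (fwd_diff g)).[x].
Proof.
rewrite !horner_newtonE !big_ord_recl /= -addrA; congr (_ + _).
  by rewrite [binpoly _]binpoly_0 !hornerC.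
rewrite -big_split /=; apply: eq_bigr => i _.
by rewrite /bump /= add1n horner_binpolyS iter_fwd_diff; ring.
Qed.

Lemma horner_newton N g k : (k < N)%N -> (newton N g).[k%:R] = g k.
Proof.
elim: k N g => [|k IH] [//|N] g kN.
  rewrite horner_newtonE big_ord_recl big1 /=; last first.
    by move=> i _; rewrite horner_binpoly0 mulr0.
  by rewrite horner_binpoly0 mulr1 addr0.
by rewrite -natr1 newtonS !IH ?(ltnW kN)// /fwd_diff addrC subrK.
Qed.

(** The difference has degree below N and vanishes at the N distinct nodes 0, ..., N - 1. *)
Lemma newton_poly N p : (size p <= N)%N -> newton N (fun k => p.[k%:R]) = p.
Proof.
move=> pN; apply/eqP; rewrite -subr_eq0; apply/eqP.
set q := _ - _.
have qN : (size q <= N)%N.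
  rewrite (leq_trans (size_polyD _ _))// size_polyN geq_max pN.
  by rewrite size_newton.
apply/eqP; apply: contraT => q0.
have /(_ [seq k%:R | k <- iota 0 N]) := max_poly_roots q0.
rewrite size_map size_iota ltnNge qN; apply.
  apply/allP => y /mapP[k + ->]; rewrite mem_iota add0n => /andP[_ kN].
  by rewrite rootE /q hornerD hornerN horner_newton// subrr.
by rewrite map_inj_uniq ?iota_uniq// => i j /eqP; rewrite eqr_nat => /eqP.
Qed.

Lemma fwd_diff_bound N g (E : R) n k : (forall k, (k < N)%N -> `|g k| <= E) ->
  (k + n < N)%N -> `|iter n fwd_diff g k| <= 2 ^+ n * E.
Proof.
move=> gE; elim: n k => [|n IH] k kN; first by rewrite mul1r gE// -(addn0 k).
rewrite iterS /fwd_diff (le_trans (ler_normB _ _))//.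
rewrite exprS -mulrA mulr_natl mulr2n lerD// IH//; first by rewrite addSnnS.
by rewrite (leq_trans _ kN)// addnS.
Qed.

Lemma fwd_diffD n g1 g2 (a : R) k :
  iter n fwd_diff (fun k => g1 k + a * g2 k) k =
  iter n fwd_diff g1 k + a * iter n fwd_diff g2 k.
Proof.
elim: n k => //= n IH k.
by rewrite /fwd_diff !IH; ring.
Qed.

Lemma eq_newton N g1 g2 : (forall k, (k < N)%N -> g1 k = g2 k) ->
  newton N g1 = newton N g2.
Proof.
move=> g12; apply: eq_bigr => i _; congr (_ *: _).
suff H n k : (k + n < N)%N -> iter n fwd_diff g1 k = iter n fwd_diff g2 k.
  by apply: H; rewrite add0n.
elim: n k => [k|n IH k kN]; first by rewrite addn0 => /g12.
have kN1 : (k.+1 + n < N)%N by rewrite addSnnS.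
by rewrite !iterS /fwd_diff !IH// (ltn_trans _ kN1)// addSn.
Qed.

Lemma newtonD N g1 g2 (a : R) :
  newton N (fun k => g1 k + a * g2 k) = newton N g1 + a *: newton N g2.
Proof.
rewrite /newton scaler_sumr -big_split /=; apply: eq_bigr => i _.
by rewrite fwd_diffD scalerDl scalerA.
Qed.

(** The l^1 norm of the coefficients after the substitution of c X for X. With c = N it measures the
    polynomial in the variable in which the nodes are k/N. *)
Definition wnorm c p : R := \sum_(i < size p) `|p`_i| * c ^+ i.

Lemma wnormE c n p : (size p <= n)%N -> wnorm c p = \sum_(i < n) `|p`_i| * c ^+ i.
Proof.
move=> pn; rewrite /wnorm (big_ord_widen n (fun i => `|p`_i| * c ^+ i) pn).
rewrite big_mkcond /=; apply: eq_bigr => i _.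
by case: ltnP => // pi; rewrite nth_default// normr0 mul0r.
Qed.

Lemma wnormD c p q : 0 <= c -> wnorm c (p + q) <= wnorm c p + wnorm c q.
Proof.
move=> c0; set n := maxn (size p) (size q).
rewrite (wnormE c (n := n)) ?size_polyD// (wnormE c (n := n) (p := p)) ?leq_maxl//.
rewrite (wnormE c (n := n) (p := q)) ?leq_maxr// -big_split /=.
apply: ler_sum => i _; rewrite coefD -mulrDl ler_wpM2r ?exprn_ge0//.
exact: ler_normD.
Qed.

Lemma wnormZ c a p : wnorm c (a *: p) = `|a| * wnorm c p.
Proof.
rewrite (wnormE c (size_scale_leq a p)) mulr_sumr; apply: eq_bigr => i _.
by rewrite coefZ normrM mulrA.
Qed.

Lemma wnorm_mulXsubC c p (a : R) : 0 <= c ->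
  wnorm c (p * ('X - a%:P)) <= (c + `|a|) * wnorm c p.
Proof.
move=> c0; rewrite mulrBr mulrC [p * _%:P]mulrC.
have H1 : wnorm c ('X * p) = c * wnorm c p.
  rewrite (wnormE c (n := (size p).+1)); last first.
    by rewrite mulrC (leq_trans (size_polyMleq _ _))// size_polyX addn2.
  rewrite big_ord_recl coefXM /= normr0 mul0r add0r mulr_sumr.
  by apply: eq_bigr => i _; rewrite coefXM /= exprS mulrCA.
have -> : 'X * p - a%:P * p = 'X * p + (- a) *: p by rewrite scaleNr mul_polyC.
by rewrite (le_trans (wnormD _ _ c0))// H1 wnormZ normrN mulrDl.
Qed.

Lemma wnorm_ge0 c p : 0 <= c -> 0 <= wnorm c p.
Proof. by move=> c0; apply: sumr_ge0 => i _; rewrite mulr_ge0 ?exprn_ge0. Qed.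

Lemma bin_le_exp2 n m : ('C(n, m) <= 2 ^ n)%N.
Proof.
have [mn|nm] := leqP m n; last by rewrite bin_small.
rewrite -[2%N]/(1 + 1)%N.
rewrite expnDn (bigD1 (inord m)) //= inordK ?ltnS//.
by rewrite !exp1n !muln1 leq_addr.
Qed.

(** The factor X - m costs at most N + m, so the norm is at most the product of (N + m) / (m + 1)
    over m < n. This is below 'C(N + n, n), hence below 2^(2N). *)
Lemma wnorm_binpoly N n : (n <= N)%N -> wnorm N%:R (binpoly n) <= 4 ^+ N.
Proof.
move=> nN.
have H : wnorm N%:R (binpoly n) <= 'C(N + n, n)%:R.
  elim: n {nN} => [|n IH].
    rewrite binpoly_0 (wnormE _ (n := 1%N)) ?size_poly1//.
    by rewrite big_ord1 coef1 normr1 mulr1 bin0.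
  rewrite binpolyS wnormZ ger0_norm ?invr_ge0// ler_pdivrMl ?ltr0n//.
  rewrite (le_trans (wnorm_mulXsubC _ _ _))// normr_nat.
  rewrite -natrM addnS -mul_bin_diag natrM ler_pM ?addr_ge0 ?wnorm_ge0//.
  by rewrite -natrD ler_nat leqnSn.
rewrite (le_trans H)// -natrX ler_nat (leq_trans (bin_le_exp2 _ _))//.
by rewrite (_ : 4 = 2 ^ 2)%N// -expnM leq_exp2l// mulSn mul1n leq_add2l.
Qed.

(** An n-th difference is at most 2^n E and a basis polynomial has norm at most 4^N. Summing the
    powers of 2 over n < N gives 8^N. *)
Lemma wnorm_newton N g (E : R) : 0 <= E -> (forall k, (k < N)%N -> `|g k| <= E) ->
  wnorm N%:R (newton N g) <= 8 ^+ N * E.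
Proof.
move=> E0 gE.
have wsum (n : nat) (F : nat -> {poly R}) :
    wnorm N%:R (\sum_(i < n) F i) <= \sum_(i < n) wnorm N%:R (F i).
  elim: n => [|n IH]; first by rewrite !big_ord0 /wnorm size_poly0 big_ord0.
  by rewrite !big_ord_recr /= (le_trans (wnormD _ _ _))// lerD2r.
apply: (le_trans (wsum N (fun n => iter n fwd_diff g 0%N *: binpoly n))).
have H n : (n <= N)%N ->
    \sum_(i < n) wnorm N%:R (iter i fwd_diff g 0 *: binpoly i) <=
    (2 ^+ n - 1) * 4 ^+ N * E.
  elim: n => [|n IH] nN; first by rewrite big_ord0 subrr !mul0r.
  rewrite big_ord_recr /= wnormZ.
  rewrite (_ : (2 ^+ n.+1 - 1) * _ * _ =
    (2 ^+ n - 1) * 4 ^+ N * E + 2 ^+ n * E * 4 ^+ N); last by rewrite exprS; ring.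
  rewrite lerD ?IH// 1?ltnW// ler_pM ?wnorm_ge0//.
    exact: fwd_diff_bound gE _.
  by rewrite wnorm_binpoly// ltnW.
apply: (le_trans (H N (leqnn N))).
rewrite (_ : 8 ^+ N = 2 ^+ N * 4 ^+ N); last by rewrite -exprMn; congr (_ ^+ _); ring.
by rewrite !ler_wpM2r ?exprn_ge0// lerBlDr lerDl.
Qed.

(* The coefficient of x^i in the polynomial of degree < N that interpolates g
   at the nodes k/N, k < N; the factor N^i undoes the scaling of the nodes. *)
Definition icoef N (g : R -> R) i : R :=
  N%:R ^+ i * (newton N (fun k => g (k%:R / N%:R)))`_i.

Lemma icoef_bound N (g : R -> R) (E : R) :
  (forall x, 0 <= x <= 1 -> `|g x| <= E) ->
  \sum_(i < N) `|icoef N g i| <= 8 ^+ N * E.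
Proof.
move=> gE.
have E0 : 0 <= E by rewrite (le_trans _ (gE 0 _))// lexx ler01.
have := @wnorm_newton N (fun k => g (k%:R / N%:R)) E E0.
rewrite (wnormE _ (size_newton _ _)) => H.
under eq_bigr => i _ do
  rewrite normrM mulrC normrX (ger0_norm (ler0n _ _)).
apply: H => k kN; apply: gE.
have N0 : (0 : R) < N%:R by rewrite ltr0n (leq_ltn_trans _ kN).
by rewrite divr_ge0//= ler_pdivrMr// mul1r ler_nat ltnW.
Qed.

Lemma icoef_bound1 N (g : R -> R) (E : R) i : (i < N)%N ->
  (forall x, 0 <= x <= 1 -> `|g x| <= E) -> `|icoef N g i| <= 8 ^+ N * E.
Proof.
move=> iN /(@icoef_bound N); apply: le_trans.
by rewrite (bigD1 (Ordinal iN)) //= lerDl sumr_ge0.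
Qed.

Lemma eq_icoef N (g1 g2 : R -> R) i : (forall x, 0 <= x <= 1 -> g1 x = g2 x) ->
  icoef N g1 i = icoef N g2 i.
Proof.
move=> g12; rewrite /icoef.
rewrite (@eq_newton N _ (fun k => g2 (k%:R / N%:R)))// => k kN.
apply: g12; have N0 : (0 : R) < N%:R by rewrite ltr0n (leq_ltn_trans _ kN).
by rewrite divr_ge0//= ler_pdivrMr// mul1r ler_nat ltnW.
Qed.

Lemma icoefD N (g1 g2 : R -> R) (a : R) i :
  icoef N (fun x => g1 x + a * g2 x) i = icoef N g1 i + a * icoef N g2 i.
Proof. by rewrite /icoef newtonD coefD coefZ; ring. Qed.

Lemma icoef_poly N (c : nat -> R) (g : R -> R) i : (i < N)%N ->
  (forall x, 0 <= x <= 1 -> g x = \sum_(j < N) c j * x ^+ j) ->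
  icoef N g i = c i.
Proof.
move=> iN gE.
have N0 : (N%:R : R) != 0 by rewrite pnatr_eq0 -lt0n (leq_ltn_trans _ iN).
rewrite (eq_icoef _ _ gE) /icoef.
set p : {poly R} := \poly_(j < N) (c j / N%:R ^+ j).
have -> : newton N (fun k => \sum_(j < N) c j * (k%:R / N%:R) ^+ j) = p.
  rewrite -[RHS](@newton_poly N) ?size_poly//; apply: eq_newton => k kN.
  rewrite /p horner_poly; apply: eq_bigr => j _.
  by rewrite expr_div_n mulrA mulrAC.
by rewrite coef_poly iN mulrCA mulfV ?mulr1// expf_neq0.
Qed.

Lemma icoef0 N (g : R -> R) : (0 < N)%N -> icoef N g 0 = g 0.
Proof.
move=> N0; rewrite /icoef mul1r -horner_coef0.
have := @horner_newton N (fun k => g (k%:R / N%:R)) 0 N0.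
by rewrite mul0r.
Qed.

Lemma icoef_sum N n (F : nat -> R -> R) (a : nat -> R) i :
  icoef N (fun x => \sum_(m < n) a m * F m x) i = \sum_(m < n) a m * icoef N (F m) i.
Proof.
elim: n => [|n IH].
  rewrite big_ord0 -[RHS](mulr0 (N%:R ^+ i)) /icoef; congr (_ * _).
  rewrite (_ : newton _ _ = 0) ?coef0//.
  rewrite -[RHS](@newton_poly N) ?size_poly0//; apply: eq_newton => k kN.
  by rewrite big_ord0 horner0.
rewrite big_ord_recr /= -IH -icoefD; apply: eq_icoef => x _.
by rewrite big_ord_recr.
Qed.

(** A polynomial of degree below N is its own interpolant, so after rescaling [0, rho] to [0, 1] the
    norm of interpolation bounds each coefficient. This is a crude Markov inequality with a constant
    exponential in N. *)
Lemma coef_bound N (c : nat -> R) (rho E : R) i : 0 <= rho -> (i < N)%N ->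
  (forall x, 0 <= x <= rho -> `|\sum_(j < N) c j * x ^+ j| <= E) ->
  `|c i| * rho ^+ i <= 8 ^+ N * E.
Proof.
move=> rho0 iN H.
have -> : `|c i| * rho ^+ i =
    `|icoef N (fun x => \sum_(j < N) (c j * rho ^+ j) * x ^+ j) i|.
  rewrite (@icoef_poly N (fun j => c j * rho ^+ j))//.
  by rewrite normrM normrX (ger0_norm rho0).
apply: icoef_bound1 => // x /andP[x0 x1].
under eq_bigr => j _ do rewrite -mulrA -exprMn.
apply: H; rewrite mulr_ge0//=.
by rewrite -[leRHS]mulr1 ler_wpM2l.
Qed.

Definition poly2 N (c : nat -> nat -> R) (u v : R) : R :=
  \sum_(i < N) (\sum_(j < N) c i j * v ^+ j) * u ^+ i.

Lemma poly2B N (c d : nat -> nat -> R) u v :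
  poly2 N c u v - poly2 N d u v = poly2 N (fun i j => c i j - d i j) u v.
Proof.
rewrite /poly2 -sumrB; apply: eq_bigr => i _.
rewrite -mulrBl -sumrB; congr (_ * _); apply: eq_bigr => j _.
by rewrite mulrBl.
Qed.

(** One application of [coef_bound] per variable, whence 64 = 8 * 8. *)
Lemma poly2_coef_bound N (c : nat -> nat -> R) (rho E : R) i j :
  0 <= rho -> (i < N)%N -> (j < N)%N ->
  (forall u v, 0 <= u <= rho -> 0 <= v <= rho -> `|poly2 N c u v| <= E) ->
  `|c i j| * rho ^+ (i + j) <= 64 ^+ N * E.
Proof.
move=> rho0 iN jN H.
rewrite exprD mulrA mulrAC.
have -> : `|c i j| * rho ^+ j * rho ^+ i = `|c i j * rho ^+ i| * rho ^+ j.
  by rewrite normrM normrX (ger0_norm rho0) mulrAC.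
rewrite (_ : 64 ^+ N * E = 8 ^+ N * (8 ^+ N * E)); last first.
  by rewrite mulrA -exprMn; congr (_ ^+ _ * _); ring.
apply: (@coef_bound N (fun j => c i j * rho ^+ i)) => // v v01.
rewrite (_ : \sum_(j < N) c i j * rho ^+ i * v ^+ j =
   (\sum_(j < N) c i j * v ^+ j) * rho ^+ i); last first.
  by rewrite mulr_suml; apply: eq_bigr => k _; rewrite mulrAC.
rewrite normrM (ger0_norm (exprn_ge0 _ rho0)).
apply: (@coef_bound N (fun i => \sum_(j < N) c i j * v ^+ j)) => // u u01.
exact: H.
Qed.

End NewtonInterpolation.

(** * Derivatives relative to an interval *)

Section RelativeDerivative.
Variable R : realType.
Implicit Types (lo hi t l : R) (f g : R -> R).

(** The difference quotient is cleared of its denominator, so u = t needs no exclusion. The explicit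
    interval allows restriction to subintervals by [has_deriv_sub]. *)
Definition has_deriv lo hi f t l := forall e, 0 < e ->
  exists2 d, 0 < d & forall u, lo <= u <= hi -> `|u - t| < d ->
    `|f u - f t - l * (u - t)| <= e * `|u - t|.

Let eq_ler (x y : R) : x = y -> x <= y. Proof. by move=> ->. Qed.

Lemma has_deriv_sub lo hi lo' hi' f t l : lo <= lo' -> hi' <= hi ->
  has_deriv lo hi f t l -> has_deriv lo' hi' f t l.
Proof.
move=> lolo hihi H e /H[d d0 Hd]; exists d => // u /andP[lou uhi]; apply: Hd.
by rewrite (le_trans lolo)// (le_trans uhi).
Qed.

Lemma has_deriv_near lo hi lo' hi' f g t l d0 : 0 < d0 -> f t = g t ->
  (forall u, lo' <= u <= hi' -> `|u - t| < d0 -> lo <= u <= hi /\ f u = g u) ->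
  has_deriv lo hi f t l -> has_deriv lo' hi' g t l.
Proof.
move=> d00 ft H fl e /fl[d d1 Hd].
exists (Num.min d d0); first by rewrite lt_min d1.
move=> u lu; rewrite lt_min => /andP[ud ud0].
have [lu' <-] := H _ lu ud0; rewrite -ft; exact: Hd.
Qed.

Lemma eq_has_deriv lo hi f g t l : f t = g t ->
  (forall u, lo <= u <= hi -> f u = g u) ->
  has_deriv lo hi f t l -> has_deriv lo hi g t l.
Proof. by move=> ft H; apply: (has_deriv_near ltr01) => // u lu _; rewrite H. Qed.

Lemma has_deriv_cst lo hi c t : has_deriv lo hi (fun=> c) t 0.
Proof.
move=> e e0; exists 1 => // u _ _.
by rewrite mul0r !subr0 subrr normr0 mulr_ge0// ltW.
Qed.

Lemma has_derivD lo hi f g t l m : has_deriv lo hi f t l ->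
  has_deriv lo hi g t m -> has_deriv lo hi (fun u => f u + g u) t (l + m).
Proof.
move=> fl gm e e0.
have e2 : 0 < e / 2 by rewrite divr_gt0.
have [d d0 Hd] := fl _ e2; have [d' d'0 Hd'] := gm _ e2.
exists (Num.min d d'); first by rewrite lt_min d0.
move=> u lu; rewrite lt_min => /andP[ud ud'].
rewrite (_ : _ - _ = (f u - f t - l * (u - t)) + (g u - g t - m * (u - t))); last by ring.
rewrite (le_trans (ler_normD _ _))// (_ : e * _ = e / 2 * `|u - t| + e / 2 * `|u - t|).
  by rewrite lerD ?Hd ?Hd'.
by rewrite -mulrDl -splitr.
Qed.

Lemma has_deriv_lip lo hi f t l : has_deriv lo hi f t l ->
  exists2 d, 0 < d & forall u, lo <= u <= hi -> `|u - t| < d ->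
    `|f u - f t| <= (`|l| + 1) * `|u - t|.
Proof.
move=> /(_ _ ltr01)[d d0 Hd]; exists d => // u lu ud.
rewrite -[f u - f t](subrK (l * (u - t))) (le_trans (ler_normD _ _))//.
by rewrite addrC mulrDl normrM lerD2l Hd.
Qed.

Lemma has_derivM lo hi f g t l m : has_deriv lo hi f t l ->
  has_deriv lo hi g t m ->
  has_deriv lo hi (fun u => f u * g u) t (l * g t + f t * m).
Proof.
move=> fl gm e e0.
set C := `|g t| + `|f t| + (`|l| + 1) * (`|m| + 1) + 1.
have C0 : 0 < C.
  by rewrite ltr_wpDl// !addr_ge0// mulr_ge0// addr_ge0.
have e2 : 0 < e / C by rewrite divr_gt0.
have [d d0 Hd] := fl _ e2; have [d' d'0 Hd'] := gm _ e2.
have [d1 d10 Hd1] := has_deriv_lip fl; have [d2 d20 Hd2] := has_deriv_lip gm.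
exists (Num.min (Num.min d d') (Num.min (Num.min d1 d2) (e / C))).
  by rewrite !lt_min d0 d'0 d10 d20.
move=> u lu; rewrite !lt_min => /andP[/andP[ud ud'] /andP[/andP[ud1 ud2] ue]].
rewrite (_ : _ - _ = g t * (f u - f t - l * (u - t)) + f t * (g u - g t - m * (u - t))
  + (f u - f t) * (g u - g t)); last by ring.
rewrite (le_trans (ler_normD _ _))//.
rewrite (_ : e * _ = C * (e / C) * `|u - t|); last by rewrite mulrCA mulfV ?mulr1// gt_eqF.
set x := `|u - t| in ud ud' ud1 ud2 ue *.
have x0 : 0 <= x by exact: normr_ge0.
have H1 : `|g t * (f u - f t - l * (u - t))| <= `|g t| * (e / C * x).
  by rewrite normrM ler_wpM2l// Hd.
have H2 : `|f t * (g u - g t - m * (u - t))| <= `|f t| * (e / C * x).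
  by rewrite normrM ler_wpM2l// Hd'.
have H3 : `|(f u - f t) * (g u - g t)| <= (`|l| + 1) * (`|m| + 1) * (e / C * x).
  rewrite normrM (le_trans (ler_pM _ _ (Hd1 _ lu ud1) (Hd2 _ lu ud2)))//.
  rewrite -/x mulrACA ler_wpM2l ?mulr_ge0 ?addr_ge0// ler_wpM2r// ltW//.
have H4 : 0 <= e / C * x by rewrite mulr_ge0 // ltW.
rewrite (le_trans (lerD (le_trans (ler_normD _ _) (lerD H1 H2)) H3))//.
by rewrite -[leRHS]mulrA -!mulrDl ler_wpM2r// /C lerDl.
Qed.

Lemma has_derivZ lo hi f t l c : has_deriv lo hi f t l ->
  has_deriv lo hi (fun u => c * f u) t (c * l).
Proof.
move=> fl; have := has_derivM (has_deriv_cst lo hi c t) fl.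
by rewrite mul0r add0r.
Qed.

Lemma has_deriv_id lo hi t : has_deriv lo hi id t 1.
Proof.
move=> e e0; exists 1 => // u _ _.
by rewrite mul1r subrr normr0 mulr_ge0// ltW.
Qed.

Lemma has_deriv_sum lo hi (F : nat -> R -> R) (L : nat -> R) t n :
  (forall i, (i < n)%N -> has_deriv lo hi (F i) t (L i)) ->
  has_deriv lo hi (fun u => \sum_(i < n) F i u) t (\sum_(i < n) L i).
Proof.
elim: n => [|n IH] H.
  rewrite big_ord0; apply: eq_has_deriv (has_deriv_cst _ _ 0 _) => [|u _]; by rewrite big_ord0.
rewrite big_ord_recr /=.
apply: (@eq_has_deriv _ _ (fun u => \sum_(i < n) F i u + F n u)).
- by rewrite big_ord_recr.
- by move=> u _; rewrite big_ord_recr.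
by apply: has_derivD; [apply: IH => i /ltnW; exact: H|exact: H].
Qed.

Lemma has_derivX lo hi a t n :
  has_deriv lo hi (fun u => (u - a) ^+ n) t (n%:R * (t - a) ^+ n.-1).
Proof.
elim: n => [|n IH]; first by rewrite mul0r; exact: has_deriv_cst.
have H : has_deriv lo hi (fun u => u - a) t (1 + 0).
  by apply: has_derivD; [exact: has_deriv_id|exact: has_deriv_cst].
rewrite addr0 in H; have := has_derivM H IH.
have -> : 1 * (t - a) ^+ n + (t - a) * (n%:R * (t - a) ^+ n.-1) = n.+1%:R * (t - a) ^+ n.
  by case: n {IH H} => [|n]; rewrite ?expr0 ?exprS -!natr1 /=; ring.
by apply: eq_has_deriv => [|u _]; rewrite exprS.
Qed.

(** A supremum argument that also covers one-sided derivatives at a and b. For each slope e, let c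
    be the supremum of the x with f a - f x <= e (x - a). The derivative at c, used to its left,
    shows that c itself qualifies; used to its right, that c < b is impossible. *)
Lemma has_deriv_nondec f df a b : a <= b ->
  (forall t, a <= t <= b -> has_deriv a b f t (df t)) ->
  (forall t, a <= t <= b -> 0 <= df t) -> f a <= f b.
Proof.
move=> ab fd d0; apply/ler_addgt0Pr => e0 e00.
(* The added 1 covers the case a = b. *)
set e := e0 / (b - a + 1).
have ba1 : 0 < b - a + 1 by rewrite ltr_wpDl// subr_ge0.
have eP : 0 < e by rewrite divr_gt0.
suff H : f a - f b <= e * (b - a).
  rewrite -lerBlDl (le_trans H)// /e mulrAC ler_pdivrMr//.
  by rewrite ler_wpM2l ?(ltW e00)// lerDl.
pose S := [set x | a <= x <= b /\ f a - f x <= e * (x - a)].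
have Sa : S a by rewrite /S /= lexx ab !subrr mulr0.
have Sub : has_ubound S by exists b => x [/andP[]].
have hS : has_sup S by split; [exists a|].
pose c := sup S.
have ac : a <= c by exact: ub_le_sup.
have cb : c <= b by apply: sup_le_ub; [exists a|move=> x [/andP[]]].
have cab : a <= c <= b by rewrite ac.
have [d dP Hd] := fd c cab e eP.
have Sc : S c.
  split => //.
  have [x Sx cx] := sup_adherent dP hS.
  have xc : x <= c by exact: ub_le_sup.
  case: Sx => xab fx.
  have xcd : `|x - c| < d by rewrite distrC ger0_norm ?subr_ge0// ltrBlDr -ltrBlDl.
  have := Hd _ xab xcd; rewrite ler_norml => /andP[_ H].
  have : 0 <= df c * (c - x) by rewrite mulr_ge0 ?d0// subr_ge0.
  have : `|x - c| = c - x by rewrite distrC ger0_norm ?subr_ge0.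
  move=> E; rewrite E in H; nra.
have [<-|cneb] := eqVneq c b; first by case: Sc.
have {cneb}cltb : c < b by rewrite lt_neqAle cneb.
pose u := Num.min b (c + d / 2).
have cu : c < u by rewrite lt_min cltb ltrDl divr_gt0.
have ub : u <= b by rewrite ge_min lexx.
have uab : a <= u <= b by rewrite ub (le_trans ac)// ltW.
suff /(ub_le_sup Sub) : S u by rewrite leNgt cu.
split => //.
have ucd : `|u - c| < d.
  rewrite ger0_norm ?subr_ge0 ?(ltW cu)// ltrBlDl gt_min.
  by apply/orP; right; rewrite ltrD2l; lra.
have := Hd _ uab ucd; rewrite ler_norml => /andP[H _].
have : 0 <= df c * (u - c) by rewrite mulr_ge0 ?d0// subr_ge0 ltW.
have E : `|u - c| = u - c by rewrite ger0_norm ?subr_ge0// ltW.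
case: Sc => _; rewrite E in H; nra.
Qed.

Lemma has_derivN lo hi f t l : has_deriv lo hi f t l ->
  has_deriv lo hi (fun u => - f u) t (- l).
Proof.
move=> /(has_derivZ (-1)); rewrite mulN1r.
by apply: eq_has_deriv => [|u _]; rewrite mulN1r.
Qed.

Lemma has_deriv_compare f df g dg a b : a <= b ->
  (forall t, a <= t <= b -> has_deriv a b f t (df t)) ->
  (forall t, a <= t <= b -> has_deriv a b g t (dg t)) ->
  (forall t, a <= t <= b -> `|df t| <= dg t) -> `|f b - f a| <= g b - g a.
Proof.
move=> ab fd gd H.
have h1 : g a + f a <= g b + f b.
  apply: (@has_deriv_nondec (fun u => g u + f u) (fun u => dg u + df u)) => // t tab.
    by apply: has_derivD; [exact: gd|exact: fd].
  by have := H _ tab; rewrite ler_norml => /andP[]; lra.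
have h2 : g a - f a <= g b - f b.
  apply: (@has_deriv_nondec (fun u => g u - f u) (fun u => dg u - df u)) => // t tab.
    by apply: has_derivD; [exact: gd|apply: has_derivN; exact: fd].
  by have := H _ tab; rewrite ler_norml => /andP[]; lra.
rewrite ler_norml; apply/andP; split; lra.
Qed.

(* Taylor's formula with the remainder bounded through a pointwise top
   derivative, which need not be continuous. *)
Lemma taylor_bound lo hi (g : nat -> R -> R) N (M : R) a b :
  (forall i t, (i < N)%N -> lo <= t <= hi -> has_deriv lo hi (g i) t (g i.+1 t)) ->
  (forall t, lo <= t <= hi -> `|g N t| <= M) ->
  lo <= a <= hi -> lo <= b <= hi ->
  `|g 0%N b - \sum_(i < N) (g i a / i`!%:R) * (b - a) ^+ i| <= M * `|b - a| ^+ N / N`!%:R.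
Proof.
elim: N g b => [|N IH] g b gd gM la lb.
  by rewrite big_ord0 subr0 expr0 mulr1 fact0 divr1 gM.
pose P u := \sum_(i < N.+1) (g i a / i`!%:R) * (u - a) ^+ i.
pose Q u := \sum_(i < N) (g i.+1 a / i`!%:R) * (u - a) ^+ i.
have PQ t : has_deriv lo hi P t (Q t).
  rewrite (_ : Q t = \sum_(i < N.+1) (g i a / i`!%:R) * (i%:R * (t - a) ^+ i.-1)); last first.
    rewrite big_ord_recl mul0r mulr0 add0r; apply: eq_bigr => i _.
    rewrite lift0 factS natrM [RHS]mulrA; congr (_ * _).
    have n0 : (i`!%:R : R) != 0 by rewrite pnatr_eq0 -lt0n fact_gt0.
    by field; rewrite n0 addrC natr1 pnatr_eq0.
  apply: (has_deriv_sum (F := fun i u => (g i a / i`!%:R) * (u - a) ^+ i)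
    (L := fun i => (g i a / i`!%:R) * (i%:R * (t - a) ^+ i.-1))) => i _.
  by apply: has_derivZ; exact: has_derivX.
pose F u := g 0%N u - P u.
pose dF u := g 1%N u - Q u.
have FdF t : lo <= t <= hi -> has_deriv lo hi F t (dF t).
  by move=> lt; apply: has_derivD; [exact: gd|apply: has_derivN].
have dFM t : lo <= t <= hi -> `|dF t| <= M * `|t - a| ^+ N / N`!%:R.
  move=> lt; apply: (IH (fun i => g i.+1)) => // i u iN lu; exact: gd.
have Fa : F a = 0.
  rewrite /F /P big_ord_recl big1 => [|i _]; last by rewrite subrr expr0n mulr0.
  by rewrite expr0 mulr1 fact0 divr1 addr0 subrr.
have n0 : (N`!%:R : R) != 0 by rewrite pnatr_eq0 -lt0n fact_gt0.
have n1 : (N.+1%:R : R) != 0 by rewrite pnatr_eq0.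
case/andP: la => la1 la2; case/andP: lb => lb1 lb2.
have [ab|/ltW ba] := leP a b.
  pose G u := M / N.+1`!%:R * (u - a) ^+ N.+1.
  have := @has_deriv_compare F dF G (fun u => M / N.+1`!%:R * (N.+1%:R * (u - a) ^+ N)) a b ab.
  rewrite Fa subr0 /G subrr expr0n /= mulr0 subr0.
  rewrite (ger0_norm (_ : 0 <= b - a)) ?subr_ge0// [M * _ / _]mulrAC.
  apply.
  - move=> t /andP[t1 t2]; apply: has_deriv_sub (FdF _ _) => //.
    by rewrite (le_trans la1)// (le_trans t2).
  - by move=> t _; apply: has_derivZ; exact: has_derivX.
  - move=> t /andP[t1 t2]; rewrite (le_trans (dFM _ _))//.
      by rewrite (le_trans la1)// (le_trans t2).
    rewrite ger0_norm ?subr_ge0// factS natrM.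
    apply: eq_ler; field.
    by rewrite n0 addrC natr1 n1.
(* On [b, a] this is - M (a - u)^(N+1) / (N+1)!, written in powers of u - a; its derivative M (a -
   u)^N / N! dominates the remainder of the derivative. *)
pose G u := - (M / N.+1`!%:R * (- 1) ^+ N * (u - a) ^+ N.+1 * (-1)).
have := @has_deriv_compare F dF G
  (fun u => - (M / N.+1`!%:R * (-1) ^+ N * (N.+1%:R * (u - a) ^+ N) * (- 1))) b a ba.
rewrite Fa sub0r normrN /G subrr expr0n /= mulr0 mul0r oppr0 sub0r opprK.
have -> : M / N.+1`!%:R * (-1) ^+ N * (b - a) ^+ N.+1 * -1 = M * `|b - a| ^+ N.+1 / N.+1`!%:R.
  rewrite distrC ger0_norm ?subr_ge0// (_ : a - b = -1 * (b - a)); last by ring.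
  by rewrite exprMn !exprS; ring.
apply.
- move=> t /andP[t1 t2]; apply: has_deriv_sub (FdF _ _) => //.
  by rewrite (le_trans lb1)// (le_trans t2).
- move=> t _.
  have := has_derivN (has_derivZ (-1) (has_derivZ (M / N.+1`!%:R * (-1) ^+ N)
    (@has_derivX b a a t N.+1))).
  rewrite [-1 * _]mulrC.
  by apply: eq_has_deriv => [|u _]; rewrite [-1 * _]mulrC.
- move=> t /andP[t1 t2]; rewrite (le_trans (dFM _ _))//.
    by rewrite (le_trans lb1)// (le_trans t2).
  rewrite distrC ger0_norm ?subr_ge0// (_ : a - t = -1 * (t - a)); last by ring.
  rewrite exprMn factS natrM.
  apply: eq_ler; field.
  by rewrite n0 addrC natr1 n1.
Qed.

End RelativeDerivative.

(** * Agreement with the derivatives on [0, T] defined by limits *)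

Section DerivOn.
Variables (R : realType) (T : R).
Hypothesis T0 : 0 < T.
Implicit Types (f : R -> R) (t l : R).

(** At least one side of t inside [0, T] has length T / 2 or more, so t is a limit point of the
    interval. Properness of the filter is what makes the derivative unique. *)
Lemma proper_within_itv t : 0 <= t <= T ->
  ProperFilter (within `[0, T]%classic t^').
Proof.
move=> /andP[t0 tT].
apply: Build_ProperFilter_ex => P.
rewrite /within /dnbhs /= /within /= => -[e /= e0 He].
have [tT2|tT2] := leP t (T / 2).
  pose d := Num.min (e / 2) (T / 2).
  have d0 : 0 < d by rewrite lt_min !divr_gt0.
  have de : d < e by rewrite gt_min; apply/orP; left; lra.
  have dT : d <= T / 2 by rewrite ge_min lexx orbT.
  exists (t + d); apply: He.
  - by rewrite /ball /= opprD addrA subrr sub0r normrN gtr0_norm.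
  - by rewrite gt_eqF// ltrDl.
  - by rewrite /= in_itv /=; apply/andP; split; lra.
pose d := Num.min (e / 2) (T / 2).
have d0 : 0 < d by rewrite lt_min !divr_gt0.
have de : d < e by rewrite gt_min; apply/orP; left; lra.
have dT : d <= T / 2 by rewrite ge_min lexx orbT.
exists (t - d); apply: He.
- by rewrite /ball /= opprB addrC subrK gtr0_norm.
- by rewrite lt_eqF// ltrBlDr ltrDl.
- by rewrite /= in_itv /=; apply/andP; split; lra.
Qed.

Lemma cvg_has_deriv f t l :
  (f u - f t) / (u - t) @[u --> within `[0, T]%classic t^'] --> l <->
  has_deriv 0 T f t l.
Proof.
split.
- move=> /cvgrPdist_le H e e0; have := H _ e0.
  rewrite near_withinE /dnbhs /= near_withinE => -[d /= d0 Hd].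
  exists d => // u u0T ud.
  have [->|ut] := eqVneq u t; first by rewrite !subrr mulr0 subr0 !normr0 mulr0.
  have {Hd} := Hd u _ ut _.
  rewrite /ball /= distrC => /(_ ud); rewrite in_itv => /(_ u0T).
  have ut0 : 0 < `|u - t| by rewrite normr_gt0 subr_eq0.
  rewrite -(ler_pM2r ut0) -normrM mulrBl divfK ?subr_eq0// distrC.
  exact.
- move=> H; apply/cvgrPdist_le => e e0; have [d d0 Hd] := H _ e0.
  rewrite near_withinE /dnbhs /= near_withinE; exists d => //= u.
  rewrite /ball /= distrC => ud ut; rewrite in_itv => /= u0T.
  have ut0 : 0 < `|u - t| by rewrite normr_gt0 subr_eq0.
  rewrite -(ler_pM2r ut0) -normrM mulrBl divfK ?subr_eq0// distrC.
  exact: Hd.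
Qed.

Lemma derivable_on_has_deriv f t : derivable_on T f t ->
  has_deriv 0 T f t (deriv_on T f t).
Proof. by move=> fd; apply/cvg_has_deriv. Qed.

Lemma has_deriv_derivable_on f t l : has_deriv 0 T f t l -> derivable_on T f t.
Proof. by move/cvg_has_deriv => fl; apply/cvg_ex; exists l. Qed.

Lemma has_deriv_deriv_on f t l : 0 <= t <= T -> has_deriv 0 T f t l ->
  deriv_on T f t = l.
Proof.
move=> /proper_within_itv F /cvg_has_deriv fl.
exact: (@cvg_lim _ (@Rhausdorff R) _ _ F).
Qed.

End DerivOn.

(** * Expansions of separately smooth functions *)

Section Expansion.
Variable R : realType.
Implicit Types (rho eps M E : R) (W : R -> R -> R) (c d : nat -> nat -> R).

Lemma half_expn_le_inv l : (1 / 2 : R) ^+ l <= l.+1%:R^-1.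
Proof.
rewrite div1r exprVn lef_pV2 ?posrE ?exprn_gt0// -natrX ler_nat.
by elim: l => // l IH; rewrite expnS mul2n -addnn -addn1 leq_add// expn_gt0.
Qed.

Lemma le_half_expn_eq0 (x C : R) : (forall l, `|x| <= C * (1 / 2) ^+ l) -> x = 0.
Proof.
move=> H; apply/eqP; rewrite -normr_le0; apply/ler_addgt0Pr => e e0.
rewrite add0r.
have C0 : 0 <= C by have := H 0%N; rewrite mulr1; apply: le_trans.
have [n Hn] : exists n, C / e < n%:R.
  by exists (Num.bound (C / e)); apply: archi_boundP; rewrite divr_ge0// ltW.
rewrite (le_trans (H n))// (le_trans (ler_wpM2l C0 (half_expn_le_inv n)))//.
rewrite ler_pdivrMr ?ltr0n// mulrC -ler_pdivrMr// (le_trans (ltW Hn))//.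
by rewrite ler_nat.
Qed.

(** Since p <= 1/2, the intervals with centre a_l and radius 2 B p^l are nested, and the supremum of
    their left ends lies in all of them. *)
Lemma geometric_limit (a : nat -> R) (B p : R) : 0 <= p <= 1 / 2 ->
  (forall l, `|a l.+1 - a l| <= B * p ^+ l) ->
  exists x, forall l, `|x - a l| <= 2 * B * p ^+ l.
Proof.
move=> /andP[p0 p2] H.
have B0 : 0 <= B by have := H 0%N; rewrite mulr1; apply: le_trans.
have Bp l : 0 <= B * p ^+ l by rewrite mulr_ge0 ?exprn_ge0.
have step l : 2 * B * p ^+ l.+1 <= B * p ^+ l.
  rewrite exprS; have := Bp l; nra.
have lowS l : a l - 2 * B * p ^+ l <= a l.+1 - 2 * B * p ^+ l.+1.
  have := H l; rewrite ler_norml => /andP[H1 _]; have := step l; lra.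
have uppS l : a l.+1 + 2 * B * p ^+ l.+1 <= a l + 2 * B * p ^+ l.
  have := H l; rewrite ler_norml => /andP[_ H1]; have := step l; lra.
have low l m : (l <= m)%N -> a l - 2 * B * p ^+ l <= a m - 2 * B * p ^+ m.
  by move=> /subnK <-; elim: (m - l)%N => // n IH; exact: (le_trans IH (lowS _)).
have upp l m : (l <= m)%N -> a m + 2 * B * p ^+ m <= a l + 2 * B * p ^+ l.
  by move=> /subnK <-; elim: (m - l)%N => // n IH; exact: (le_trans (uppS _) IH).
have lu l m : a l - 2 * B * p ^+ l <= a m + 2 * B * p ^+ m.
  have H1 := low l _ (leq_maxl l m); have H2 := upp m _ (leq_maxr l m).
  have := Bp (maxn l m); lra.
pose S := [set a l - 2 * B * p ^+ l | l in [set: nat]].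
have hS : has_ubound S.
  by exists (a 0%N + 2 * B * p ^+ 0) => _ [l _ <-].
exists (sup S) => l; rewrite ler_norml; apply/andP; split.
  have : a l - 2 * B * p ^+ l <= sup S by apply: ub_le_sup => //; exists l.
  lra.
have : sup S <= a l + 2 * B * p ^+ l.
  by apply: sup_le_ub; [exists (a 0%N - 2 * B * p ^+ 0), 0%N|move=> _ [m _ <-]].
lra.
Qed.

Lemma icoefZ N (g : R -> R) (a : R) i :
  icoef N (fun x => a * g x) i = a * icoef N g i.
Proof.
rewrite (_ : (fun x => _) = (fun x => g x + (a - 1) * g x)); last first.
  by apply/funext => x; ring.
by rewrite icoefD; ring.
Qed.

Lemma sum_pow_bound N (b : nat -> R) (v : R) : `|v| <= 1 ->
  `|\sum_(j < N) b j * v ^+ j| <= \sum_(j < N) `|b j|.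
Proof.
move=> v1; rewrite (le_trans (ler_norm_sum _ _ _))//; apply: ler_sum => j _.
by rewrite normrM normrX ler_piMr// exprn_ile1.
Qed.

(** Interpolation is linear and reproduces polynomials of degree below N, so the difference is the
    interpolant of a remainder bounded by M. *)
Lemma icoef_remainder N (g : R -> R) (z : nat -> R) M :
  (forall v, 0 <= v <= 1 -> `|g v - \sum_(j < N) z j * v ^+ j| <= M) ->
  forall v, `|v| <= 1 ->
  `|\sum_(j < N) icoef N g j * v ^+ j - \sum_(j < N) z j * v ^+ j| <= 8 ^+ N * M.
Proof.
move=> H v v1; rewrite -sumrB.
pose h x := g x - \sum_(j < N) z j * x ^+ j.
apply: le_trans (icoef_bound N (g := h) H).
rewrite (le_trans _ (sum_pow_bound N (icoef N h) v1))//.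
rewrite le_eqVlt; apply/orP; left; apply/eqP; congr `|_|.
apply: eq_bigr => j _; rewrite -mulrBl; congr (_ * _).
rewrite -(@icoef_poly _ N z (fun x => \sum_(j < N) z j * x ^+ j) j)//.
rewrite (_ : h = fun x => g x + (-1) * \sum_(j < N) z j * x ^+ j); last first.
  by apply/funext => x; rewrite mulN1r.
by rewrite icoefD mulN1r.
Qed.

Lemma ler_dist3 (a b c d x y z : R) : `|a - b| <= x -> `|b - c| <= y ->
  `|c - d| <= z -> `|a - d| <= x + y + z.
Proof.
move=> H1 H2 H3; rewrite (_ : a - d = (a - b) + (b - c) + (c - d)); last by ring.
by rewrite (le_trans (ler_normD _ _))// lerD// (le_trans (ler_normD _ _))// lerD.
Qed.

(* The polynomial is Taylor in the first variable and interpolation in the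
   second; only the interpolation operator has to be bounded. *)
Lemma taylor_interp_bound N W (w z : nat -> R -> R) (J : R -> Prop) M :
  (forall u, 0 <= u <= 1 -> J u) -> (forall u, J u -> `|u| <= 1) ->
  (forall u v, J u -> J v -> `|W u v - \sum_(i < N) w i v * u ^+ i| <= M) ->
  (forall u v, J u -> J v -> `|W u v - \sum_(j < N) z j u * v ^+ j| <= M) ->
  forall u v, J u -> J v ->
  `|W u v - poly2 N (fun i j => icoef N (w i) j) u v| <= 3 * 8 ^+ N * M.
Proof.
move=> J01 J1 Hw Hz u v Ju Jv.
have M0 : 0 <= M by apply: le_trans (Hz _ _ Ju Jv).
have H1 := Hz u v Ju Jv.
have H2 : `|\sum_(j < N) z j u * v ^+ j - \sum_(j < N) icoef N (W u) j * v ^+ j| <= 8 ^+ N * M.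
  rewrite distrC; apply: (@icoef_remainder N (W u) (z ^~ u)) (J1 _ Jv) => x x01.
  by apply: Hz => //; exact: J01.
(* For fixed u, interpolation in the second variable is applied to W(u, .) minus its Taylor
   polynomial in u, which is at most M. The three distances are M, 8^N M and 8^N M, hence the factor
   3 * 8^N. *)
have H3 : `|\sum_(j < N) icoef N (W u) j * v ^+ j -
    poly2 N (fun i j => icoef N (w i) j) u v| <= 8 ^+ N * M.
  pose h x := W u x + (-1) * \sum_(i < N) u ^+ i * w i x.
  have hM x : 0 <= x <= 1 -> `|h x| <= M.
    move=> /J01 Jx; rewrite /h mulN1r.
    under eq_bigr => i _ do rewrite mulrC.
    exact: Hw.
  apply: le_trans (icoef_bound N hM).
  rewrite (le_trans _ (sum_pow_bound N (icoef N h) (J1 _ Jv)))//.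
  rewrite le_eqVlt; apply/orP; left; apply/eqP; congr `|_|.
  rewrite /poly2.
  under [X in _ - X]eq_bigr => i _ do rewrite mulr_suml.
  rewrite exchange_big /= -sumrB; apply: eq_bigr => j _.
  rewrite /h icoefD mulN1r icoef_sum mulrBl mulr_suml; congr (_ - _).
  by apply: eq_bigr => i _; ring.
rewrite (le_trans (ler_dist3 H1 H2 H3))//.
have : 1 <= (8 : R) ^+ N by rewrite exprn_ege1// ler1n.
by move=> ?; nra.
Qed.

Definition scaled_icoef N (w : nat -> R -> R) rho i j : R :=
  icoef N (fun y => w i (rho * y)) j / rho ^+ j.

(** The nodes lie in [0, rho], but the estimate holds at all points of J within distance rho of 0,
    on either side: bounding by the sum of absolute coefficients uses only the modulus of the
    variable. *)
Lemma taylor_interp_scaled N W (w z : nat -> R -> R) (J : R -> Prop) M rho :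
  0 < rho <= 1 ->
  (forall u, 0 <= u <= 1 -> J u) ->
  (forall u v, J u -> J v -> `|W u v - \sum_(i < N) w i v * u ^+ i| <= M * `|u| ^+ N) ->
  (forall u v, J u -> J v -> `|W u v - \sum_(j < N) z j u * v ^+ j| <= M * `|v| ^+ N) ->
  forall u v, J u -> J v -> `|u| <= rho -> `|v| <= rho ->
  `|W u v - poly2 N (scaled_icoef N w rho) u v| <= 3 * 8 ^+ N * (M * rho ^+ N).
Proof.
move=> /andP[r0 r1] J01 Hw Hz u v Ju Jv ur vr.
have M0 : 0 <= M.
  have J1 : J 1 by apply: J01; rewrite ler01 lexx.
  by have := Hw _ _ J1 J1; rewrite normr1 expr1n mulr1; apply: le_trans.
have rn0 : rho != 0 by rewrite gt_eqF.
pose J' x := J (rho * x) /\ `|x| <= 1.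
have Mr x : `|x| <= 1 -> M * `|rho * x| ^+ N <= M * rho ^+ N.
  move=> x1; rewrite ler_wpM2l// lerXn2r ?nnegrE ?(ltW r0)//.
  by rewrite normrM gtr0_norm// ler_piMr// ltW.
have := @taylor_interp_bound N (fun x y => W (rho * x) (rho * y))
  (fun i y => rho ^+ i * w i (rho * y)) (fun j x => rho ^+ j * z j (rho * x)) J' (M * rho ^+ N) _ _ _ _ (u / rho) (v / rho).
have E x : rho * (x / rho) = x by rewrite mulrCA mulfV ?mulr1.
rewrite !E.
have -> : poly2 N (fun i j => icoef N (fun y => rho ^+ i * w i (rho * y)) j) (u / rho) (v / rho)
   = poly2 N (scaled_icoef N w rho) u v.
  rewrite /poly2; apply: eq_bigr => i _.
  rewrite !mulr_suml; apply: eq_bigr => j _.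
  rewrite icoefZ /scaled_icoef !expr_div_n; field.
  by rewrite !expf_neq0.
have Jr x : J x -> `|x| <= rho -> J' (x / rho).
  by move=> Jx xr; rewrite /J' E normrM normfV (gtr0_norm r0) ler_pdivrMr// mul1r.
apply; [| | | |exact: Jr|exact: Jr].
- move=> x /andP[x0 x1]; split; last by rewrite ger0_norm.
  by apply: J01; rewrite mulr_ge0 ?(ltW r0)//= mulr_ile1// ltW.
- by move=> x [].
- move=> x y [Jx x1] [Jy y1].
  apply: le_trans (Mr _ x1).
  apply: le_trans (Hw _ _ Jx Jy); rewrite le_eqVlt; apply/orP; left; apply/eqP.
  by congr `|_ - _|; apply: eq_bigr => i _; rewrite exprMn; ring.
- move=> x y [Jx x1] [Jy y1].
  apply: le_trans (Mr _ y1).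
  apply: le_trans (Hz _ _ Jx Jy); rewrite le_eqVlt; apply/orP; left; apply/eqP.
  by congr `|_ - _|; apply: eq_bigr => i _; rewrite exprMn; ring.
Qed.

Lemma poly2_le N c (rho B u v : R) : 0 <= rho -> `|u| <= rho -> `|v| <= rho ->
  (forall i j, (i < N)%N -> (j < N)%N -> `|c i j| * rho ^+ (i + j) <= B) ->
  `|poly2 N c u v| <= N%:R ^+ 2 * B.
Proof.
move=> r0 ur vr cB; rewrite /poly2 (le_trans (ler_norm_sum _ _ _))//.
have -> : N%:R ^+ 2 * B = \sum_(i < N) \sum_(j < N) B.
  by rewrite !sumr_const !card_ord expr2 -mulrA !mulr_natl.
apply: ler_sum => i _; rewrite mulr_suml (le_trans (ler_norm_sum _ _ _))//.
apply: ler_sum => j _; rewrite !normrM !normrX.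
rewrite (le_trans _ (cB i j _ _))// exprD -mulrA ler_wpM2l// mulrC.
by rewrite ler_pM ?exprn_ge0// lerXn2r ?nnegrE.
Qed.

(** This absorbs the logarithmic factor. With th = 2^(-eps) one has 2 th > 1 because eps < 1, and
    Bernoulli's inequality gives (2 th)^l >= 1 + l (2 th - 1) >= (l + 1) (2 th - 1). *)
Lemma half_powR_bound eps l : 0 <= eps < 1 ->
  l.+1%:R * (1 / 2) ^+ l <= (2 * (1 / 2) `^ eps - 1)^-1 * ((1 / 2) ^+ l) `^ eps.
Proof.
move=> /andP[e0 e1].
set th := (1 / 2) `^ eps.
have th1 : 1 / 2 < th.
  rewrite -[ltLHS](@powRr1 _ (1/2)) /th; last by lra.
  by rewrite /powR gt_eqF; [rewrite ltr_expR ltr_nM2r ?ln_lt0; lra|lra].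
have th2 : th <= 1.
  have h : 0 < (1 / 2 : R) <= 1 by apply/andP; split; lra.
  by have := ger_powR h e0; rewrite powRr0.
have -> : ((1 / 2) ^+ l) `^ eps = th ^+ l :> R.
  rewrite -powR_mulrn; last by lra.
  by rewrite powRAC powR_mulrn// powR_ge0.
have x0 : 0 < 2 * th - 1 by lra.
rewrite mulrC [leRHS]mulrC ler_pdivlMr// -mulrA.
have -> : th ^+ l = (1 / 2) ^+ l * (2 * th) ^+ l.
  by rewrite -exprMn; congr (_ ^+ _); lra.
rewrite ler_wpM2l ?exprn_ge0//.
have bern n : 1 + n%:R * (2 * th - 1) <= (2 * th) ^+ n.
  elim: n => [|n IH]; first by rewrite mul0r addr0.
  have n0 : (0 : R) <= n%:R by [].
  have n0' : 0 <= n%:R * (2 * th - 1) by rewrite mulr_ge0// ltW.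
  rewrite exprS -natr1; nra.
by apply: le_trans (bern l); rewrite -natr1 mulrDl mul1r addrC lerD2r; lra.
Qed.

Lemma half_scale rho : 0 < rho <= 1 ->
  exists l, (1 / 2) ^+ l.+1 < rho /\ rho <= (1 / 2) ^+ l.
Proof.
move=> /andP[r0 r1].
have ex : exists l, (1 / 2) ^+ l.+1 < rho.
  have [n Hn] : exists n, rho^-1 < n%:R.
    by exists (Num.bound (rho^-1)); apply: archi_boundP; rewrite invr_ge0 ltW.
  exists n; rewrite (le_lt_trans (half_expn_le_inv _))// invf_plt ?posrE//.
  by rewrite (lt_le_trans Hn)// ler_nat -addn2 leq_addr.
have [l Hl lmin] := ex_minnP ex.
exists l; split => //; case: l Hl lmin => [|l] // Hl lmin.
by rewrite leNgt; apply/negP => /lmin; rewrite ltnn.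
Qed.

(** The 8 is the cost of interpolation, 64 the cost of reading off a coefficient in two variables,
    and 4 the cost of halving the scale, since 2^(i+j) <= 4^N for i, j < N. *)
Definition expansion_base : R := 4 * (64 * 8).

Lemma expansion_base_ge : 1 <= expansion_base.
Proof. by rewrite /expansion_base; lra. Qed.

Lemma expansion_baseX_ge0 N : 0 <= expansion_base ^+ N.
Proof. by rewrite exprn_ge0// (le_trans ler01 expansion_base_ge). Qed.

(** The bracket is the error at scale rho_l = 2^(-l) per unit of (l + 1) rho_l^N, with N^2 counting
    coefficients; the inverse comes from [half_powR_bound], and 2^N from replacing rho_l by a radius
    greater than rho_l / 2. *)
Definition expansion_const N eps : R :=
  (3 * 8 ^+ N + N%:R ^+ 2 * (15 * expansion_base ^+ N)) * (2 * (1 / 2) `^ eps - 1)^-1 * 2 ^+ N.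

(** Coefficients of order at least N need not converge as the scale 2^(-l) decreases, but they grow
    at most like (l + 1) 2^(-l (N - i - j)). Dropping them costs (l + 1) 2^(-l N), the logarithmic
    loss that the last conclusion trades for the exponent N - 1 + eps. The third conclusion compares
    d with an arbitrary approximating polynomial c; bounds on d will come from suitable choices of
    c. *)
Theorem joint_expansion N W (w z : nat -> R -> R) (J : R -> Prop) M :
  (0 < N)%N ->
  (forall u, 0 <= u <= 1 -> J u) ->
  (forall u v, J u -> J v -> `|W u v - \sum_(i < N) w i v * u ^+ i| <= M * `|u| ^+ N) ->
  (forall u v, J u -> J v -> `|W u v - \sum_(j < N) z j u * v ^+ j| <= M * `|v| ^+ N) ->
  exists d : nat -> nat -> R,
  [/\ forall i j, (N <= i + j)%N -> d i j = 0,
      forall i, (i < N)%N -> d i 0%N = w i 0,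
      forall c E, (forall u v, 0 <= u <= 1 -> 0 <= v <= 1 -> `|W u v - poly2 N c u v| <= E) ->
        forall i j, (i + j < N)%N -> `|d i j - c i j| <= 15 * expansion_base ^+ N * (E + M) &
      forall eps E, 0 <= eps < 1 ->
        (forall u v, 0 <= u <= 1 -> 0 <= v <= 1 -> `|W u v| <= E) ->
        forall rho u v, 0 < rho <= 1 -> J u -> J v -> `|u| <= rho -> `|v| <= rho ->
        `|W u v - poly2 N d u v| <=
          expansion_const N eps * (E + M) * (rho ^+ N.-1 * rho `^ eps)].
Proof.
move=> N0 J01 Hw Hz.
have M0 : 0 <= M.
  have J1 : J 1 by apply: J01; rewrite ler01 lexx.
  by have := Hw _ _ J1 J1; rewrite normr1 expr1n mulr1; apply: le_trans.
pose rho l : R := (1 / 2) ^+ l.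
have rho0 l : 0 < rho l by rewrite exprn_gt0//; lra.
have rho1 l : rho l <= 1 by rewrite exprn_ile1//; lra.
have rho01 l : 0 < rho l <= 1 by rewrite rho0 rho1.
pose q l i j := scaled_icoef N w (rho l) i j.
have approx l u v : J u -> J v -> `|u| <= rho l -> `|v| <= rho l ->
    `|W u v - poly2 N (q l) u v| <= 3 * 8 ^+ N * (M * rho l ^+ N).
  exact: (taylor_interp_scaled (rho01 l) J01 Hw Hz).
pose B := 6 * expansion_base ^+ N * M.
have K1 (a b : R) : a ^+ N * b ^+ N = (a * b) ^+ N by rewrite exprMn.
have base0 := expansion_baseX_ge0 N.
have B0 : 0 <= B by rewrite mulr_ge0// mulr_ge0.
(* The ratio for coefficients of order e: p(e)^l = rho_l^(N - e), at most 2^(-l) when e < N and at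
   least 1 when e >= N. *)
pose p e : R := 2 ^+ e * (1 / 2) ^+ N.
have p0 e : 0 <= p e by rewrite mulr_ge0 ?exprn_ge0//; lra.
have tw e : 2 ^+ e * (1 / 2) ^+ e = 1 :> R.
  by rewrite -exprMn (_ : 2 * (1 / 2) = 1) ?expr1n//; lra.
have p_half e : (e < N)%N -> p e <= 1 / 2.
  move=> eN; rewrite /p -(subnKC eN) addSnnS exprD mulrA tw mul1r exprS.
  by rewrite mul1r ler_piMr//; apply: exprn_ile1; lra.
have p_ge1 e : (N <= e)%N -> 1 <= p e.
  move=> eN; rewrite /p -(subnKC eN) exprD mulrAC tw mul1r.
  by apply: exprn_ege1; lra.
have pl e l : p e ^+ l * rho l ^+ e = rho l ^+ N.
  rewrite /p /rho exprMn -!exprM mulrAC (mulnC l e) -exprMn.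
  rewrite (_ : 2 * (1 / 2) = 1); last by lra.
  by rewrite expr1n mul1r mulnC.
(* Two consecutive approximations are compared on the smaller square; their errors 3 * 8^N M rho^N
   add up, which explains the 6 in [B]. *)
have qS l i j : (i < N)%N -> (j < N)%N ->
    `|q l.+1 i j - q l i j| <= B * p (i + j)%N ^+ l.
  move=> iN jN.
  have H u v : 0 <= u <= rho l.+1 -> 0 <= v <= rho l.+1 ->
      `|poly2 N (fun i j => q l.+1 i j - q l i j) u v| <= 6 * 8 ^+ N * (M * rho l ^+ N).
    move=> /andP[u0 u1] /andP[v0 v1].
    have rS : rho l.+1 <= rho l.
      by rewrite /rho exprS ler_piMl ?(ltW (rho0 l))//; lra.
    have u01 : J u by apply: J01; rewrite u0 (le_trans u1).
    have v01 : J v by apply: J01; rewrite v0 (le_trans v1).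
    have nu : `|u| <= rho l.+1 by rewrite ger0_norm.
    have nv : `|v| <= rho l.+1 by rewrite ger0_norm.
    have H1 := approx l.+1 _ _ u01 v01 nu nv.
    have H2 := approx l _ _ u01 v01 (le_trans nu rS) (le_trans nv rS).
    rewrite -poly2B (_ : _ - _ = (W u v - poly2 N (q l) u v) -
      (W u v - poly2 N (q l.+1) u v)); last by ring.
    rewrite (le_trans (ler_normB _ _))// (le_trans (lerD H2 H1))//.
    have : 3 * 8 ^+ N * (M * rho l.+1 ^+ N) <= 3 * 8 ^+ N * (M * rho l ^+ N).
      rewrite ler_wpM2l ?mulr_ge0 ?exprn_ge0// ler_wpM2l//.
      by rewrite lerXn2r ?nnegrE ?(ltW (rho0 _)).
    lra.
  have aux (x : R) (e : nat) : x * rho l ^+ e = 2 ^+ e * (x * rho l.+1 ^+ e).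
    rewrite [rho l.+1]exprS exprMn -/(rho l) [RHS]mulrCA.
    by rewrite [2 ^+ e * _]mulrA tw mul1r.
  have := poly2_coef_bound (ltW (rho0 l.+1)) iN jN H.
  set e := (i + j)%N; set x := `|_| => Hx.
  have re0 : 0 < rho l ^+ e by rewrite exprn_gt0.
  rewrite -(ler_pM2r re0) -mulrA pl.
  rewrite aux.
  have x0 : 0 <= x * rho l.+1 ^+ e by rewrite mulr_ge0 ?exprn_ge0 ?(ltW (rho0 _))// /x normr_ge0.
  rewrite (le_trans (_ : _ <= 4 ^+ N * (64 ^+ N * (6 * 8 ^+ N * (M * rho l ^+ N)))))//.
    rewrite ler_pM ?exprn_ge0//.
    rewrite (_ : 4 = 2 ^+ 2); last by rewrite expr2; lra.
    rewrite -exprM ler_weXn2l ?ler1n// mul2n -addnn leq_add// ltnW//.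
  rewrite le_eqVlt; apply/orP; left; apply/eqP.
  by rewrite /B /expansion_base !exprMn; ring.
have lim i j : exists x, (i + j < N)%N -> forall l, `|x - q l i j| <= 2 * B * p (i + j)%N ^+ l.
  have [ij|ij] := boolP (i + j < N)%N; last by exists 0.
  have [||x Hx] := @geometric_limit (fun l => q l i j) B (p (i + j)%N).
  - by rewrite p0 p_half.
  - move=> l; apply: qS; first exact: leq_ltn_trans (leq_addr _ _) ij.
    exact: leq_ltn_trans (leq_addl _ _) ij.
  by exists x.
pose d' i j := projT1 (cid (lim i j)).
have d'P i j := projT2 (cid (lim i j)).
pose d i j := if (i + j < N)%N then d' i j else 0.
have dP i j l : (i + j < N)%N -> `|d i j - q l i j| <= 2 * B * p (i + j)%N ^+ l.
  by move=> ij; rewrite /d ij; exact: d'P.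
have d0 i j : (N <= i + j)%N -> d i j = 0 by rewrite /d ltnNge => ->.
(* The constant 15 is 3 + 2 * 6: the error at scale 1, plus the distance 2 B from the coefficients
   at scale 1 to their limits. *)
have bound c E : (forall u v, 0 <= u <= 1 -> 0 <= v <= 1 -> `|W u v - poly2 N c u v| <= E) ->
    forall i j, (i < N)%N -> (j < N)%N ->
    `|q 0%N i j - c i j| + 2 * B <= 15 * expansion_base ^+ N * (E + M).
  move=> HE i j iN jN.
  have E0 : 0 <= E.
    by have := HE 0 0; rewrite lexx ler01 => /(_ isT isT); apply: le_trans.
  have H u v : 0 <= u <= 1 -> 0 <= v <= 1 ->
      `|poly2 N (fun i j => q 0%N i j - c i j) u v| <= E + 3 * 8 ^+ N * M.
    move=> u01 v01.
    have nu : `|u| <= rho 0%N by case/andP: u01 => ? ?; rewrite ger0_norm.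
    have nv : `|v| <= rho 0%N by case/andP: v01 => ? ?; rewrite ger0_norm.
    have := approx 0%N u v (J01 _ u01) (J01 _ v01) nu nv.
    rewrite [rho _]expr0 expr1n mulr1 => H1.
    rewrite -poly2B (_ : _ - _ = (W u v - poly2 N c u v) -
      (W u v - poly2 N (q 0%N) u v)); last by ring.
    by rewrite (le_trans (ler_normB _ _))// lerD// HE.
  have := @poly2_coef_bound _ N _ 1 _ i j ler01 iN jN H; rewrite expr1n mulr1.
  move=> H1; rewrite (le_trans (lerD H1 (lexx _)))// /B.
  have e1 : 64 ^+ N <= expansion_base ^+ N :> R.
    by rewrite /expansion_base lerXn2r ?nnegrE; lra.
  have e2 : 64 ^+ N * 8 ^+ N <= expansion_base ^+ N :> R.
    by rewrite K1 /expansion_base lerXn2r ?nnegrE; lra.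
  have e3 : 0 <= 64 ^+ N :> R by rewrite exprn_ge0.
  nra.
exists d; split => //.
(* 0 is a node at every scale, so the coefficient of order (i, 0) equals w i 0 for every l. *)
- move=> i iN; apply/eqP; rewrite -subr_eq0; apply/eqP.
  apply: (@le_half_expn_eq0 _ (2 * B)) => l.
  have iN0 : (i + 0 < N)%N by rewrite addn0.
  have := dP i 0%N l iN0; rewrite /q /scaled_icoef icoef0// mulr0 expr0 divr1.
  move=> /le_trans; apply; rewrite ler_wpM2l ?mulr_ge0// lerXn2r ?nnegrE ?p0 ?p_half ?addn0//; lra.
- move=> c E HE i j ij.
  have iN : (i < N)%N by exact: leq_ltn_trans (leq_addr _ _) ij.
  have jN : (j < N)%N by exact: leq_ltn_trans (leq_addl _ _) ij.
  apply: le_trans (bound c E HE i j iN jN).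
  have := dP i j 0%N ij; rewrite expr0 mulr1 => H1.
  rewrite (_ : d i j - c i j = (q 0%N i j - c i j) + (d i j - q 0%N i j)); last by ring.
  by rewrite (le_trans (ler_normD _ _))// lerD2l.
move=> eps E eps01 HE r u v r01 Ju Jv ur vr.
have E0 : 0 <= E.
  by have := HE 0 0; rewrite lexx ler01 => /(_ isT isT); apply: le_trans.
have [l [rl1 rl2]] := half_scale r01.
case/andP: r01 => r0 r1.
have C1 : `|W u v - poly2 N d u v| <=
    (3 * 8 ^+ N + N%:R ^+ 2 * (15 * expansion_base ^+ N)) * (E + M) * (l.+1%:R * rho l ^+ N).
  have H0 i j : (i < N)%N -> (j < N)%N -> `|q 0%N i j| + 2 * B <= 15 * expansion_base ^+ N * (E + M).
    move=> iN jN; have := bound (fun _ _ => 0) E _ i j iN jN; rewrite subr0; apply.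
    move=> x y x01 y01; rewrite (_ : poly2 _ _ _ _ = 0) ?subr0 ?HE//.
    by rewrite /poly2 big1// => k _; rewrite big1 ?mul0r// => m _; rewrite mul0r.
  have l1 : (1 : R) <= l.+1%:R by rewrite ler1n.
  have rN0 : 0 <= rho l ^+ N by rewrite exprn_ge0// ltW.
  have H1 : `|poly2 N (q l) u v - poly2 N d u v| <=
     N%:R ^+ 2 * (15 * expansion_base ^+ N * (E + M) * (l.+1%:R * rho l ^+ N)).
    rewrite poly2B; apply: (@poly2_le _ _ (rho l)); rewrite ?(ltW (rho0 l))//.
      exact: le_trans ur rl2.
      exact: le_trans vr rl2.
    move=> i j iN jN.
    suff H2 : `|q l i j - d i j| <= 15 * expansion_base ^+ N * (E + M) * (l.+1%:R * p (i + j)%N ^+ l).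
      rewrite -(pl (i + j)%N l) !mulrA ler_wpM2r ?exprn_ge0 ?(ltW (rho0 l))//.
      by rewrite -!mulrA in H2 *.
    have pe0 : 0 <= p (i + j)%N ^+ l by rewrite exprn_ge0.
    (* Here d is 0, and the coefficient at scale l is reached from scale 1 by l increments, each at
       most B p^l because p >= 1. *)
    have [ij|ij] := leqP N (i + j).
      rewrite d0// subr0 -[15 * _ * _ * _]mulrA.
      have p1 := p_ge1 _ ij.
      have ql m : `|q m i j| <= `|q 0%N i j| + m%:R * B * p (i + j)%N ^+ m.
        elim: m => [|m IH]; first by rewrite !mul0r addr0.
        rewrite -[q m.+1 i j](subrK (q m i j)) (le_trans (ler_normD _ _))//.
        rewrite (le_trans (lerD (qS m i j iN jN) IH))// addrCA lerD2l.
        have pm : 0 <= p (i + j)%N ^+ m by rewrite exprn_ge0.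
        rewrite exprS -natr1.
        have m0 : (0 : R) <= m%:R by [].
        have X0 : 0 <= B * p (i + j)%N ^+ m by rewrite mulr_ge0.
        have X1 : 0 <= m%:R * (B * p (i + j)%N ^+ m) by rewrite mulr_ge0.
        nra.
      rewrite (le_trans (ql l))// mulrA.
      have pl1 : 1 <= p (i + j)%N ^+ l by rewrite exprn_ege1.
      have := H0 i j iN jN.
      have lP : l.+1%:R = l%:R + 1 :> R by rewrite natr1.
      have l0 : (0 : R) <= l%:R by [].
      set Y := 15 * _ * _ => HY.
      have q0 : 0 <= `|q 0%N i j| by [].
      apply: (@le_trans _ _ ((`|q 0%N i j| + 2 * B) * l.+1%:R * p (i + j)%N ^+ l)).
        rewrite lP.
        have Z1 : 0 <= `|q 0%N i j| * l%:R by rewrite mulr_ge0.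
        have Z2 : 0 <= B * l%:R by rewrite mulr_ge0.
        have : `|q 0%N i j| <= (`|q 0%N i j| + `|q 0%N i j| * l%:R) * p (i + j)%N ^+ l.
          nra.
        have : l%:R * B * p (i + j)%N ^+ l <= (2 * B * (l%:R + 1)) * p (i + j)%N ^+ l.
          by rewrite ler_wpM2r//; nra.
        lra.
      have lp0 : 0 <= l.+1%:R * p (i + j)%N ^+ l by rewrite mulr_ge0.
      by have := ler_wpM2r lp0 HY; rewrite -!mulrA.
    rewrite distrC (le_trans (dP _ _ _ ij))// mulrA ler_wpM2r//.
    have := H0 i j iN jN; have q0 : 0 <= `|q 0%N i j| by [].
    set Y := 15 * _ * _ => HY; nra.
  have H2 := approx l u v Ju Jv (le_trans ur rl2) (le_trans vr rl2).
  rewrite (_ : _ - _ = (W u v - poly2 N (q l) u v) + (poly2 N (q l) u v - poly2 N d u v)); last by ring.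
  rewrite (le_trans (ler_normD _ _))// (le_trans (lerD H2 H1))//.
  rewrite [leRHS](_ : _ = 3 * 8 ^+ N * ((E + M) * (l.+1%:R * rho l ^+ N)) +
    N%:R ^+ 2 * (15 * expansion_base ^+ N * (E + M) * (l.+1%:R * rho l ^+ N))); last by ring.
  rewrite lerD2r; apply: ler_wpM2l; first by rewrite mulr_ge0 ?exprn_ge0.
  by apply: ler_pM => //; [rewrite lerDr|rewrite ler_peMl].
rewrite (le_trans C1)//.
have lE : l.+1%:R * rho l ^+ N = (l.+1%:R * rho l) * rho l ^+ N.-1.
  by rewrite -mulrA -exprS prednK.
rewrite lE.
have H1 := half_powR_bound l eps01.
have rl : rho l <= 2 * r.
  by move: rl1; rewrite exprS -/(rho l); lra.
have H2 : rho l `^ eps * rho l ^+ N.-1 <= 2 ^+ N * (r ^+ N.-1 * r `^ eps).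
  have h1 : rho l `^ eps <= 2 * r `^ eps.
    case/andP: eps01 => e0 e1.
    apply: (@le_trans _ _ ((2 * r) `^ eps)).
      by apply: ge0_ler_powR => //; rewrite nnegrE; [exact: ltW (rho0 l)|lra].
    rewrite powRM ?(ltW r0)// ler_wpM2r ?powR_ge0//.
    by rewrite -[leRHS]powRr1// ler_powR ?ler1n// ltW.
  have h2 : rho l ^+ N.-1 <= 2 ^+ N.-1 * r ^+ N.-1.
    by rewrite -exprMn lerXn2r ?nnegrE ?(ltW (rho0 l))//; lra.
  apply: (le_trans (ler_pM (powR_ge0 _ _) (exprn_ge0 _ (ltW (rho0 l))) h1 h2)).
  have -> : 2 ^+ N = 2 * 2 ^+ N.-1 :> R by rewrite -exprS prednK.
  by rewrite le_eqVlt; apply/orP; left; apply/eqP; ring.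
have EM : 0 <= E + M by rewrite addr_ge0.
set X := 3 * _ + _.
have X0 : 0 <= X.
  have base0' := expansion_baseX_ge0 N.
  rewrite /X; apply: addr_ge0; first by rewrite mulr_ge0 ?exprn_ge0.
  by apply: mulr_ge0; [rewrite exprn_ge0|rewrite mulr_ge0].
rewrite (le_trans (_ : _ <= X * (E + M) * ((2 * (1 / 2) `^ eps - 1)^-1 * (2 ^+ N * (r ^+ N.-1 * r `^ eps)))))//.
  rewrite ler_wpM2l ?mulr_ge0//.
  rewrite (le_trans (ler_wpM2r _ H1)) ?exprn_ge0 ?(ltW (rho0 l))//.
  rewrite -mulrA ler_wpM2l// invr_ge0.
  have : 1 / 2 <= (1 / 2 : R) `^ eps.
    by case/andP: eps01 => e0 e1; apply: ger1_powR; lra.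
  lra.
by rewrite /expansion_const -/X le_eqVlt; apply/orP; left; apply/eqP; ring.
Qed.

End Expansion.

(** * Expansions at a diagonal point and their dependence on that point *)

Section LocalExpansion.
Variable R : realType.
Implicit Types (H : R -> R -> R) (U V : nat -> R -> R -> R) (c : nat -> nat -> R).

Lemma poly2_scale N c (x u v : R) :
  poly2 N c (x * u) (x * v) = poly2 N (fun i j => c i j * x ^+ (i + j)) u v.
Proof.
rewrite /poly2; apply: eq_bigr => i _; rewrite !mulr_suml; apply: eq_bigr => j _.
by rewrite !exprMn exprD; ring.
Qed.

(* [U i] and [V j] are the pure derivatives of H in its first and second
   variable. *)
Definition pure_derivs (lo hi : R) N H U V (M : R) :=
  [/\ forall t tau, lo <= t <= hi -> lo <= tau <= hi -> U 0%N t tau = H t tau /\ V 0%N t tau = H t tau,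
      forall i t tau, (i < N)%N -> lo <= t <= hi -> lo <= tau <= hi ->
        has_deriv lo hi (fun x => U i x tau) t (U i.+1 t tau),
      forall j t tau, (j < N)%N -> lo <= t <= hi -> lo <= tau <= hi ->
        has_deriv lo hi (fun x => V j t x) tau (V j.+1 t tau),
      forall t tau, lo <= t <= hi -> lo <= tau <= hi -> `|U N t tau| <= M &
      forall t tau, lo <= t <= hi -> lo <= tau <= hi -> `|V N t tau| <= M].

Lemma between_itv (lo hi a b x : R) : lo <= a <= hi -> lo <= a + b <= hi ->
  0 <= x <= 1 -> lo <= a + b * x <= hi.
Proof. by move=> /andP[? ?] /andP[? ?] /andP[? ?]; apply/andP; split; nra. Qed.

(** The unit-square result in the variables (t - a) / del. A negative del places the square to the
    left of a, as needed near the right end of the interval. *)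
Lemma local_expansion (lo hi : R) N H U V M a del : (0 < N)%N ->
  pure_derivs lo hi N H U V M -> lo <= a <= hi -> lo <= a + del <= hi -> del != 0 ->
  exists d : nat -> nat -> R,
  [/\ forall i j, (N <= i + j)%N -> d i j = 0,
      forall i, (i < N)%N -> d i 0%N = U i a a / i`!%:R,
      forall c E, (forall u v, 0 <= u <= 1 -> 0 <= v <= 1 ->
          `|H (a + del * u) (a + del * v) - poly2 N c (del * u) (del * v)| <= E) ->
        forall i j, (i + j < N)%N ->
          `|d i j - c i j| * `|del| ^+ (i + j) <= 15 * expansion_base R ^+ N * (E + M * `|del| ^+ N / N`!%:R) &
      forall eps E, 0 <= eps < 1 ->
        (forall t tau, lo <= t <= hi -> lo <= tau <= hi -> `|H t tau| <= E) ->
        forall rho u v, 0 < rho <= `|del| ->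
        lo <= a + u <= hi -> lo <= a + v <= hi -> `|u| <= rho -> `|v| <= rho ->
        `|H (a + u) (a + v) - poly2 N d u v| <=
          expansion_const N eps * (E + M * `|del| ^+ N / N`!%:R) *
          ((rho / `|del|) ^+ N.-1 * (rho / `|del|) `^ eps)].
Proof.
move=> N0 [HUV HU HV UM VM] la lad del0.
pose J u := lo <= a + del * u <= hi.
have J01 u : 0 <= u <= 1 -> J u by exact: between_itv.
have J0 : J 0 by rewrite /J mulr0 addr0.
pose w i v := U i a (a + del * v) / i`!%:R * del ^+ i.
pose z j u := V j (a + del * u) a / j`!%:R * del ^+ j.
have [||d [d0 di0 dc de]] := @joint_expansion _ N
  (fun u v => H (a + del * u) (a + del * v)) w z J (M * `|del| ^+ N / N`!%:R) N0 J01.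
- move=> u v Ju Jv.
  have := @taylor_bound _ lo hi (fun i x => U i x (a + del * v)) N M a (a + del * u).
  move=> /(_ (fun i t iN lt => HU _ _ _ iN lt Jv) (fun t lt => UM _ _ lt Jv) la Ju).
  rewrite (HUV _ _ Ju Jv).1 addrAC subrr add0r normrM exprMn => H1.
  rewrite (_ : _ * `|u| ^+ N = M * (`|del| ^+ N * `|u| ^+ N) / N`!%:R); last by ring.
  apply: le_trans H1; rewrite le_eqVlt; apply/orP; left; apply/eqP; congr `|_ - _|.
  by apply: eq_bigr => i _; rewrite /w exprMn; ring.
- move=> u v Ju Jv.
  have := @taylor_bound _ lo hi (fun i x => V i (a + del * u) x) N M a (a + del * v).
  move=> /(_ (fun i t iN lt => HV _ _ _ iN Ju lt) (fun t lt => VM _ _ Ju lt) la Jv).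
  rewrite (HUV _ _ Ju Jv).2 addrAC subrr add0r normrM exprMn => H1.
  rewrite (_ : _ * `|v| ^+ N = M * (`|del| ^+ N * `|v| ^+ N) / N`!%:R); last by ring.
  apply: le_trans H1; rewrite le_eqVlt; apply/orP; left; apply/eqP; congr `|_ - _|.
  by apply: eq_bigr => i _; rewrite /z exprMn; ring.
have dn n : del ^+ n != 0 by rewrite expf_neq0.
exists (fun i j => d i j / del ^+ (i + j)); split.
- by move=> i j ij; rewrite d0// mul0r.
- by move=> i iN; rewrite di0// /w mulr0 addr0 addn0 mulfK.
- move=> c E HE i j ij.
  have -> : `|d i j / del ^+ (i + j) - c i j| * `|del| ^+ (i + j) =
      `|d i j - c i j * del ^+ (i + j)|.
    by rewrite -normrX -normrM mulrBl divfK.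
  apply: (dc (fun i j => c i j * del ^+ (i + j)) E) => // u v u01 v01.
  by rewrite -poly2_scale; exact: HE.
- move=> eps E eps01 HE rho u v /andP[r0 r1] lu lv ur vr.
  have nd : 0 < `|del| by rewrite normr_gt0.
  have Er x : del * (x / del) = x by rewrite mulrCA mulfV ?mulr1.
  have := de eps E eps01 _ (rho / `|del|) (u / del) (v / del).
  rewrite /J !Er !normrM !normfV ![_ / `|del| <= _]ler_pdivrMr// mul1r ![_ / `|del| * `|del|]divfK ?gt_eqF//.
  rewrite divr_gt0//= r1 => H1.
  have -> : poly2 N (fun i j => d i j / del ^+ (i + j)) u v = poly2 N d (u / del) (v / del).
    rewrite -{1}(Er u) -{1}(Er v) poly2_scale; apply: eq_bigr => i _; congr (_ * _).
    by apply: eq_bigr => j _; rewrite divfK.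
  by apply: H1 => // x y x01 y01; apply: HE; exact: J01.
Qed.

(** Coefficients after recentring at (x, x). The truncated subtractions are harmless, since the
    binomial coefficients vanish when p < i or q < j. *)
Definition poly2_shift N c (x : R) (i j : nat) : R :=
  \sum_(p < N) \sum_(q < N)
    c p q * ('C(p, i)%:R * 'C(q, j)%:R) * x ^+ ((p - i) + (q - j)).

Lemma exprD_ord N p (u x : R) : (p < N)%N ->
  (u + x) ^+ p = \sum_(i < N) 'C(p, i)%:R * x ^+ (p - i) * u ^+ i.
Proof.
move=> pN; rewrite addrC exprDn (big_ord_widen N (fun i => (x ^+ (p - i) * u ^+ i) *+ 'C(p, i)))//.
rewrite big_mkcond /=; apply: eq_bigr => i _; rewrite ltnS.
by case: leqP => [_|pi]; [rewrite -mulr_natl mulrA|rewrite bin_small// !mul0r].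
Qed.

Lemma poly2_shiftE N c (x u v : R) :
  poly2 N c (u + x) (v + x) = poly2 N (poly2_shift N c x) u v.
Proof.
rewrite /poly2 /poly2_shift.
under eq_bigr => p _.
  rewrite (exprD_ord u x (ltn_ord p)) mulr_sumr.
  under eq_bigr => i _.
    rewrite mulr_suml.
    under eq_bigr => q _.
      rewrite (exprD_ord v x (ltn_ord q)) mulr_sumr mulr_suml.
      over.
    rewrite exchange_big /=.
    over.
  over.
rewrite exchange_big /=; apply: eq_bigr => i _.
rewrite mulr_suml exchange_big /=; apply: eq_bigr => j _.
rewrite !mulr_suml; apply: eq_bigr => p _; rewrite !mulr_suml; apply: eq_bigr => q _.
by rewrite exprD; ring.
Qed.

Lemma sum_delta N (f : nat -> R) k : (k < N)%N ->
  \sum_(p < N) (nat_of_ord p == k)%:R * f p = f k.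
Proof.
move=> kN; rewrite (bigD1 (Ordinal kN)) //= eqxx mul1r big1 ?addr0// => p.
by rewrite -val_eqE /= => /negbTE ->; rewrite mul0r.
Qed.

Lemma poly2_shift0 N c i j : (i < N)%N -> (j < N)%N -> poly2_shift N c 0 i j = c i j.
Proof.
move=> iN jN; rewrite -(sum_delta (fun p => c p j) iN); apply: eq_bigr => p _.
rewrite -(sum_delta (c p) jN) mulr_sumr; apply: eq_bigr => q _.
rewrite expr0n addn_eq0 !subn_eq0.
have [pi|pi|->] := ltngtP p i.
- by rewrite (bin_small pi) !(mul0r, mulr0).
- by rewrite !(mul0r, mulr0).
have [qj|qj|->] := ltngtP q j.
- by rewrite (bin_small qj) !(mul0r, mulr0).
- by rewrite !(mul0r, mulr0).
by rewrite !binn !(mul1r, mulr1).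
Qed.

(** At t = a only the terms whose power of t - a is exactly 1 survive, namely (i+1, j) and (i,
    j+1). *)
Lemma has_deriv_poly2_shift lo hi N c a i j : (i + j + 1 < N)%N ->
  has_deriv lo hi (fun t : R => poly2_shift N c (t - a) i j) a
    (i.+1%:R * c i.+1 j + j.+1%:R * c i j.+1).
Proof.
move=> ijN.
have iN1 : (i.+1 < N)%N by rewrite (leq_trans _ ijN)// ltnS addn1 ltnS leq_addr.
have jN1 : (j.+1 < N)%N by rewrite (leq_trans _ ijN)// ltnS addn1 ltnS leq_addl.
have -> : i.+1%:R * c i.+1 j + j.+1%:R * c i j.+1 =
  \sum_(p < N) \sum_(q < N) c p q * ('C(p, i)%:R * 'C(q, j)%:R) *
   (((p - i) + (q - j))%N%:R * (a - a) ^+ ((p - i) + (q - j))%N.-1).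
  rewrite -(sum_delta (fun p => i.+1%:R * c p j) iN1).
  rewrite -(sum_delta (fun p => j.+1%:R * c p j.+1) (ltnW iN1)) -big_split /=.
  apply: eq_bigr => p _.
  rewrite -(sum_delta (fun q => (nat_of_ord p == i.+1)%:R * (i.+1%:R * c p q)) (ltnW jN1)).
  rewrite -(sum_delta (fun q => (nat_of_ord p == i)%:R * (j.+1%:R * c p q)) jN1) -big_split /=.
  apply: eq_bigr => q _.
  have [pi|ip|pi] := ltngtP p i.
  - by rewrite (bin_small pi) (ltn_eqF (leqW pi)) !(mul0r, mulr0, addr0).
  - have [qj|jq|qj] := ltngtP q j.
    + by rewrite (bin_small qj) (ltn_eqF (leqW qj)) !(mul0r, mulr0, addr0).
    + rewrite !(mul0r, mulr0, addr0).
      have : (1 < p - i + (q - j))%N.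
        by rewrite -[2%N]/(1 + 1)%N leq_add// subn_gt0.
      by case: (_ + _)%N => [|[|n]]// _; rewrite subrr expr0n /= !mulr0.
    + rewrite qj (ltn_eqF (ltnSn j)) subnn addn0 binn !(mul0r, mulr0, addr0, mul1r, mulr1).
      have [->|pi1] := eqVneq (nat_of_ord p) i.+1.
        by rewrite subSnn binSn /=; ring.
      have : (1 < p - i)%N by rewrite ltn_subRL addn1 ltn_neqAle eq_sym pi1.
      by case: (p - i)%N => [|[|n]]// _; rewrite subrr expr0n /= !(mulr0, mul0r).
  - rewrite pi (ltn_eqF (ltnSn i)) subnn add0n binn !(mul0r, mulr0, add0r, mul1r, mulr1).
    have [qj|jq|qj] := ltngtP q j.
    + by rewrite (bin_small qj) (ltn_eqF (leqW qj)) !(mul0r, mulr0, addr0).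
    + have [->|qj1] := eqVneq (nat_of_ord q) j.+1.
        by rewrite subSnn binSn /=; ring.
      have : (1 < q - j)%N by rewrite ltn_subRL addn1 ltn_neqAle eq_sym qj1.
      by case: (q - j)%N => [|[|n]]// _; rewrite subrr expr0n /= !(mulr0, mul0r).
    + by rewrite qj (ltn_eqF (ltnSn j)) subnn !(mul0r, mulr0).
rewrite /poly2_shift.
apply: (has_deriv_sum (F := fun p t => \sum_(q < N) c p q * ('C(p, i)%:R * 'C(q, j)%:R) *
  (t - a) ^+ ((p - i) + (q - j))) (L := fun p => \sum_(q < N) c p q * ('C(p, i)%:R * 'C(q, j)%:R) *
   (((p - i) + (q - j))%N%:R * (a - a) ^+ ((p - i) + (q - j))%N.-1))) => p _.
apply: (has_deriv_sum (F := fun q t => c p q * ('C(p, i)%:R * 'C(q, j)%:R) *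
  (t - a) ^+ ((p - i) + (q - j))) (L := fun q => c p q * ('C(p, i)%:R * 'C(q, j)%:R) *
   (((p - i) + (q - j))%N%:R * (a - a) ^+ ((p - i) + (q - j))%N.-1))) => q _.
by apply: has_derivZ; exact: has_derivX.
Qed.

(* Converse Taylor theorem: comparing the expansions at a and a + w on the
   square between them. *)
Lemma expansion_has_deriv (s0 s1 : R) N H (d : R -> nat -> nat -> R) (L C : R) :
  0 < L ->
  (forall a, s0 <= a <= s1 -> forall rho u v, 0 < rho <= L ->
    s0 <= a + u <= s1 -> s0 <= a + v <= s1 -> `|u| <= rho -> `|v| <= rho ->
    `|H (a + u) (a + v) - poly2 N (d a) u v| <= C * (rho ^+ N.-1 * rho `^ 2^-1)) ->
  forall i j a, (i + j + 1 < N)%N -> s0 <= a <= s1 ->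
  has_deriv s0 s1 (fun t => d t i j) a
    (i.+1%:R * d a i.+1 j + j.+1%:R * d a i j.+1).
Proof.
move=> L0 HC i j a ijN sa e e0.
have iN : (i < N)%N by rewrite (leq_trans _ ijN)// ltnS -addnA leq_addr.
have jN : (j < N)%N by rewrite (leq_trans _ ijN)// ltnS addnAC leq_addl.
have e2 : 0 < e / 2 by rewrite divr_gt0.
have [d1 d10 Hd1] := @has_deriv_poly2_shift s0 s1 N (d a) a i j ijN _ e2.
pose K := 64 ^+ N * (2 * `|C|) + 1.
have K0 : 0 < K by rewrite /K ltr_wpDl// !mulr_ge0// exprn_ge0.
(* The square matches the rate: the coefficients agree up to a multiple of |w|^(3/2), and the spare
   |w|^(1/2) has to be at most e / (2 K). *)
pose d2 := (e / 2 / K) ^+ 2.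
have eK : 0 < e / 2 / K by rewrite divr_gt0.
have d20 : 0 < d2 by rewrite exprn_gt0.
exists (Num.min (Num.min d1 d2) (Num.min 1 L)); first by rewrite !lt_min d10 d20 ltr01.
move=> b sb; rewrite !lt_min => /andP[/andP[bd1 bd2] /andP[b1 bL]].
have [->|ba] := eqVneq b a; first by rewrite !subrr mulr0 subr0 !normr0 mulr0.
have {Hd1} := Hd1 b sb bd1; rewrite subrr poly2_shift0//.
set w := b - a; set l := _%:R * _ + _; set S := poly2_shift _ _ w _ _ => H1.
have w0 : 0 < `|w| by rewrite normr_gt0 subr_eq0.
suff H2 : `|d b i j - S| <= e / 2 * `|w|.
  rewrite (_ : _ - _ = (d b i j - S) + (S - d a i j - l * w)); last by ring.
  by rewrite (le_trans (ler_normD _ _))// (le_trans (lerD H2 H1))// -mulrDl -splitr.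
(* The scaling by - w makes the unit square correspond to the square with opposite corners (b, b)
   and (a, a), where both expansions apply. *)
pose c := fun i j => (d b i j - poly2_shift N (d a) w i j) * (- w) ^+ (i + j).
have Hc x y : 0 <= x <= 1 -> 0 <= y <= 1 ->
    `|poly2 N c x y| <= 2 * `|C| * (`|w| ^+ N.-1 * `|w| `^ 2^-1).
  move=> x01 y01; rewrite /c -poly2_scale -poly2B -poly2_shiftE.
  have wL : 0 < `|w| <= L by rewrite w0 ltW.
  have small z : 0 <= z <= 1 -> `|- w * z| <= `|w|.
    by move=> /andP[z0 z1]; rewrite normrM normrN (ger0_norm z0) ler_piMr.
  have small' z : 0 <= z <= 1 -> `|- w * z + w| <= `|w|.
    move=> /andP[z0 z1]; rewrite (_ : _ + w = w * (1 - z)); last by ring.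
    rewrite normrM ler_piMr// ler_norml; apply/andP; split; lra.
  have bE z : b - w * z = a + (- w * z + w) by rewrite /w; ring.
  have inb z : 0 <= z <= 1 -> s0 <= b + - w * z <= s1.
    by move=> z01; apply: between_itv => //; rewrite /w opprB addrC subrK.
  have ina z : 0 <= z <= 1 -> s0 <= a + (- w * z + w) <= s1.
    by move=> z01; rewrite -bE -mulNr; exact: inb.
  have Q1 := HC b sb `|w| _ _ wL (inb _ x01) (inb _ y01) (small _ x01) (small _ y01).
  have Q2 := HC a sa `|w| _ _ wL (ina _ x01) (ina _ y01) (small' _ x01) (small' _ y01).
  rewrite -!bE -!mulNr in Q2.
  rewrite (_ : _ - _ = (H (b + - w * x) (b + - w * y) - poly2 N (d a) (- w * x + w) (- w * y + w))
    - (H (b + - w * x) (b + - w * y) - poly2 N (d b) (- w * x) (- w * y))); last by ring.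
  rewrite (le_trans (ler_normB _ _))// (le_trans (lerD Q2 Q1))//.
  have : 0 <= `|w| ^+ N.-1 * `|w| `^ 2^-1 by rewrite mulr_ge0 ?exprn_ge0 ?powR_ge0.
  by have := ler_norm C; nra.
have := poly2_coef_bound ler01 iN jN Hc; rewrite expr1n mulr1 /c normrM normrX normrN -/S.
set x := `|_ - _| => Hx.
have x0 : 0 <= x by exact: normr_ge0.
have wij : 0 < `|w| ^+ (i + j) by rewrite exprn_gt0.
have sw : `|w| `^ 2^-1 <= e / 2 / K.
  rewrite powR12_sqrt// -(ger0_norm (ltW eK)) -(sqrtr_sqr (e / 2 / K)).
  by rewrite ler_wsqrtr// -/d2 ltW.
have wN : `|w| ^+ N.-1 <= `|w| * `|w| ^+ (i + j).
  have aux (m n : nat) : (m + 1 < n)%N -> (m.+1 <= n.-1)%N by rewrite addn1; case: n.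
  by rewrite -exprS; apply: ler_wiXn2l; [exact: ltW|exact: ltW|exact: aux].
rewrite -(ler_pM2r wij) (le_trans Hx)//.
rewrite (le_trans (_ : _ <= K * ((`|w| * `|w| ^+ (i + j)) * (e / 2 / K))))//.
  rewrite (_ : 64 ^+ N * _ = (64 ^+ N * (2 * `|C|)) * (`|w| ^+ N.-1 * `|w| `^ 2^-1)); last by rewrite !mulrA.
  apply: ler_pM; rewrite ?mulr_ge0 ?exprn_ge0 ?powR_ge0//.
    by rewrite /K lerDl.
  by apply: ler_pM; rewrite ?exprn_ge0 ?powR_ge0.
rewrite le_eqVlt; apply/orP; left; apply/eqP; field; rewrite gt_eqF//.
Qed.

End LocalExpansion.

(** * Diagonal derivatives as limiting coefficients *)

Section Dmix.
Variable R : realType.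

(* [Dmix T H i j t] plays the part of the mixed derivative of order (i, j) of H
   at (t, t): the recursion is the chain rule
   d/dt D_ij(t, t) = D_(i+1)j(t, t) + D_i(j+1)(t, t) solved for the last term. *)
Fixpoint Dmix (T : R) (H : R -> R -> R) (i j : nat) {struct j} : R -> R :=
  if j is j'.+1 then fun t => deriv_on T (Dmix T H i j') t - Dmix T H i.+1 j' t
  else fun t => derivn_on T (fun x => H x t) i t.

Lemma has_deriv_Dmix (T : R) (H : R -> R -> R) i j t l : 0 < T -> 0 <= t <= T ->
  has_deriv 0 T (Dmix T H i j) t l ->
  has_deriv 0 T (Dmix T H i j) t (Dmix T H i.+1 j t + Dmix T H i j.+1 t).
Proof.
move=> T0 tT Dl; rewrite /= addrC subrK.
by rewrite (has_deriv_deriv_on T0 tT Dl).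
Qed.

(** Base points run over [s0, T], while the squares may reach down to lo. The condition s0 = 0 or s0
    < a makes [s0, T] a neighbourhood of a in [0, T], so that a derivative relative to [s0, T] is
    one relative to [0, T]. The identification with [Dmix] goes by induction on j: the Taylor
    coefficients in t give j = 0, and the converse Taylor formula solved for order (i, j+1) gives
    the step. *)
Lemma region_expansion (T lo s0 : R) N H (M E L : R) (del : R -> R) :
  let U i t tau := derivn_on T (fun x => H x tau) i t in
  let V j t tau := derivn_on T (fun x => H t x) j tau in
  let S a := [/\ 0 <= a, s0 <= a <= T & s0 = 0 \/ s0 < a] in
  0 < T -> 0 <= lo <= s0 -> (0 < N)%N -> pure_derivs lo T N H U V M ->
  (forall t tau, lo <= t <= T -> lo <= tau <= T -> `|H t tau| <= E) ->
  0 < L -> (forall a, s0 <= a <= T -> `|del a| = L /\ lo <= a + del a <= T) ->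
  exists d : R -> nat -> nat -> R,
  [/\ forall a i j, s0 <= a <= T -> (N <= i + j)%N -> d a i j = 0,
     forall a c E', s0 <= a <= T ->
        (forall u v, 0 <= u <= 1 -> 0 <= v <= 1 ->
          `|H (a + del a * u) (a + del a * v) - poly2 N c (del a * u) (del a * v)| <= E') ->
        forall i j, (i + j < N)%N ->
          `|d a i j - c i j| * L ^+ (i + j) <= 15 * expansion_base R ^+ N * (E' + M * L ^+ N / N`!%:R),
     forall a eps, s0 <= a <= T -> 0 <= eps < 1 ->
        forall rho u v, 0 < rho <= L ->
        lo <= a + u <= T -> lo <= a + v <= T -> `|u| <= rho -> `|v| <= rho ->
        `|H (a + u) (a + v) - poly2 N (d a) u v| <=
          expansion_const N eps * (E + M * L ^+ N / N`!%:R) *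
          ((rho / L) ^+ N.-1 * (rho / L) `^ eps),
     forall a i j, S a -> (i + j < N)%N ->
       Dmix T H i j a = i`!%:R * j`!%:R * d a i j &
     forall a i j, S a -> (i + j + 1 < N)%N ->
       has_deriv 0 T (Dmix T H i j) a (Dmix T H i.+1 j a + Dmix T H i j.+1 a)].
Proof.
move=> U V S T0 /andP[lo0 los0] N0 HUV HE L0 delP.
have ex a : exists d : nat -> nat -> R, s0 <= a <= T ->
  [/\ forall i j, (N <= i + j)%N -> d i j = 0,
      forall i, (i < N)%N -> d i 0%N = U i a a / i`!%:R,
      forall c E', (forall u v, 0 <= u <= 1 -> 0 <= v <= 1 ->
          `|H (a + del a * u) (a + del a * v) - poly2 N c (del a * u) (del a * v)| <= E') ->
        forall i j, (i + j < N)%N ->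
          `|d i j - c i j| * L ^+ (i + j) <= 15 * expansion_base R ^+ N * (E' + M * L ^+ N / N`!%:R) &
      forall eps, 0 <= eps < 1 ->
        forall rho u v, 0 < rho <= L ->
        lo <= a + u <= T -> lo <= a + v <= T -> `|u| <= rho -> `|v| <= rho ->
        `|H (a + u) (a + v) - poly2 N d u v| <=
          expansion_const N eps * (E + M * L ^+ N / N`!%:R) *
          ((rho / L) ^+ N.-1 * (rho / L) `^ eps)].
  have [sa|nsa] := boolP (s0 <= a <= T); last by exists (fun _ _ => 0).
  have [dL la] := delP a sa.
  have lla : lo <= a <= T by case/andP: sa => sa1 ->; rewrite (le_trans los0).
  have d0 : del a != 0 by rewrite -normr_eq0 dL gt_eqF.
  have [d [P1 P2 P3 P4]] := local_expansion N0 HUV lla la d0.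
  rewrite dL in P3 P4.
  by exists d => _; split => // eps eps01; exact: P4.
have [d dP] := choice ex.
have dd := @expansion_has_deriv _ s0 T N H d L
  (expansion_const N 2^-1 * (E + M * L ^+ N / N`!%:R) * ((L ^- N.-1) * (L^-1) `^ 2^-1)) L0 _.
have {}dd i j a : (i + j + 1 < N)%N -> s0 <= a <= T ->
    has_deriv s0 T (fun t => d t i j) a (i.+1%:R * d a i.+1 j + j.+1%:R * d a i j.+1).
  apply: dd => b sb rho u v rL lu lv ur vr.
  have [_ _ _ H4] := dP b sb.
  have h2 : 0 <= (2^-1 : R) < 1 by apply/andP; split; lra.
  case/andP: lu => lu1 lu2; case/andP: lv => lv1 lv2.
  have lu : lo <= b + u <= T by rewrite lu2 (le_trans los0).
  have lv : lo <= b + v <= T by rewrite lv2 (le_trans los0).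
  have := H4 _ h2 rho u v rL lu lv ur vr.
  case/andP: rL => r0 _.
  rewrite exprMn powRM ?invr_ge0 ?(ltW r0) ?(ltW L0)// exprVn => H5.
  by apply: (le_trans H5); rewrite le_eqVlt; apply/orP; left; apply/eqP; ring.
have Sopen a : S a -> exists2 e, 0 < e & forall u, 0 <= u <= T -> `|u - a| < e -> S u.
  move=> [a0 /andP[sa aT] [s00|s0a]].
    by exists 1 => // u /andP[u0 uT] _; split; [|rewrite s00 u0|left].
  exists (a - s0); first by rewrite subr_gt0.
  move=> u /andP[u0 uT]; rewrite ltr_norml => /andP[H1 _].
  have su : s0 < u by lra.
  by split; [|rewrite ltW|right].
have fac_neq0 n : (n`!%:R : R) != 0 by rewrite pnatr_eq0 -lt0n fact_gt0.
(* the derivative of the coefficients transfers to [Dmix] once they agree near a *)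
have transfer i j : (forall a, S a -> Dmix T H i j a = i`!%:R * j`!%:R * d a i j) ->
    forall a, S a -> (i + j + 1 < N)%N ->
    has_deriv 0 T (Dmix T H i j) a
      (i`!%:R * j`!%:R * (i.+1%:R * d a i.+1 j + j.+1%:R * d a i j.+1)).
  move=> HD a Sa ijN; have [e e0 He] := Sopen a Sa.
  have [a0 sa _] := Sa.
  have := has_derivZ (i`!%:R * j`!%:R) (dd i j a ijN sa).
  apply: (has_deriv_near e0); first by rewrite HD.
  move=> u u0T ue; have Su := He u u0T ue.
  by split; [case: Su|rewrite HD].
have HD i j a : S a -> (i + j < N)%N -> Dmix T H i j a = i`!%:R * j`!%:R * d a i j.
  elim: j i a => [|j IH] i a Sa ijN.
    have [_ sa _] := Sa; have [_ di0 _ _] := dP a sa.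
    rewrite addn0 in ijN; rewrite di0//.
    by rewrite /= fact0 mulr1 mulrC divfK.
  have ijN' : (i + j < N)%N by rewrite (leq_trans _ ijN)// addnS.
  have [a0 /andP[sa aT] _] := Sa.
  have aT' : 0 <= a <= T by rewrite a0.
  have H1 := transfer i j (fun a Sa => IH i a Sa ijN') a Sa _.
  rewrite /= (has_deriv_deriv_on T0 aT' (H1 _)); last by rewrite -addnA addn1.
  rewrite IH ?addSnnS// !factS !natrM; ring.
exists d; split => //.
- by move=> a i j sa; case: (dP a sa) => + _ _ _; apply.
- by move=> a c E' sa; case: (dP a sa) => _ _ + _; apply.
- by move=> a eps sa; case: (dP a sa) => _ _ _; apply.
- move=> a i j Sa ijN; rewrite (HD i j a)//.
- move=> a i j Sa ijN; have [a0 /andP[sa aT] _] := Sa.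
  have ijN' : (i + j < N)%N by rewrite (leq_ltn_trans _ ijN)// leq_addr.
  have HDij b (Sb : S b) := HD i j b Sb ijN'.
  have a0T : 0 <= a <= T by rewrite a0.
  have H1 := transfer i j HDij a Sa ijN.
  exact: has_deriv_Dmix T0 a0T H1.
Qed.

End Dmix.

(** * Weighted bounds on the diagonal *)

Section Regularity.
Variables (R : realType) (T : R) (r : nat) (zeta : R).
Hypotheses (T0 : 0 < T) (r0 : (0 < r)%N) (zeta0 : 0 <= zeta) (zeta1 : zeta < 1).
Implicit Types (A B : R) (g : R -> R) (H : R -> R -> R) (k s : nat).

Definition weight k (t : R) : R :=
  if (k <= r)%N then 1 else (t `^ (k%:R - r%:R - zeta))^-1.

Definition geom_fact A B k : R := A * B ^+ k * k`!%:R.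

(* Q^*_(r,gamma) is contained in this class for s = Q_order r gamma and
   zeta = Q_zeta gamma, and B^*_(r,gamma) in all of these classes for
   zeta = 1 - gamma, because k^k <= 4^k k!. *)
Definition regular s A B g : Prop :=
  [/\ forall k t, (k < r)%N -> 0 <= t <= T -> derivable_on T (derivn_on T g k) t,
      forall k t, (r <= k < s)%N -> 0 < t <= T -> derivable_on T (derivn_on T g k) t,
      forall k t, (k <= r)%N -> 0 <= t <= T -> `|derivn_on T g k t| <= geom_fact A B k
    & forall k t, (r < k <= s)%N -> 0 < t <= T ->
        `|derivn_on T g k t| <= geom_fact A B k / t `^ (k%:R - r%:R - zeta)].

Lemma weight_gt0 k t : 0 < t -> 0 < weight k t.
Proof. by rewrite /weight => t0; case: ifP => // _; rewrite invr_gt0 powR_gt0. Qed.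

Lemma weight_low k t : (k <= r)%N -> weight k t = 1.
Proof. by rewrite /weight => ->. Qed.

Lemma weight_exponent k : (r < k)%N -> 0 < k%:R - r%:R - zeta.
Proof.
move=> rk; have : r.+1%:R <= k%:R :> R by rewrite ler_nat.
rewrite -natr1 => h; move: zeta1; lra.
Qed.

Lemma weight_le k t lo : 0 < lo <= t -> weight k t <= weight k lo.
Proof.
move=> /andP[lo0 lot]; rewrite /weight; case: leqP => // rk.
rewrite lef_pV2 ?posrE ?powR_gt0 ?(lt_le_trans lo0)//.
apply: ge0_ler_powR => //; first exact: ltW (weight_exponent rk).
  by rewrite nnegrE ltW.
by rewrite nnegrE (le_trans (ltW lo0)).
Qed.

Lemma geom_fact_ge0 A B k : 0 <= A -> 0 <= B -> 0 <= geom_fact A B k.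
Proof. by move=> ? ?; rewrite !mulr_ge0 ?exprn_ge0. Qed.

Lemma regular_has_deriv_low s A B g k t : regular s A B g -> (k < r)%N -> 0 <= t <= T ->
  has_deriv 0 T (derivn_on T g k) t (derivn_on T g k.+1 t).
Proof. by move=> [H1 _ _ _] kr tT; apply: (derivable_on_has_deriv (H1 _ _ kr tT)). Qed.

Lemma regular_has_deriv s A B g k t : regular s A B g -> (k < s)%N -> 0 < t <= T ->
  has_deriv 0 T (derivn_on T g k) t (derivn_on T g k.+1 t).
Proof.
move=> reg ks /andP[t0 tT]; have [kr|rk] := ltnP k r.
  by apply: (regular_has_deriv_low reg) => //; rewrite ltW.
case: reg => _ H2 _ _; apply: derivable_on_has_deriv; apply: H2; rewrite ?rk ?t0//.
Qed.

Lemma regular_bound s A B g k t : regular s A B g -> (k <= s)%N -> 0 < t <= T ->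
  `|derivn_on T g k t| <= geom_fact A B k * weight k t.
Proof.
move=> [_ _ H3 H4] ks /andP[t0 tT]; rewrite /weight; case: leqP => rk.
  by rewrite mulr1 H3// ltW.
by apply: H4; rewrite ?rk ?t0.
Qed.

Lemma regular_pure_low s A B H : separately T (regular s A B) H ->
  pure_derivs 0 T r H (fun i t tau => derivn_on T (fun x => H x tau) i t)
    (fun j t tau => derivn_on T (fun x => H t x) j tau) (geom_fact A B r).
Proof.
move=> [H1 H2]; split => //.
- by move=> i t tau ir tT tauT; apply: (regular_has_deriv_low (H1 tau tauT)).
- by move=> i t tau ir tT tauT; apply: (regular_has_deriv_low (H2 t tT)).
- by move=> t tau tT tauT; case: (H1 tau tauT) => _ _ H3 _; exact: H3.
- by move=> t tau tT tauT; case: (H2 t tT) => _ _ H3 _; exact: H3.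
Qed.

Lemma regular_pure s A B H lo N : 0 <= A -> 0 <= B -> separately T (regular s A B) H ->
  0 < lo -> (N <= s)%N ->
  pure_derivs lo T N H (fun i t tau => derivn_on T (fun x => H x tau) i t)
    (fun j t tau => derivn_on T (fun x => H t x) j tau) (geom_fact A B N * weight N lo).
Proof.
move=> A0 B0 [H1 H2] lo0 Ns.
have I t : lo <= t <= T -> 0 < t <= T.
  by move=> /andP[lot ->]; rewrite (lt_le_trans lo0).
have I' t : lo <= t <= T -> 0 <= t <= T by move=> /I/andP[/ltW -> ->].
split => //.
- move=> i t tau ir tT tauT; apply: has_deriv_sub (ltW lo0) (lexx _) _.
  by apply: (regular_has_deriv (H1 tau (I' _ tauT))); [exact: leq_trans ir Ns|exact: I].
- move=> i t tau ir tT tauT; apply: has_deriv_sub (ltW lo0) (lexx _) _.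
  by apply: (regular_has_deriv (H2 t (I' _ tT))); [exact: leq_trans ir Ns|exact: I].
- move=> t tau tT tauT; apply: le_trans (regular_bound (H1 tau (I' _ tauT)) Ns (I _ tT)) _.
  by rewrite ler_wpM2l ?geom_fact_ge0// weight_le// lo0; case/andP: tT.
- move=> t tau tT tauT; apply: le_trans (regular_bound (H2 t (I' _ tT)) Ns (I _ tauT)) _.
  by rewrite ler_wpM2l ?geom_fact_ge0// weight_le// lo0; case/andP: tauT.
Qed.

Lemma regular_kernel_bound s A B H t tau : separately T (regular s A B) H ->
  0 <= t <= T -> 0 <= tau <= T -> `|H t tau| <= A.
Proof.
move=> [H1 _] tT tauT; case: (H1 tau tauT) => _ _ /(_ 0%N t (leq0n _) tT) + _.
by rewrite /geom_fact expr0 fact0 !mulr1.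
Qed.

Lemma fact_mul_le i j : (i`! * j`! <= (i + j)`!)%N.
Proof.
rewrite -(bin_fact (leq_addr j i)) addKn mulnA leq_pmul2r ?fact_gt0//.
by rewrite leq_pmull// bin_gt0 leq_addr.
Qed.

Lemma fact_neq0 n : (n`!%:R : R) != 0.
Proof. by rewrite pnatr_eq0 -lt0n fact_gt0. Qed.

(** Points inwards, so that the square keeps side T / 2 even at the ends of [0, T]. *)
Let half_dir (a : R) : R := if a <= T / 2 then T / 2 else - (T / 2).

(** Pure derivatives up to order r are bounded on all of [0, T], so order r can be used at the fixed
    scale T / 2, up to a = 0. The error exponent is taken with eps = zeta, which is admissible as
    zeta < 1. *)
Lemma coarse_expansion s A B H : 0 <= A -> 0 <= B -> separately T (regular s A B) H ->
  let K := A + geom_fact A B r * (T / 2) ^+ r / r`!%:R in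
  [/\ forall i j a, (i + j + 1 < r)%N -> 0 <= a <= T ->
        has_deriv 0 T (Dmix T H i j) a (Dmix T H i.+1 j a + Dmix T H i j.+1 a),
      forall i j a, (i + j < r)%N -> 0 <= a <= T ->
        `|Dmix T H i j a| * (T / 2) ^+ (i + j) <=
           (i + j)`!%:R * (15 * expansion_base R ^+ r * K)
    & forall a, 0 <= a <= T -> exists2 c : nat -> nat -> R,
        (forall i j, (r <= i + j)%N -> c i j = 0) &
        forall rho u v, 0 < rho <= T / 2 -> 0 <= a + u <= T -> 0 <= a + v <= T ->
          `|u| <= rho -> `|v| <= rho ->
          `|H (a + u) (a + v) - poly2 r c u v| <=
            expansion_const r zeta * K * ((rho / (T / 2)) ^+ r.-1 * (rho / (T / 2)) `^ zeta)].
Proof.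
move=> A0 B0 HH K.
have L0 : 0 < T / 2 by move: T0; lra.
have dirP a : 0 <= a <= T -> `|half_dir a| = T / 2 /\ 0 <= a + half_dir a <= T.
  rewrite /half_dir => /andP[a0 aT]; case: leP => aT2.
    by rewrite gtr0_norm//; split => //; apply/andP; split; lra.
  by rewrite normrN gtr0_norm//; split => //; apply/andP; split; lra.
have bnd t tau : 0 <= t <= T -> 0 <= tau <= T -> `|H t tau| <= A.
  exact: regular_kernel_bound HH.
have lo0 : 0 <= (0 : R) <= 0 by rewrite lexx.
have [d [d0 dc de dD dd]] := region_expansion T0 lo0 r0 (regular_pure_low HH) bnd L0 dirP.
have S a : 0 <= a <= T -> [/\ 0 <= a, 0 <= a <= T & (0 : R) = 0 \/ 0 < a].
  by move=> aT; split => //; [case/andP: aT|left].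
split.
- by move=> i j a ij /S Sa; exact: dd Sa ij.
- move=> i j a ij aT; rewrite dD//; last exact: S.
  rewrite !normrM !normr_nat.
  have H1 : `|d a i j - 0| * (T / 2) ^+ (i + j) <= 15 * expansion_base R ^+ r * K.
    apply: (dc a (fun _ _ => 0) A) => // u v u01 v01.
    rewrite (_ : poly2 _ _ _ _ = 0); last first.
      by rewrite /poly2 big1// => k _; rewrite big1 ?mul0r// => m _; rewrite mul0r.
    have [_ lad] := dirP a aT.
    by rewrite subr0 bnd//; exact: between_itv.
  rewrite subr0 in H1.
  rewrite -[leLHS]mulrA ler_pM ?mulr_ge0 ?exprn_ge0 ?(ltW L0)//.
  by rewrite -natrM ler_nat fact_mul_le.
- move=> a aT; exists (d a); first by move=> i j; exact: d0.
  by move=> rho u v; apply: de => //; rewrite zeta0.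
Qed.

(** For base points in [3a/4, T] the square of side a/4 to the left stays in [a/2, T], where the
    pure derivatives of order i + j + 2 are bounded. *)
Lemma Dmix_has_deriv s A B H i j a : 0 <= A -> 0 <= B ->
  separately T (regular s A B) H -> (i + j + 1 < s)%N -> 0 < a <= T ->
  has_deriv 0 T (Dmix T H i j) a (Dmix T H i.+1 j a + Dmix T H i j.+1 a).
Proof.
move=> A0 B0 HH ij /andP[a0 aT].
have lo0 : 0 < a / 2 by rewrite divr_gt0.
have los : 0 <= a / 2 <= 3 * a / 4 by apply/andP; split; lra.
have L0 : 0 < a / 4 by rewrite divr_gt0.
have bnd t tau : a / 2 <= t <= T -> a / 2 <= tau <= T -> `|H t tau| <= A.
  move=> /andP[t1 t2] /andP[u1 u2]; apply: (regular_kernel_bound HH); rewrite ?t2 ?u2 andbT; lra.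
have dirP b : 3 * a / 4 <= b <= T -> `|- (a / 4)| = a / 4 /\ a / 2 <= b + - (a / 4) <= T.
  move=> /andP[b1 b2]; rewrite normrN gtr0_norm//; split => //.
  by apply/andP; split; lra.
have [d [_ _ _ _ dd]] := region_expansion T0 los (ltn0Sn _)
   (regular_pure A0 B0 HH lo0 ij) bnd L0 dirP.
apply: dd; last by rewrite ltnS.
by split; [exact: ltW|apply/andP; split; lra|right; lra].
Qed.

Lemma le_exprS (x : R) n : 1 <= x -> x <= x ^+ n.+1.
Proof. by move=> x1; rewrite exprS ler_peMr ?exprn_ege1// (le_trans ler01). Qed.

(* For orders at least r the expansion of order r at scale T is subtracted
   first: what remains is O(a^(r-1+zeta)) at distance a from the diagonal
   point (a, a), which gives the right power of a. *)
Lemma Dmix_bound A B : 0 <= A -> 1 <= B -> exists2 C, 1 <= C &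
  forall s H, separately T (regular s A B) H ->
  (forall i j a, (i + j < r)%N -> 0 <= a <= T ->
     `|Dmix T H i j a| <= (i + j)`!%:R * C ^+ (i + j).+1) /\
  (forall i j a, (i + j < s)%N -> 0 < a <= T ->
     `|Dmix T H i j a| <= (i + j)`!%:R * C ^+ (i + j).+1 * weight (i + j).+1 a).
Proof.
move=> A0 B1; have B0 : 0 <= B by exact: le_trans B1.
pose K := A + geom_fact A B r * (T / 2) ^+ r / r`!%:R.
have T20 : 0 < T / 2 by rewrite divr_gt0.
have K0 : 0 <= K.
  rewrite /K addr_ge0// divr_ge0 ?mulr_ge0 ?geom_fact_ge0 ?exprn_ge0 ?(ltW T20)//.
have base1 := expansion_base_ge R.
have base0 : 0 <= expansion_base R by exact: le_trans base1.
(* The last factor pays for the division by (T / 2)^(i+j) with i + j < r, since T / 2 may be less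
   than 1. *)
pose X := 15 * expansion_base R ^+ r * K * (1 + (T / 2)^-1) ^+ r.
have T2i : 0 <= (T / 2)^-1 by rewrite invr_ge0 ltW.
have X0 : 0 <= X by rewrite /X mulr_ge0 ?exprn_ge0 ?addr_ge0// mulr_ge0// mulr_ge0 ?exprn_ge0.
pose Kc := `|expansion_const r zeta| * K * ((2 * T)^-1 ^+ r.-1 * (2 * T)^-1 `^ zeta).
have Kc0 : 0 <= Kc.
  by rewrite /Kc !mulr_ge0 ?powR_ge0 ?exprn_ge0 ?invr_ge0 ?mulr_ge0// ltW.
pose Y := 15 * (Kc + T * A) + 1.
have TA0 : 0 <= T * A by rewrite mulr_ge0// ltW.
have Y1 : 1 <= Y by rewrite /Y lerDr mulr_ge0 ?addr_ge0.
pose Z := expansion_base R * (4 * B) * Y.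
have Y0 : 0 <= Y by exact: le_trans Y1.
have Z0 : 0 <= Z by rewrite /Z !mulr_ge0.
exists (1 + X + Z); first by rewrite -addrA lerDl addr_ge0.
set C := 1 + X + Z.
have C1 : 1 <= C by rewrite /C -addrA lerDl addr_ge0.
have C0 : 0 <= C by exact: le_trans C1.
move=> s H HH; have [cd cb ce] := coarse_expansion A0 B0 HH; rewrite -/K in cb ce.
have low i j a : (i + j < r)%N -> 0 <= a <= T ->
     `|Dmix T H i j a| <= (i + j)`!%:R * C ^+ (i + j).+1.
  move=> ij aT; have H1 := cb i j a ij aT.
  have L0 : 0 < (T / 2) ^+ (i + j) by rewrite exprn_gt0.
  have H2 : `|Dmix T H i j a| <= (i + j)`!%:R * (15 * expansion_base R ^+ r * K) * ((T / 2) ^- (i + j)).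
    by rewrite ler_pdivlMr.
  apply: (le_trans H2); rewrite -mulrA ler_wpM2l//.
  have H3 : (T / 2) ^- (i + j) <= (1 + (T / 2)^-1) ^+ r.
    rewrite -exprVn (@le_trans _ _ ((1 + (T / 2)^-1) ^+ (i + j)))//.
      by rewrite lerXn2r ?nnegrE ?addr_ge0// lerDr.
    by rewrite ler_weXn2l ?lerDl// ltnW.
  have H4 : 15 * expansion_base R ^+ r * K * (T / 2) ^- (i + j) <= X.
    by rewrite /X ler_wpM2l// mulr_ge0// mulr_ge0 ?exprn_ge0.
  apply: (le_trans H4); apply: le_trans (le_exprS _ C1).
  by rewrite /C addrAC lerDr addr_ge0.
split=> // i j a; set n := (i + j)%N => ns /andP[a0 aT].
have aT' : 0 <= a <= T by rewrite ltW.
have [nr|rn] := ltnP n r; first by rewrite weight_low// mulr1 low.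
have wE : weight n.+1 a = (a `^ (n.+1%:R - r%:R - zeta))^-1 by rewrite /weight ltnNge rn.
have lo0 : 0 < a / 2 by rewrite divr_gt0.
have los : 0 <= a / 2 <= 3 * a / 4 by apply/andP; split; lra.
have L0 : 0 < a / 4 by rewrite divr_gt0.
have bnd t tau : a / 2 <= t <= T -> a / 2 <= tau <= T -> `|H t tau| <= A.
  move=> /andP[t1 t2] /andP[u1 u2]; apply: (regular_kernel_bound HH); rewrite ?t2 ?u2 andbT; lra.
have dirP b : 3 * a / 4 <= b <= T -> `|- (a / 4)| = a / 4 /\ a / 2 <= b + - (a / 4) <= T.
  move=> /andP[b1 b2]; rewrite normrN gtr0_norm//; split => //.
  by apply/andP; split; lra.
have [d [_ dc _ dD _]] := region_expansion T0 los (ltn0Sn _)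
   (regular_pure A0 B0 HH lo0 ns) bnd L0 dirP.
have sa : 3 * a / 4 <= a <= T by apply/andP; split; lra.
rewrite dD ?ltnSn//; last by split; [exact: ltW| |right; lra].
have [c c0 cE] := ce a aT'.
pose E' := Kc * (a ^+ r.-1 * a `^ zeta).
have poly_ext u v : poly2 n.+1 c u v = poly2 r c u v.
  rewrite /poly2 (big_ord_widen n.+1 (fun i => (\sum_(j < r) c i j * v ^+ j) * u ^+ i) (leqW rn)).
  rewrite [RHS]big_mkcond /=; apply: eq_bigr => p _; case: ltnP => pr.
    congr (_ * _); rewrite (big_ord_widen n.+1 (fun j => c p j * v ^+ j) (leqW rn)).
    rewrite [RHS]big_mkcond /=; apply: eq_bigr => q _; case: ltnP => // qr.
    by rewrite c0 ?mul0r// (leq_trans qr)// leq_addl.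
  rewrite big1 ?mul0r// => q _.
  by rewrite c0 ?mul0r// (leq_trans pr)// leq_addr.
have HE' u v : 0 <= u <= 1 -> 0 <= v <= 1 ->
    `|H (a + - (a / 4) * u) (a + - (a / 4) * v) - poly2 n.+1 c (- (a / 4) * u) (- (a / 4) * v)| <= E'.
  move=> u01 v01; rewrite poly_ext.
  have rho4 : 0 < a / 4 <= T / 2 by rewrite L0; lra.
  have ina x : 0 <= x <= 1 -> 0 <= a + - (a / 4) * x <= T.
    by move=> /andP[x0 x1]; apply/andP; split; nra.
  have sm x : 0 <= x <= 1 -> `|- (a / 4) * x| <= a / 4.
    by move=> /andP[x0 x1]; rewrite normrM normrN (gtr0_norm L0) ger0_norm// ler_piMr// ltW.
  have := cE (a / 4) _ _ rho4 (ina _ u01) (ina _ v01) (sm _ u01) (sm _ v01).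
  move=> /le_trans; apply.
  have -> : a / 4 / (T / 2) = a * (2 * T)^-1 by field; rewrite gt_eqF.
  rewrite exprMn powRM ?(ltW a0) ?invr_ge0 ?mulr_ge0 ?(ltW T0)// /E' /Kc.
  rewrite (le_trans (ler_wpM2r _ (ler_wpM2r K0 (ler_norm _))))//.
    by rewrite !mulr_ge0 ?powR_ge0 ?exprn_ge0 ?invr_ge0 ?mulr_ge0 ?(ltW a0)// ltW.
  by rewrite le_eqVlt; apply/orP; left; apply/eqP; ring.
(* The coarse polynomial c has no coefficients of order at least r, so the distance between d and c
   is the coefficient itself. *)
have := dc a c E' sa HE' i j (ltnSn _); rewrite -/n (c0 i j rn) subr0.
set M := geom_fact A B n.+1 * weight n.+1 (a / 2).
rewrite !normrM !normr_nat => Hd.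
have Ln : 0 < (a / 4) ^+ n by rewrite exprn_gt0.
(* The coarse error divided by a^n has exactly the exponent allowed at order n + 1; this is the
   reason for eps = zeta. *)
have aw : a ^+ r.-1 * a `^ zeta / a ^+ n = weight n.+1 a.
  have an : a != 0 by rewrite gt_eqF.
  rewrite wE -powRN -!powR_mulrn ?(ltW a0)// -powRN -!powRD ?an ?implybT//.
  congr (_ `^ _).
  have -> : r%:R = r.-1%:R + 1 :> R by rewrite natr1 prednK.
  by rewrite -natr1; ring.
have w0 : 0 < weight n.+1 a by exact: weight_gt0.
have wa2 : weight n.+1 (a / 2) <= 2 ^+ n.+1 * weight n.+1 a.
  rewrite wE /weight ltnNge rn /= powRM ?(ltW a0)// invfM mulrC ler_wpM2r ?invr_ge0 ?powR_ge0//.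
  rewrite -powRN -[2^-1]powR_inv1// -powRrM mulN1r opprK.
  rewrite -powR_mulrn// ler_powR ?ler1n//.
  have : 0 <= r%:R :> R by [].
  by move: zeta0; lra.
have H1 : E' / (a / 4) ^+ n = Kc * 4 ^+ n * weight n.+1 a.
  by rewrite /E' -aw expr_div_n invf_div; ring.
have H2 : M * (a / 4) ^+ n.+1 / n.+1`!%:R / (a / 4) ^+ n <= T * A * (2 * B) ^+ n.+1 * weight n.+1 a.
  have -> : M * (a / 4) ^+ n.+1 / n.+1`!%:R / (a / 4) ^+ n =
     A * B ^+ n.+1 * (a / 4) * weight n.+1 (a / 2).
    rewrite /M /geom_fact [(a / 4) ^+ n.+1]exprS.
    move: (fact_neq0 n.+1) (gt_eqF Ln) => h1 h2.
    by field; rewrite h1 ?expf_neq0 ?(gt_eqF a0)// gt_eqF.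
  have ABn : 0 <= A * B ^+ n.+1 by rewrite mulr_ge0 ?exprn_ge0.
  have h1 : A * B ^+ n.+1 * (a / 4) <= A * B ^+ n.+1 * T by rewrite ler_wpM2l//; lra.
  have h2 : 0 <= A * B ^+ n.+1 * (a / 4) by rewrite mulr_ge0 ?(ltW L0).
  have h3 : 0 <= weight n.+1 (a / 2) by apply/ltW/weight_gt0.
  apply: (le_trans (ler_pM h2 h3 h1 wa2)).
  by rewrite exprMn le_eqVlt; apply/orP; left; apply/eqP; ring.
have Hd' : `|d a i j| <= 15 * expansion_base R ^+ n.+1 * (Kc * 4 ^+ n + T * A * (2 * B) ^+ n.+1) * weight n.+1 a.
  rewrite -(ler_pdivlMr _ _ Ln) in Hd; apply: (le_trans Hd).
  rewrite [leLHS](_ : _ = 15 * expansion_base R ^+ n.+1 * (E' / (a / 4) ^+ n +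
    M * (a / 4) ^+ n.+1 / n.+1`!%:R / (a / 4) ^+ n)); last by ring.
  rewrite [leRHS](_ : _ = 15 * expansion_base R ^+ n.+1 * (Kc * 4 ^+ n * weight n.+1 a +
    T * A * (2 * B) ^+ n.+1 * weight n.+1 a)); last by ring.
  have h15 : 0 <= 15 * expansion_base R ^+ n.+1 by rewrite mulr_ge0 ?exprn_ge0.
  rewrite H1; apply: (ler_wpM2l h15); rewrite lerD2l; exact: H2.
rewrite -[leRHS]mulrA; apply: ler_pM => //.
  by rewrite -natrM ler_nat fact_mul_le.
apply: (le_trans Hd'); rewrite ler_wpM2r ?(ltW w0)//.
have B4 : 1 <= 4 * B by lra.
have Zn : Z ^+ n.+1 <= C ^+ n.+1.
  by rewrite lerXn2r ?nnegrE// /C lerDr addr_ge0.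
apply: le_trans Zn.
rewrite [leLHS](_ : _ = expansion_base R ^+ n.+1 *
  (15 * (Kc * 4 ^+ n + T * A * (2 * B) ^+ n.+1))); last by ring.
rewrite [leRHS](_ : _ = expansion_base R ^+ n.+1 * ((4 * B) ^+ n.+1 * Y ^+ n.+1)); last first.
  by rewrite /Z -!exprMn !mulrA.
apply: ler_wpM2l; first exact: exprn_ge0.
have B4n : 4 ^+ n <= (4 * B) ^+ n.+1.
  rewrite (@le_trans _ _ (4 ^+ n.+1))//.
    by rewrite ler_weXn2l// ler1n.
  rewrite lerXn2r ?nnegrE//; lra.
have B2n : (2 * B) ^+ n.+1 <= (4 * B) ^+ n.+1 by rewrite lerXn2r ?nnegrE; lra.
have YS := le_exprS n Y1.
have B40 : 0 <= (4 * B) ^+ n.+1 by apply: exprn_ge0; lra.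
apply: (le_trans (_ : _ <= (4 * B) ^+ n.+1 * Y)); last exact: ler_wpM2l.
have := ler_wpM2l Kc0 B4n; have := ler_wpM2l TA0 B2n; rewrite /Y; lra.
Qed.

End Regularity.

(** * Integrals over intervals *)

Section IntervalIntegrals.
Variable R : realType.
Notation mu := (@lebesgue_measure R).
Implicit Types (a b t x B : R) (f g : R -> R).

Definition cont_on a b f := forall x, a <= x <= b -> forall e, 0 < e ->
  exists2 d, 0 < d & forall y, a <= y <= b -> `|y - x| < d -> `|f y - f x| <= e.

Lemma cont_onP a b f : {within `[a, b], continuous f} <-> cont_on a b f.
Proof.
split.
- move=> /(@subspace_continuousP R _ R) H x xab e e0.
  have /H : `[a, b]%classic x by rewrite /= in_itv.
  move=> /cvgrPdist_le /(_ e e0); rewrite near_withinE => -[d /= d0 Hd].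
  exists d => // y yab yx; rewrite distrC; apply: Hd => /=; first by rewrite /ball /= distrC.
  by rewrite in_itv.
- move=> H; apply/(@subspace_continuousP R _ R) => x; rewrite /= in_itv /= => xab.
  apply/cvgrPdist_le => e e0; have [d d0 Hd] := H x xab e e0.
  rewrite near_withinE; exists d => //= y; rewrite /ball /= distrC => yx; rewrite in_itv /= => yab.
  by rewrite distrC; exact: Hd.
Qed.

Lemma cont_on_measurable a b f : cont_on a b f -> measurable_fun `[a, b]%classic f.
Proof. by move/cont_onP => fc; apply: subspace_continuous_measurable_fun. Qed.

Lemma cont_on_bounded a b f : a <= b -> cont_on a b f ->
  exists2 B, 0 <= B & forall x, a <= x <= b -> `|f x| <= B.
Proof.
move=> ab /cont_onP fc.
have [c _ Hc] := EVT_max ab fc; have [d _ Hd] := EVT_min ab fc.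
exists (`|f c| + `|f d|); first by rewrite addr_ge0.
move=> x xab; have xab' : x \in `[a, b] by rewrite in_itv.
have := Hc _ xab'; have := Hd _ xab'.
have := ler_norm (f c); have := lerNnormlW (lexx `|f d|).
have := normr_ge0 (f c); have := normr_ge0 (f d).
by move=> *; rewrite ler_norml; apply/andP; split; lra.
Qed.

Lemma lipschitz_cont_on a b f (K : R) :
  (forall x y, a <= x <= b -> a <= y <= b -> `|f y - f x| <= K * `|y - x|) -> cont_on a b f.
Proof.
move=> H x xab e e0; exists (e / (`|K| + 1)); first by rewrite divr_gt0// ltr_wpDl.
move=> y yab; rewrite ltr_pdivlMr ?ltr_wpDl// => yx.
apply: (le_trans (H _ _ xab yab)).
have := ler_norm K; have := normr_ge0 (y - x); nra.
Qed.

Lemma cont_onM a b f g : a <= b -> cont_on a b f -> cont_on a b g ->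
  cont_on a b (fun x => f x * g x).
Proof.
move=> ab /cont_onP fc /cont_onP gc; apply/cont_onP.
by move=> x; apply: cvgM; [exact: fc|exact: gc].
Qed.

Lemma cont_onB a b f g : cont_on a b f -> cont_on a b g ->
  cont_on a b (fun x => f x - g x).
Proof.
move=> /cont_onP fc /cont_onP gc; apply/cont_onP.
by move=> x; apply: cvgB; [exact: fc|exact: gc].
Qed.

Lemma cont_onD a b f g : cont_on a b f -> cont_on a b g ->
  cont_on a b (fun x => f x + g x).
Proof.
move=> /cont_onP fc /cont_onP gc; apply/cont_onP.
by move=> x; apply: cvgD; [exact: fc|exact: gc].
Qed.

Lemma cont_on_cst a b (c : R) : cont_on a b (fun=> c).
Proof. by apply/cont_onP => x; exact: cvg_cst. Qed.

(** Partial derivatives of H of top order are obtained as pointwise limits and are known only to be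
    bounded and measurable, so integrals are handled in this class. *)
Definition bmeas a b f B := measurable_fun `[a, b]%classic f /\
  forall x, a <= x <= b -> `|f x| <= B.

Lemma bmeas_sub a b a' b' f B : a <= a' -> b' <= b -> bmeas a b f B -> bmeas a' b' f B.
Proof.
move=> aa bb [mf fB]; split.
  apply: measurable_funS mf => //; apply: subset_itv; by rewrite bnd_simp.
by move=> x /andP[x1 x2]; apply: fB; rewrite (le_trans aa)// (le_trans x2).
Qed.

Lemma bmeasM a b f g B B' : bmeas a b f B -> bmeas a b g B' ->
  bmeas a b (fun x => f x * g x) (B * B').
Proof.
move=> [mf fB] [mg gB]; split; first exact: measurable_funM.
by move=> x xab; rewrite normrM ler_pM// ?fB ?gB.
Qed.

Lemma bmeasB a b f g B B' : bmeas a b f B -> bmeas a b g B' ->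
  bmeas a b (fun x => f x - g x) (B + B').
Proof.
move=> [mf fB] [mg gB]; split; first exact: measurable_funB.
by move=> x xab; rewrite (le_trans (ler_normB _ _))// lerD ?fB ?gB.
Qed.

Lemma bmeas_integrable a b f B : bmeas a b f B ->
  mu.-integrable `[a, b] (EFin \o f).
Proof.
move=> [mf fB]; apply: measurable_bounded_integrable => //.
  by rewrite /= lebesgue_measure_itv /=; case: ifPn => // _; rewrite -EFinB ltry.
exists B; split; first by rewrite num_real.
move=> x Bx y /=; rewrite in_itv /= => yab.
by rewrite (le_trans (fB _ yab))// ltW.
Qed.

Lemma integral_cst_itv a b (c : R) : a <= b ->
  \int[mu]_(x in `[a, b]) c = c * (b - a).
Proof.
move=> ab; rewrite Rintegral_cst//; congr (_ * _).
rewrite [X in fine X](_ : _ = (b - a)%:E)//.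
rewrite [LHS]lebesgue_measure_itv /= lte_fin; case: ifPn => [_|].
  by rewrite EFinB.
by rewrite -leNgt => ba; rewrite (_ : b - a = 0)//; lra.
Qed.

Lemma integral_bound a b f B : a <= b -> bmeas a b f B ->
  `|\int[mu]_(x in `[a, b]) f x| <= B * (b - a).
Proof.
move=> ab Hf; have fi := bmeas_integrable Hf.
apply: (le_trans (le_normr_Rintegral _ fi)) => //.
rewrite -(integral_cst_itv B ab).
have B0 : 0 <= B.
  by case: Hf => _ /(_ a); rewrite lexx ab => /(_ isT); apply: le_trans.
apply: le_Rintegral => //.
- apply: (@bmeas_integrable a b (fun x => `|f x|) B); split.
    by case: Hf => mf _; exact: measurableT_comp.
  by case: Hf => _ fB x xab; rewrite normr_id fB.
- apply: (@bmeas_integrable a b (fun=> B) B); split => // x _; by rewrite ger0_norm.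
- by move=> x /=; rewrite in_itv /= => xab; case: Hf => _ fB; exact: fB.
Qed.

Lemma le_integral_abs a b f g B B' : a <= b -> bmeas a b f B -> bmeas a b g B' ->
  (forall x, a <= x <= b -> `|f x| <= g x) ->
  `|\int[mu]_(x in `[a, b]) f x| <= \int[mu]_(x in `[a, b]) g x.
Proof.
move=> ab Hf Hg fg; apply: (le_trans (le_normr_Rintegral _ (bmeas_integrable Hf))) => //.
apply: le_Rintegral => //.
- apply: (@bmeas_integrable a b (fun x => `|f x|) B); split.
    by case: Hf => mf _; exact: measurableT_comp.
  by case: Hf => _ fB x xab; rewrite normr_id fB.
- exact: bmeas_integrable Hg.
Qed.

Lemma integral_split a b c f B : a <= b <= c -> bmeas a c f B ->
  \int[mu]_(x in `[a, c]) f x =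
  \int[mu]_(x in `[a, b]) f x + \int[mu]_(x in `[b, c]) f x.
Proof.
move=> /andP[ab bc] Hf.
have H := @Rintegral_itvB _ f (BLeft a) (BRight c) b (bmeas_integrable Hf).
rewrite !bnd_simp in H; move: (H ab bc) => {}H.
rewrite -(Rintegral_itv_obnd_cbnd (r := b)); last first.
  apply: integrableS (bmeas_integrable Hf) => //; apply: subset_itv; by rewrite bnd_simp.
by rewrite -H addrC subrK.
Qed.

Lemma itv_integralB a b f g B B' : bmeas a b f B -> bmeas a b g B' ->
  \int[mu]_(x in `[a, b]) (f x - g x) =
  \int[mu]_(x in `[a, b]) f x - \int[mu]_(x in `[a, b]) g x.
Proof. by move=> Hf Hg; apply: RintegralB => //; [exact: bmeas_integrable Hf|exact: bmeas_integrable Hg]. Qed.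

Lemma itv_integralZ a b f B c : bmeas a b f B ->
  \int[mu]_(x in `[a, b]) (c * f x) = c * \int[mu]_(x in `[a, b]) f x.
Proof. by move=> Hf; apply: RintegralZl => //; exact: bmeas_integrable Hf. Qed.

Lemma eq_integral_itv a b f g : (forall x, a <= x <= b -> f x = g x) ->
  \int[mu]_(x in `[a, b]) f x = \int[mu]_(x in `[a, b]) g x.
Proof.
by move=> fg; apply: eq_Rintegral => x; rewrite inE /= in_itv /=; exact: fg.
Qed.

Lemma integral_point a f : \int[mu]_(x in `[a, a]) f x = 0.
Proof. by rewrite set_itv1 Rintegral_set1. Qed.

Lemma dct_itv a b (f_ : nat -> R -> R) f B : a <= b ->
  (forall n, bmeas a b (f_ n) B) ->
  (forall x, a <= x <= b -> f_ ^~ x @ \oo --> f x) ->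
  \int[mu]_(x in `[a, b]) f_ n x @[n --> \oo] --> \int[mu]_(x in `[a, b]) f x.
Proof.
move=> ab Hf fl.
have B0 : 0 <= B.
  by case: (Hf 0%N) => _ /(_ a); rewrite lexx ab => /(_ isT); apply: le_trans.
have mf : measurable_fun `[a, b]%classic f.
  apply: (@measurable_fun_cvg _ _ _ _ f_) => [n|x /=].
    by case: (Hf n).
  by rewrite in_itv /=; exact: fl.
have fB x : a <= x <= b -> `|f x| <= B.
  move=> xab; have H : `|f_ n x| @[n --> \oo] --> `|f x|.
    by apply: cvg_norm; exact: fl.
  rewrite -(cvg_lim (@Rhausdorff R) H); apply: limr_le; first by apply/cvg_ex; exists `|f x|.
  by apply: nearW => n; case: (Hf n) => _; exact.
apply: fine_cvg; rewrite /Rintegral fineK; last first.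
  apply: integrable_fin_num => //; exact: (@bmeas_integrable a b f B).
apply: (@dominated_cvg _ _ _ mu `[a, b]%classic _ (fun n x => (f_ n x)%:E) _ (EFin \o cst B)) => //=.
- by move=> n; apply/measurable_EFinP; case: (Hf n).
- by move=> x; rewrite in_itv /= => xab; apply: cvg_EFin; [exact: nearW|exact: fl].
- by apply: (@bmeas_integrable a b (cst B) B); split => // x _; rewrite ger0_norm.
- by move=> n x; rewrite in_itv /= lee_fin => xab; case: (Hf n) => _; exact.
Qed.

Lemma has_deriv_integral T g B t : bmeas 0 T g B -> 0 <= t <= T ->
  (forall e, 0 < e -> exists2 d, 0 < d & forall y, 0 <= y <= T -> `|y - t| < d -> `|g y - g t| <= e) ->
  has_deriv 0 T (fun u => \int[mu]_(x in `[0, u]) g x) t (g t).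
Proof.
move=> Hg /andP[t0 tT] gc e e0; have [d d0 Hd] := gc e e0.
exists d => // u /andP[u0 uT] ut.
have main x y : 0 <= x -> x <= y -> y <= T -> (forall z, x <= z <= y -> `|z - t| < d) ->
    `|\int[mu]_(z in `[0, y]) g z - \int[mu]_(z in `[0, x]) g z - g t * (y - x)| <= e * (y - x).
  move=> x0 xy yT Hz.
  rewrite (@integral_split 0 x y g B) ?x0//; last exact: bmeas_sub Hg.
  rewrite (addrC (\int[mu]_(z in `[0, x]) _)) addrK -integral_cst_itv//.
  have Hg' : bmeas x y g B by exact: bmeas_sub Hg.
  have Hc : bmeas x y (fun=> g t) `|g t| by split.
  rewrite -(itv_integralB Hg' Hc); apply: integral_bound => //; split.
    by case: (bmeasB Hg' Hc).
  move=> z zxy; apply: Hd; last exact: Hz.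
  by case/andP: zxy => z1 z2; rewrite (le_trans x0)// (le_trans z2).
case: (leP t u) => tu.
  rewrite (ger0_norm (_ : 0 <= u - t)) ?subr_ge0//; apply: main => // z /andP[z1 z2].
  apply: le_lt_trans ut; rewrite !ger0_norm ?subr_ge0//; lra.
rewrite distrC (distrC u) (ger0_norm (_ : 0 <= t - u)) ?subr_ge0 ?(ltW tu)//.
rewrite (_ : _ - _ = \int[mu]_(z in `[0, t]) g z - \int[mu]_(z in `[0, u]) g z - g t * (t - u)); last by ring.
apply: main => //; first exact: ltW.
move=> z /andP[z1 z2]; apply: le_lt_trans ut.
rewrite distrC (distrC u) !ger0_norm ?subr_ge0 ?(ltW tu)//; lra.
Qed.

End IntervalIntegrals.

(** * Solutions of the Volterra equation *)

Section Volterra.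
Variable R : realType.
Notation mu := (@lebesgue_measure R).

Lemma cont_on_uniform_limit (a b : R) (f : R -> R) :
  (forall e, 0 < e -> exists2 g, cont_on a b g & forall x, a <= x <= b -> `|f x - g x| <= e) ->
  cont_on a b f.
Proof.
move=> H x xab e e0; have e3 : 0 < e / 3 by rewrite divr_gt0.
have [g gc fg] := H _ e3; have [d d0 Hd] := gc x xab _ e3.
exists d => // y yab yx; have H1 := fg _ xab; have H2 := fg _ yab; have H3 := Hd _ yab yx.
rewrite (_ : f y - f x = (f y - g y) + (g y - g x) - (f x - g x)); last by ring.
rewrite (le_trans (ler_normB _ _))// (le_trans (lerD (ler_normD _ _) (lexx _)))//.
lra.
Qed.

(** From m > 2 x on, consecutive terms shrink at least by half; C collects the earlier terms. A
    geometric rate is what [geometric_limit] and [le_half_expn_eq0] accept. *)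
Lemma expn_fact_le_half (x : R) : 0 <= x ->
  exists2 C, 0 <= C & forall n, x ^+ n / n`!%:R <= C * (1 / 2) ^+ n.
Proof.
move=> x0; pose a n : R := x ^+ n / n`!%:R.
have a0 n : 0 <= a n by rewrite divr_ge0 ?exprn_ge0.
have aS n : a n.+1 = a n * (x / n.+1%:R).
  rewrite /a exprS factS natrM; field.
  by rewrite fact_neq0 /= addrC natr1 pnatr_eq0.
have [m xm] : exists m, 2 * x < m%:R.
  by exists (Num.bound (2 * x)); apply: archi_boundP; rewrite mulr_ge0.
have small n : (m <= n)%N -> a n.+1 <= a n * (1 / 2).
  move=> mn; rewrite aS ler_wpM2l// ler_pdivrMr ?ltr0n//.
  have : m%:R <= n.+1%:R :> R by rewrite ler_nat ltnW.
  lra.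
pose C := \sum_(i < m.+1) a i * 2 ^+ i.
have C0 : 0 <= C by apply: sumr_ge0 => i _; rewrite mulr_ge0 ?exprn_ge0.
exists C => // n; rewrite -/(a n).
have tw k : 2 ^+ k * (1 / 2) ^+ k = 1 :> R.
  by rewrite -exprMn (_ : 2 * (1 / 2) = 1) ?expr1n//; lra.
have low k : (k <= m)%N -> a k <= C * (1 / 2) ^+ k.
  move=> km; have H : a k * 2 ^+ k <= C.
    rewrite /C (bigD1 (Ordinal (km : (k < m.+1)%N)))//= lerDl.
    by apply: sumr_ge0 => i _; rewrite mulr_ge0 ?exprn_ge0.
  have h : 0 <= (1 / 2 : R) ^+ k by rewrite exprn_ge0//; lra.
  by have := ler_wpM2r h H; rewrite -mulrA tw mulr1.
have [/low//|mn] := leqP n m.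
rewrite -(subnK (ltnW mn)); elim: (n - m)%N => [|k IH]; first exact: low.
rewrite addSn; apply: (le_trans (small _ (leq_addl _ _))).
rewrite [leRHS](_ : _ = C * (1 / 2) ^+ (k + m) * (1 / 2)); last by rewrite -[RHS]mulrA -exprSr.
by apply: ler_wpM2r => //; lra.
Qed.

Section Kernel.
Variables (T A Lam : R) (H : R -> R -> R).
Hypotheses (T0 : 0 < T) (A0 : 0 <= A).
Hypothesis HA : forall t tau, 0 <= t <= T -> 0 <= tau <= T -> `|H t tau| <= A.
Hypothesis Hlip : forall t t' tau, 0 <= t <= T -> 0 <= t' <= T -> 0 <= tau <= T ->
  `|H t' tau - H t tau| <= Lam * `|t' - t|.
Hypothesis Hcont : forall t, 0 <= t <= T -> cont_on 0 T (H t).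

Definition volterra_op (t : R) (g : R -> R) : R :=
  \int[mu]_(tau in `[0, t]) (H t tau * g tau).

Lemma kernel_bmeas t : 0 <= t <= T -> bmeas 0 T (H t) A.
Proof.
by move=> tT; split; [apply: cont_on_measurable; exact: Hcont tT|move=> x xT; exact: HA].
Qed.

Lemma sub_bmeas t g Y : 0 <= t <= T -> bmeas 0 T g Y -> bmeas 0 t g Y.
Proof. by move=> /andP[_ tT]; apply: bmeas_sub. Qed.

Lemma kernel_mul_bmeas t s g Y : 0 <= t <= T -> 0 <= s <= T -> bmeas 0 T g Y ->
  bmeas 0 s (fun tau => H t tau * g tau) (A * Y).
Proof.
by move=> tT sT Hg; apply: (sub_bmeas sT); apply: bmeasM => //; exact: kernel_bmeas.
Qed.

Lemma volterra_op_bound t g Y : 0 <= t <= T -> bmeas 0 T g Y ->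
  `|volterra_op t g| <= A * Y * t.
Proof.
move=> tT Hg; rewrite -[X in _ <= _ * X]subr0; apply: integral_bound.
  by case/andP: tT.
exact: kernel_mul_bmeas.
Qed.

Lemma volterra_opB t g g' Y Y' : 0 <= t <= T -> bmeas 0 T g Y -> bmeas 0 T g' Y' ->
  volterra_op t g - volterra_op t g' = volterra_op t (fun tau => g tau - g' tau).
Proof.
move=> tT Hg Hg'; rewrite -(itv_integralB (kernel_mul_bmeas tT tT Hg) (kernel_mul_bmeas tT tT Hg')).
by apply: eq_integral_itv => x _; rewrite mulrBr.
Qed.

Lemma volterra_op_cont g Y : bmeas 0 T g Y -> cont_on 0 T (volterra_op ^~ g).
Proof.
move=> Hg.
have Y0 : 0 <= Y.
  by case: Hg => _ /(_ 0); rewrite lexx (ltW T0) => /(_ isT); apply: le_trans.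
pose K := `|Lam| * Y * T + A * Y.
have main t t' : 0 <= t <= T -> 0 <= t' <= T -> t <= t' ->
    `|volterra_op t' g - volterra_op t g| <= K * (t' - t).
  move=> tT tT' tt'; case/andP: (tT) => t0 tT1; case/andP: (tT') => t0' tT1'.
  have B1 := kernel_mul_bmeas tT' tT' Hg; have B2 := kernel_mul_bmeas tT' tT Hg.
  have B3 := kernel_mul_bmeas tT tT Hg.
  have tt0 : 0 <= t <= t' by rewrite t0.
  rewrite /volterra_op (integral_split tt0 B1) addrAC -(itv_integralB B2 B3).
  rewrite (le_trans (ler_normD _ _))// /K mulrDl lerD//; last first.
    by apply: integral_bound => //; apply: bmeas_sub B1.
  rewrite (le_trans (integral_bound (B := `|Lam| * (t' - t) * Y) t0 _))//.
    split; first by case: (bmeasB B2 B3).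
    move=> x /andP[x0 xt]; rewrite -mulrBl normrM.
    have xT : 0 <= x <= T by rewrite x0 (le_trans xt).
    rewrite ler_pM//; last by case: Hg => _; apply.
    apply: (le_trans (Hlip tT tT' xT)); rewrite ger0_norm ?subr_ge0//.
    by rewrite ler_wpM2r ?subr_ge0// ler_norm.
  rewrite subr0 (_ : _ * t = `|Lam| * Y * t * (t' - t)); last by ring.
  by rewrite ler_wpM2r ?subr_ge0// ler_wpM2l// mulr_ge0.
apply: (@lipschitz_cont_on _ _ _ _ K) => x y xT yT.
case: (leP x y) => xy.
  by rewrite (ger0_norm (_ : 0 <= y - x)) ?subr_ge0//; exact: main.
rewrite distrC (distrC y) (ger0_norm (_ : 0 <= x - y)) ?subr_ge0 ?(ltW xy)//.
by apply: main => //; exact: ltW.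
Qed.

(* The estimate Z (A t)^n / n! makes the Picard iteration converge and is also
   what forces uniqueness. *)
Lemma volterra_op_pow g Y n : 0 <= Y -> bmeas 0 T g Y ->
  forall (Z : R), 0 <= Z -> (forall tau, 0 <= tau <= T -> `|g tau| <= Z * ((A * tau) ^+ n / n`!%:R)) ->
  forall t, 0 <= t <= T -> `|volterra_op t g| <= Z * ((A * t) ^+ n.+1 / n.+1`!%:R).
Proof.
move=> Y0 Hg Z Z0 gZ t tT; case/andP: (tT) => t0 tT1.
pose phi tau := A * (Z * ((A * tau) ^+ n / n`!%:R)).
have phic : cont_on 0 t phi.
  have Hid : cont_on 0 t (id : R -> R).
    apply: (@lipschitz_cont_on _ _ _ _ 1) => x y _ _; by rewrite mul1r.
  have Hpow m : cont_on 0 t (fun x : R => x ^+ m).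
    elim: m => [|m IH]; first exact: cont_on_cst.
    have -> : (fun x : R => x ^+ m.+1) = (fun x => x * x ^+ m).
      by apply/funext => x; rewrite exprS.
    exact: cont_onM.
  have -> : phi = (fun x => (A * Z * A ^+ n / n`!%:R) * x ^+ n).
    by apply/funext => x; rewrite /phi exprMn; ring.
  by apply: cont_onM => //; exact: cont_on_cst.
have [P P0 HP] := cont_on_bounded t0 phic.
have phib : bmeas 0 t phi P by split => //; exact: cont_on_measurable.
apply: (le_trans (le_integral_abs t0 (kernel_mul_bmeas tT tT Hg) phib _)).
  move=> x /andP[x0 xt]; have xT : 0 <= x <= T by rewrite x0 (le_trans xt).
  by rewrite normrM /phi ler_pM// ?HA ?gZ.
pose F u := \int[mu]_(x in `[0, u]) phi x.
(* The integral of [phi] is bounded by comparing derivatives with this power. *)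
pose G u := (A ^+ n.+1 * Z / n.+1`!%:R) * (u - 0) ^+ n.+1.
have := @has_deriv_compare _ F phi G (fun u => (A ^+ n.+1 * Z / n.+1`!%:R) * (n.+1%:R * (u - 0) ^+ n)) 0 t t0.
rewrite /F integral_point subr0 /G !subr0 expr0n /= mulr0 subr0 => HH.
apply: (le_trans (ler_norm _)).
have -> : Z * ((A * t) ^+ n.+1 / (n.+1)`!%:R) = A ^+ n.+1 * Z / (n.+1)`!%:R * t ^+ n.+1.
  by rewrite exprMn; ring.
apply: HH.
- by move=> u ut; apply: (has_deriv_integral phib ut (phic u ut)).
- move=> u ut; apply: has_derivZ.
  have := @has_derivX R 0 t 0 u n.+1; rewrite subr0.
  by apply: eq_has_deriv => [|v _]; rewrite subr0.
- move=> u /andP[u0 _]; rewrite ger0_norm; last first.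
    by rewrite /phi !mulr_ge0 ?exprn_ge0 ?invr_ge0 ?mulr_ge0.
  rewrite /phi le_eqVlt; apply/orP; left; apply/eqP.
  rewrite factS natrM exprMn exprS subr0; field.
  by rewrite fact_neq0 /= addrC natr1 pnatr_eq0.
Qed.

Variable f : R -> R.
Hypothesis fcont : cont_on 0 T f.

Fixpoint picard n : R -> R :=
  if n is m.+1 then fun t => f t + volterra_op t (picard m) else f.

Lemma cont_on_bmeas g : cont_on 0 T g -> exists2 Y, 0 <= Y & bmeas 0 T g Y.
Proof.
move=> gc; have [Y Y0 HY] := cont_on_bounded (ltW T0) gc.
by exists Y => //; split => //; exact: cont_on_measurable.
Qed.

Lemma picard_cont n : cont_on 0 T (picard n).
Proof.
elim: n => //= n IH; apply: cont_onD => //.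
by have [Y _ HY] := cont_on_bmeas IH; exact: volterra_op_cont HY.
Qed.

Lemma volterra_exists : exists2 x, cont_on 0 T x &
  forall t, 0 <= t <= T -> x t - volterra_op t x = f t.
Proof.
have AT0 : 0 <= A * T by rewrite mulr_ge0// ltW.
have [C C0 HC] := expn_fact_le_half AT0.
have [Bf Bf0 HBf] := cont_on_bmeas fcont.
pose Y := A * Bf * T.
have Y0 : 0 <= Y by rewrite !mulr_ge0// ltW.
have step n t : 0 <= t <= T ->
    `|picard n.+1 t - picard n t| <= Y * ((A * t) ^+ n / n`!%:R).
  elim: n t => [|n IH] t tT.
    rewrite expr0 fact0 divr1 mulr1 /= addrAC subrr add0r.
    apply: (le_trans (volterra_op_bound tT HBf)).
    by rewrite ler_wpM2l ?mulr_ge0//; case/andP: tT.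
  have [Y1 Y10 H1] := cont_on_bmeas (picard_cont n.+1).
  have [Y2 Y20 H2] := cont_on_bmeas (picard_cont n).
  have -> : picard n.+2 t - picard n.+1 t =
      volterra_op t (fun tau => picard n.+1 tau - picard n tau).
    by rewrite -(volterra_opB tT H1 H2) /=; ring.
  exact: (volterra_op_pow (addr_ge0 Y10 Y20) (bmeasB H1 H2) Y0 IH).
have step' n t : 0 <= t <= T -> `|picard n.+1 t - picard n t| <= (Y * C) * (1 / 2) ^+ n.
  move=> tT; apply: (le_trans (step n t tT)); rewrite -mulrA ler_wpM2l//.
  apply: le_trans (HC n); rewrite ler_wpM2r ?invr_ge0//.
  case/andP: tT => t0 tT; rewrite lerXn2r ?nnegrE ?mulr_ge0 ?(ltW T0)//.
  by rewrite ler_wpM2l.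
have ex t : exists x, 0 <= t <= T -> forall n, `|x - picard n t| <= 2 * (Y * C) * (1 / 2) ^+ n.
  have [tT|?] := boolP (0 <= t <= T); last by exists 0.
  have h : 0 <= (1 / 2 : R) <= 1 / 2 by rewrite lexx andbT; lra.
  have [|x Hx] := @geometric_limit _ (fun n => picard n t) (Y * C) (1 / 2) h.
    by move=> n; exact: step'.
  by exists x.
have [x Hx] := choice ex.
have xc : cont_on 0 T x.
  apply: cont_on_uniform_limit => e e0.
  have [n Hn] : exists n, 2 * (Y * C) / e < n%:R.
    exists (Num.bound (2 * (Y * C) / e)); apply: archi_boundP.
    by rewrite divr_ge0 ?mulr_ge0// ltW.
  exists (picard n); first exact: picard_cont.
  move=> t tT; apply: (le_trans (Hx t tT n)).
  have YC0 : 0 <= 2 * (Y * C) by rewrite mulr_ge0// mulr_ge0.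
  rewrite (le_trans (ler_wpM2l YC0 (half_expn_le_inv R n)))//.
  rewrite ler_pdivrMr ?ltr0n// [e * _]mulrC -ler_pdivrMr// (le_trans (ltW Hn))//.
  by rewrite ler_nat.
exists x => // t tT; apply/eqP; rewrite -subr_eq0; apply/eqP.
pose D := 2 * (Y * C).
have D0 : 0 <= D by rewrite mulr_ge0// mulr_ge0.
(* With K the integral operator, the residual x - K x - f equals (x - x_(n+1)) - K (x - x_n), and
   both parts decay like 2^(-n). *)
apply: (@le_half_expn_eq0 _ _ (D + A * T * D)) => n.
have [Yx _ Hxm] := cont_on_bmeas xc.
have [Yn _ Hnm] := cont_on_bmeas (picard_cont n).
have Hd : bmeas 0 T (fun tau => x tau - picard n tau) (D * (1 / 2) ^+ n).
  split; first by case: (bmeasB Hxm Hnm).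
  by move=> tau tauT; exact: Hx.
have := volterra_op_bound tT Hd; rewrite -(volterra_opB tT Hxm Hnm) => H1.
have H2 := Hx t tT n.+1.
rewrite (_ : _ - f t = (x t - picard n.+1 t) - (volterra_op t x - volterra_op t (picard n))); last first.
  by rewrite /=; ring.
rewrite (le_trans (ler_normB _ _))// (le_trans (lerD H2 H1))// [leRHS]mulrDl.
have p0 : 0 <= (1 / 2 : R) ^+ n by rewrite exprn_ge0//; lra.
have Dp := mulr_ge0 D0 p0.
apply: lerD.
  rewrite exprS -/D; nra.
rewrite (_ : A * T * D * _ = A * (D * (1 / 2) ^+ n) * T); last by ring.
by apply: ler_wpM2l; [exact: mulr_ge0|case/andP: tT].
Qed.

Lemma volterra_unique x y : cont_on 0 T x -> cont_on 0 T y ->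
  (forall t, 0 <= t <= T -> x t - volterra_op t x = f t) ->
  (forall t, 0 <= t <= T -> y t - volterra_op t y = f t) ->
  forall t, 0 <= t <= T -> y t = x t.
Proof.
move=> xc yc Hx Hy t tT; apply/eqP; rewrite -subr_eq0; apply/eqP.
have AT0 : 0 <= A * T by rewrite mulr_ge0// ltW.
have [C C0 HC] := expn_fact_le_half AT0.
have [Yx Yx0 Hxm] := cont_on_bmeas xc.
have [Yy Yy0 Hym] := cont_on_bmeas yc.
pose Y := Yy + Yx; have Y0 : 0 <= Y by rewrite addr_ge0.
have Hd := bmeasB Hym Hxm.
have step n s : 0 <= s <= T -> `|y s - x s| <= Y * ((A * s) ^+ n / n`!%:R).
  elim: n s => [|n IH] s sT.
    by rewrite expr0 fact0 divr1 mulr1; case: Hd => _; exact.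
  have -> : y s - x s = volterra_op s (fun tau => y tau - x tau).
    rewrite -(volterra_opB sT Hym Hxm).
    by have := Hx s sT; have := Hy s sT; lra.
  exact: (volterra_op_pow Y0 Hd Y0 IH).
apply: (@le_half_expn_eq0 _ _ (Y * C)) => n.
apply: (le_trans (step n t tT)); rewrite -mulrA ler_wpM2l//.
apply: le_trans (HC n); rewrite ler_wpM2r ?invr_ge0//.
case/andP: tT => t0 tT; rewrite lerXn2r ?nnegrE ?mulr_ge0 ?(ltW T0)//.
by rewrite ler_wpM2l.
Qed.

End Kernel.
End Volterra.

(** * Differentiation of integrals with a parameter and a variable end *)

Section KernelDerivative.
Variable R : realType.
Notation mu := (@lebesgue_measure R).

(* The top derivative [v] is only a pointwise limit of difference quotients, so
   this rests on dominated convergence along a sequence violating the claim. *)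
Lemma has_deriv_param_integral (T t b X M d0 : R) (u : R -> R -> R) (v x : R -> R) :
  0 <= b -> 0 < d0 -> bmeas 0 b x X ->
  (forall s, 0 <= s <= T -> `|s - t| < d0 -> measurable_fun `[0, b]%classic (u s)) ->
  measurable_fun `[0, b]%classic (u t) ->
  (exists B, forall tau, 0 <= tau <= b -> `|u t tau| <= B) ->
  (forall s tau, 0 <= s <= T -> `|s - t| < d0 -> 0 <= tau <= b ->
     `|u s tau - u t tau| <= M * `|s - t|) ->
  (forall tau, 0 <= tau <= b -> has_deriv 0 T (u ^~ tau) t (v tau)) ->
  has_deriv 0 T (fun s => \int[mu]_(tau in `[0, b]) (u s tau * x tau)) t
    (\int[mu]_(tau in `[0, b]) (v tau * x tau)).
Proof.
move=> b0 d00 Hx mu_ mut [B utB] lip dv e e0; apply: contrapT => nex.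
have X0 : 0 <= X.
  by case: Hx => _ /(_ 0); rewrite lexx b0 => /(_ isT); apply: le_trans.
set l := \int[mu]_(tau in _) (v tau * x tau) in nex *.
pose P s := \int[mu]_(tau in `[0, b]) (u s tau * x tau).
have ex n : exists s, [/\ 0 <= s <= T, `|s - t| < d0, `|s - t| < n.+1%:R^-1 &
    e * `|s - t| < `|P s - P t - l * (s - t)|].
  apply: contrapT => H; apply: nex; exists (Num.min d0 n.+1%:R^-1).
    by rewrite lt_min d00 invr_gt0 ltr0n.
  move=> s sT; rewrite lt_min => /andP[sd sn]; rewrite leNgt; apply/negP => Hs.
  by apply: H; exists s.
have [s Hs] := choice ex.
have st n : s n - t != 0.
  case: (Hs n) => _ _ _; apply: contraTneq => /eqP; rewrite subr_eq0 => /eqP ->.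
  by rewrite !subrr mulr0 subr0 normr0 mulr0 ltxx.
have M0 : 0 <= M.
  case: (Hs 0%N) => sT sd _ _; have := lip _ 0 sT sd; rewrite lexx b0 => /(_ isT).
  move=> /(le_trans (normr_ge0 _)); rewrite pmulr_lge0//.
  by rewrite normr_gt0.
pose F n tau := (u (s n) tau - u t tau) / (s n - t) * x tau.
have Fb n : bmeas 0 b (F n) (M * X).
  apply: bmeasM => //; case: (Hs n) => sT sd _ _; split.
    by apply: measurable_funM; [apply: measurable_funB => //; exact: mu_|exact: measurable_cst].
  move=> tau taub; rewrite normrM normfV ler_pdivrMr ?normr_gt0 ?st//.
  exact: lip.
have usb n : bmeas 0 b (u (s n)) (B + M * `|s n - t|).
  case: (Hs n) => sT sd _ _; split; first exact: mu_.
  move=> tau taub; rewrite -[u (s n) tau](subrK (u t tau)) addrC.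
  by rewrite (le_trans (ler_normD _ _))// lerD ?utB ?lip.
have utb : bmeas 0 b (u t) B by split.
have Fint n : \int[mu]_(tau in `[0, b]) F n tau = (P (s n) - P t) / (s n - t).
  rewrite /P -(itv_integralB (bmeasM (usb n) Hx) (bmeasM utb Hx)) mulrC.
  have := itv_integralZ (s n - t)^-1 (bmeasB (bmeasM (usb n) Hx) (bmeasM utb Hx)).
  move=> <-; apply: eq_integral_itv => tau _; rewrite /F; ring.
have Fl tau : 0 <= tau <= b -> F ^~ tau @ \oo --> v tau * x tau.
  move=> taub; apply: cvgM; last exact: cvg_cst.
  apply/cvgrPdist_le => e1 e10; have [d d1 Hd] := dv tau taub _ e10.
  near=> n; case: (Hs n) => sT _ sn _.
  have sd : `|s n - t| < d.
    apply: (lt_le_trans sn); near: n.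
    have := near_infty_natSinv_lt (PosNum d1).
    by apply: filterS => n /ltW.
  have st0 : 0 < `|s n - t| by rewrite normr_gt0.
  rewrite distrC -(ler_pM2r st0) -normrM mulrBl divfK//.
  exact: Hd.
have := dct_itv b0 Fb Fl; rewrite -/l => /cvgrPdist_le /(_ e e0)[n0 _ /(_ n0 (leqnn _))].
rewrite Fint distrC; case: (Hs n0) => _ _ _; rewrite ltNge => /negP H /= H1; apply: H.
have st0 : 0 < `|s n0 - t| by rewrite normr_gt0.
by move: H1; rewrite -(ler_pM2r st0) -normrM mulrBl divfK.
Unshelve. all: by end_near. Qed.

(** Leibniz' rule. [P] varies only the parameter and [G] only the end point; what is left is the
    integral of (u s - u t) x between t and s, which is O(|s - t|^2) by the Lipschitz bound. *)
Lemma has_deriv_volterra_op (T t X M d0 : R) (u : R -> R -> R) (v x : R -> R) :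
  0 <= t <= T -> 0 < d0 -> cont_on 0 T x ->
  (forall s, 0 <= s <= T -> `|s - t| < d0 -> cont_on 0 T (u s)) ->
  (forall s tau, 0 <= s <= T -> `|s - t| < d0 -> 0 <= tau <= T ->
     `|u s tau - u t tau| <= M * `|s - t|) ->
  (forall tau, 0 <= tau <= T -> has_deriv 0 T (u ^~ tau) t (v tau)) ->
  has_deriv 0 T (fun s => \int[mu]_(tau in `[0, s]) (u s tau * x tau)) t
    (u t t * x t + \int[mu]_(tau in `[0, t]) (v tau * x tau)).
Proof.
move=> tT d00 xc uc lip dv; case/andP: (tT) => t0 tT1.
have T0 : 0 <= T by exact: le_trans tT1.
have [Y Y0 HY] := cont_on_bounded T0 xc.
have Hx : bmeas 0 T x Y by split => //; exact: cont_on_measurable.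
have tt : `|t - t| < d0 by rewrite subrr normr0.
have ub s : 0 <= s <= T -> `|s - t| < d0 -> exists B, bmeas 0 T (u s) B.
  move=> sT sd; have [B B0 HB] := cont_on_bounded T0 (uc s sT sd).
  by exists B; split => //; apply: cont_on_measurable; exact: uc.
have [Bt Hut] := ub t tT tt.
pose P s := \int[mu]_(tau in `[0, t]) (u s tau * x tau).
pose G s := \int[mu]_(tau in `[0, s]) (u t tau * x tau).
pose F s := \int[mu]_(tau in `[0, s]) (u s tau * x tau).
have dP : has_deriv 0 T P t (\int[mu]_(tau in `[0, t]) (v tau * x tau)).
  apply: (@has_deriv_param_integral T t t Y M d0 u v x t0 d00).
  - exact: bmeas_sub Hx.
  - move=> s sT sd; have [B [HB _]] := ub s sT sd.
    apply: measurable_funS HB => //; apply: subset_itv; by rewrite bnd_simp.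
  - by case: (bmeas_sub (lexx 0) tT1 Hut).
  - by exists Bt; case: (bmeas_sub (lexx 0) tT1 Hut).
  - move=> s tau sT sd /andP[tau0 taut]; apply: lip => //.
    by rewrite tau0 (le_trans taut).
  - by move=> tau /andP[tau0 taut]; apply: dv; rewrite tau0 (le_trans taut).
have dG : has_deriv 0 T G t (u t t * x t).
  apply: (has_deriv_integral (bmeasM Hut Hx) tT) => e e0.
  exact: (cont_onM T0 (uc t tT tt) xc) tT e e0.
have rem s : 0 <= s <= T -> `|s - t| < d0 ->
    `|F s - P s - (G s - G t)| <= `|M| * Y * `|s - t| * `|s - t|.
  move=> sT sd; have [Bs Hus] := ub s sT sd; case/andP: (sT) => s0 sT1.
  have Hsx := bmeasM Hus Hx; have Htx := bmeasM Hut Hx.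
  have main a c : 0 <= a -> a <= c -> c <= T -> `|c - a| = `|s - t| ->
      `|\int[mu]_(tau in `[a, c]) (u s tau * x tau) -
        \int[mu]_(tau in `[a, c]) (u t tau * x tau)| <= `|M| * Y * `|s - t| * `|s - t|.
    move=> a0 ac cT E.
    have H1 := bmeas_sub a0 cT Hsx; have H2 := bmeas_sub a0 cT Htx.
    rewrite -(itv_integralB H1 H2) -{2}E (ger0_norm (_ : 0 <= c - a)) ?subr_ge0//.
    apply: integral_bound => //; split; first by case: (bmeasB H1 H2).
    move=> tau /andP[ta tc]; have tauT : 0 <= tau <= T.
      by rewrite (le_trans a0)// (le_trans tc).
    rewrite -mulrBl normrM mulrAC; apply: ler_pM => //; last exact: HY.
    by apply: (le_trans (lip _ _ sT sd tauT)); rewrite ler_wpM2r// ler_norm.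
  case: (leP t s) => ts.
    have ts0 : 0 <= t <= s by rewrite t0.
    rewrite (_ : _ - _ = \int[mu]_(tau in `[t, s]) (u s tau * x tau) -
        \int[mu]_(tau in `[t, s]) (u t tau * x tau)); first exact: main.
    rewrite /F /P /G (integral_split ts0 (bmeas_sub (lexx 0) sT1 Hsx)).
    by rewrite (integral_split ts0 (bmeas_sub (lexx 0) sT1 Htx)); ring.
  have st0 : 0 <= s <= t by rewrite s0 ltW.
  rewrite (_ : _ - _ = - (\int[mu]_(tau in `[s, t]) (u s tau * x tau) -
      \int[mu]_(tau in `[s, t]) (u t tau * x tau))); last first.
    rewrite /F /P /G (integral_split st0 (bmeas_sub (lexx 0) tT1 Hsx)).
    by rewrite (integral_split st0 (bmeas_sub (lexx 0) tT1 Htx)); ring.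
  by rewrite normrN; apply: main => //; [exact: ltW|rewrite distrC].
pose Q s := F s - P s - (G s - G t).
have Qt : Q t = 0 by rewrite /Q /F /P /G; ring.
have dQ : has_deriv 0 T Q t 0.
  move=> e e0; pose K := `|M| * Y + 1.
  have K0 : 0 < K by rewrite ltr_wpDl// mulr_ge0.
  exists (Num.min d0 (e / K)); first by rewrite lt_min d00 divr_gt0.
  move=> s sT; rewrite lt_min => /andP[sd se].
  rewrite Qt mul0r !subr0; apply: (le_trans (rem s sT sd)).
  rewrite ler_wpM2r//.
  move: se; rewrite ltr_pdivlMr// => /ltW; apply: le_trans.
  by rewrite mulrC ler_wpM2l// /K lerDl.
have := has_derivD (has_derivD dG dP) (has_derivD dQ (has_deriv_cst 0 T (- G t) t)).
rewrite !addr0; apply: eq_has_deriv => [|s _]; rewrite /Q /F; ring.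
Qed.

End KernelDerivative.

(** * Derivatives of solutions *)

Section SolutionDerivatives.
Variable R : realType.
Notation mu := (@lebesgue_measure R).

(* The boundary terms of the k-th derivative of a solution x are
   [\sum_(j < k) \sum_(p <- boundary_terms k j) Dmix T H p.1 p.2 t * x^(j)(t)]. *)
Fixpoint boundary_terms (k j : nat) : seq (nat * nat) :=
  if k is k'.+1 then
    [seq (p.1.+1, p.2) | p <- boundary_terms k' j] ++
    [seq (p.1, p.2.+1) | p <- boundary_terms k' j] ++
    (if j is j'.+1 then boundary_terms k' j' else [:: (k', 0%N)])
  else [::].

Lemma boundary_terms_order k j p : p \in boundary_terms k j -> (p.1 + p.2 + j.+1)%N = k.
Proof.
elim: k j p => [|k IH] j p //=.
rewrite !mem_cat => /orP[/mapP[q /IH <- ->] /=|/orP[/mapP[q /IH <- ->] /=|]].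
- by rewrite !addSn.
- by rewrite !addnS !addSn.
- by case: j => [|j]; [rewrite inE => /eqP -> /=; rewrite addn0 addn1|move/IH => <-; rewrite addnS].
Qed.

Lemma boundary_terms_nil k j : (k <= j)%N -> boundary_terms k j = [::].
Proof.
move=> kj; case E : (boundary_terms k j) => [//|p l].
have : p \in boundary_terms k j by rewrite E inE eqxx.
move=> /boundary_terms_order H; move: kj; rewrite -H addnS ltnNge.
by rewrite leq_addl.
Qed.

(** The recursion doubles the terms of (k, j) and adds those of (k, j-1); the bound satisfies the
    same recursion by Pascal's rule. *)
Lemma size_boundary_terms k j : (j < k)%N ->
  (size (boundary_terms k j) <= 2 ^ (k - j.+1) * 'C(k, j.+1))%N.
Proof.
elim: k j => [//|k IH] j jk; rewrite /= !size_cat !size_map.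
have H1 : (size (boundary_terms k j) + size (boundary_terms k j) <=
    2 ^ (k - j) * 'C(k, j.+1))%N.
  move: jk; rewrite ltnS leq_eqVlt => /orP[/eqP ->|jk].
    by rewrite boundary_terms_nil.
  rewrite addnn -mul2n (leq_trans (leq_mul (leqnn 2) (IH _ jk)))//.
  by rewrite mulnA -expnS -subSn// subSS.
rewrite subSS addnA binS mulnDr leq_add//.
case: j jk {H1} => [|j] jk; first by rewrite subn0 bin0 muln1 expn_gt0.
exact: IH.
Qed.

Definition boundary_sum (T : R) (H : R -> R -> R) (l : seq (nat * nat)) (t : R) : R :=
  \sum_(p <- l) Dmix T H p.1 p.2 t.

Lemma has_deriv_boundary_sum (T : R) H l t :
  (forall p, p \in l -> has_deriv 0 T (Dmix T H p.1 p.2) t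
     (Dmix T H p.1.+1 p.2 t + Dmix T H p.1 p.2.+1 t)) ->
  has_deriv 0 T (boundary_sum T H l) t
    (boundary_sum T H [seq (p.1.+1, p.2) | p <- l] t +
     boundary_sum T H [seq (p.1, p.2.+1) | p <- l] t).
Proof.
elim: l => [|p l IH] Hl.
  rewrite /boundary_sum !big_nil addr0.
  by apply: eq_has_deriv (has_deriv_cst _ _ 0 _) => [|u _]; rewrite big_nil.
have Hp := Hl p (mem_head _ _).
have {}IH := IH (fun q ql => Hl q (mem_behead (s := p :: l) ql)).
have := has_derivD Hp IH; rewrite /boundary_sum /= !big_cons /= addrACA.
by apply: eq_has_deriv => [|u _]; rewrite big_cons.
Qed.

Section Region.
Variables (T : R) (H : R -> R -> R) (f x : R -> R) (S : R -> Prop) (n : nat).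
Hypothesis T0 : 0 < T.
Let U k t tau := derivn_on T (fun y => H y tau) k t.
Let Kx k t := \int[mu]_(tau in `[0, t]) (U k t tau * x tau).
Hypothesis S_sub : forall t, S t -> 0 <= t <= T.
(** S is [0, T] with n = r, or (0, T] with n = s. Each t in S has a relative neighbourhood [lo, T]
    inside S on which the partial derivatives up to order n are bounded, and which contains a point
    other than t. *)
Hypothesis S_open : forall t, S t -> exists lo d0, [/\ 0 < d0, 0 <= lo <= t,
  forall u, 0 <= u <= T -> `|u - t| < d0 -> lo <= u,
  forall u, lo <= u <= T -> S u &
  (exists u, lo <= u <= T /\ u != t) /\
  forall k, (k <= n)%N -> exists2 M, 0 <= M & forall u tau, lo <= u <= T -> 0 <= tau <= T -> `|U k u tau| <= M].
Hypothesis HU : forall k t tau, S t -> (k < n)%N -> 0 <= tau <= T ->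
  has_deriv 0 T (fun y => U k y tau) t (U k.+1 t tau).
Hypothesis Hf : forall k t, S t -> (k < n)%N ->
  has_deriv 0 T (derivn_on T f k) t (derivn_on T f k.+1 t).
Hypothesis HD : forall i j t, S t -> (i + j + 1 < n)%N ->
  has_deriv 0 T (Dmix T H i j) t (Dmix T H i.+1 j t + Dmix T H i j.+1 t).
Hypothesis Hcont : forall t, S t -> cont_on 0 T (H t).
Hypothesis xcont : cont_on 0 T x.
Hypothesis xsol : forall t, 0 <= t <= T -> x t - Kx 0 t = f t.

(** Continuity in tau passes from order k to k + 1 because difference quotients in t converge
    uniformly in tau. The rate comes from the bound at order k + 2, so this stops short of order
    n. *)
Lemma partial_cont k t : S t -> (k < n)%N -> cont_on 0 T (U k t).
Proof.
elim: k t => [|k IH] t St kn; first exact: Hcont.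
have [lo [d0 [d00 /andP[lo0 lot] near_lo loS [[u [lou ut]] bnd]]]] := S_open St.
have [M M0 HM] := bnd k.+2 kn.
have tT := S_sub St; case/andP: (tT) => t0 tT1.
have lt : lo <= t <= T by rewrite lot.
apply: cont_on_uniform_limit => e e0.
have uS := loS u lou.
(* a point b of the region at distance at most e / (M + 1) from t *)
pose th := Num.min 1 (e / (M + 1) / `|u - t|).
have ut0 : 0 < `|u - t| by rewrite normr_gt0 subr_eq0.
have eM : 0 < e / (M + 1) by rewrite divr_gt0// ltr_wpDl.
have th0 : 0 < th by rewrite lt_min ltr01 divr_gt0.
have th1 : th <= 1 by rewrite ge_min lexx.
pose b := t + (u - t) * th.
have lb : lo <= b <= T.
  apply: between_itv => //; last by rewrite ltW.
  by rewrite addrC subrK.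
have bt : b - t = (u - t) * th by rewrite /b addrAC subrr add0r.
have bt0 : b - t != 0 by rewrite bt mulf_neq0 ?subr_eq0// gt_eqF.
have bte : `|b - t| <= e / (M + 1).
  rewrite bt normrM (gtr0_norm th0) mulrC -ler_pdivlMr//.
  by rewrite ge_min lexx orbT.
exists (fun tau => (b - t)^-1 * (U k b tau - U k t tau)).
  have bS := loS b lb.
  apply: cont_onM; [exact: ltW|exact: cont_on_cst|].
  by apply: cont_onB; apply: IH => //; exact: ltnW.
move=> tau tauT.
have HT : `|U k b tau - (U k t tau + U k.+1 t tau * (b - t))| <= M * `|b - t| ^+ 2 / 2.
  have := @taylor_bound _ lo T (fun i y => U (k + i) y tau) 2 M t b _ _ lt lb.
  rewrite !big_ord_recl big_ord0 (_ : nat_of_ord (lift ord0 ord0) = 1%N)// !addn0 addn1 addn2.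
  rewrite expr0 expr1 fact0 !divr1 mulr1 addr0; apply => [i s i2 ls|s ls]; last exact: HM.
  rewrite addnS; apply: has_deriv_sub lo0 (lexx _) _; apply: HU => //; first exact: loS.
  by rewrite (leq_ltn_trans _ kn)// -addn1 leq_add2l -ltnS.
have btp : 0 < `|b - t| by rewrite normr_gt0.
rewrite -(ler_pM2r btp) -normrM mulrBl mulrAC mulVf// mul1r.
rewrite distrC (_ : _ - _ = U k b tau - (U k t tau + U k.+1 t tau * (b - t))); last by ring.
apply: (le_trans HT); rewrite expr2 mulrA mulrAC ler_wpM2r//.
rewrite ler_pdivlMr in bte; last by rewrite ltr_wpDl.
nra.
Qed.

(** Order n is included: a derivative is the pointwise limit of difference quotients along a
    sequence, and these are continuous in tau. *)
Lemma partial_measurable k t : S t -> (k <= n)%N -> measurable_fun `[0, T]%classic (U k t).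
Proof.
case: k => [|k] St kn; first by apply: cont_on_measurable; exact: Hcont.
have [lo [d0 [d00 /andP[lo0 lot] near_lo loS [[u [lou ut]] _]]]] := S_open St.
have tT := S_sub St; case/andP: (tT) => t0 tT1.
have lt : lo <= t <= T by rewrite lot.
pose s m := t + (u - t) * m.+1%:R^-1.
have ls m : lo <= s m <= T.
  apply: between_itv => //; first by rewrite addrC subrK.
  by rewrite invr_ge0 ler0n invf_le1 ?ltr0n// ler1n.
have sm m : s m - t = (u - t) / m.+1%:R by rewrite /s addrAC subrr add0r.
have sm0 m : s m - t != 0 by rewrite sm mulf_neq0 ?subr_eq0// invr_eq0 pnatr_eq0.
apply: (@measurable_fun_cvg _ _ _ _ (fun m tau => (U k (s m) tau - U k t tau) * (s m - t)^-1)).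
  move=> m; apply: measurable_funM; last exact: measurable_cst.
  by apply: measurable_funB; apply: cont_on_measurable; apply: partial_cont => //; exact: loS.
move=> tau; rewrite /= in_itv /= => tauT.
apply/cvgrPdist_le => e e0; have [d d1 Hd] := HU St kn tauT e0.
have ut0 : 0 < `|u - t| by rewrite normr_gt0 subr_eq0.
have dut : 0 < d / `|u - t| by rewrite divr_gt0.
near=> m.
have sd : `|s m - t| < d.
  rewrite sm normrM normfV normr_nat mulrC -ltr_pdivlMr//.
  near: m; exact: near_infty_natSinv_lt (PosNum dut).
have sT : 0 <= s m <= T by case/andP: (ls m) => l1 ->; rewrite (le_trans lo0).
have st0 : 0 < `|s m - t| by rewrite normr_gt0.
rewrite distrC -(ler_pM2r st0) -normrM mulrBl divfK//.
exact: Hd.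
Unshelve. all: by end_near. Qed.

Lemma has_deriv_Kx k t : S t -> (k < n)%N ->
  has_deriv 0 T (Kx k) t (U k t t * x t + Kx k.+1 t).
Proof.
move=> St kn; have tT := S_sub St.
have [lo [d0 [d00 /andP[lo0 lot] near_lo loS [_ bnd]]]] := S_open St.
have [M M0 HM] := bnd k.+1 kn.
have lt : lo <= t <= T by rewrite lot; case/andP: tT.
apply: (@has_deriv_volterra_op R T t 0 M d0 (U k) (U k.+1 t) x) => //.
- move=> s sT sd; apply: partial_cont => //; apply: loS.
  by rewrite near_lo//; case/andP: sT.
- move=> s tau sT sd tauT.
  have ls : lo <= s <= T by rewrite near_lo//; case/andP: sT.
  have := @taylor_bound _ lo T (fun i y => U (k + i) y tau) 1 M t s _ _ lt ls.
  rewrite big_ord1 !addn0 addn1 /= expr0 expr1 !divr1 mulr1; apply.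
    move=> i y; rewrite ltnS leqn0 => /eqP -> ly; rewrite addn0 addn1.
    by apply: has_deriv_sub lo0 (lexx _) _; apply: HU => //; exact: loS.
  by move=> y ly; exact: HM.
- by move=> tau tauT; exact: HU.
Qed.

(** Differentiability and the formula are proved together, because the next derivative is that of
    the formula, valid near t. In the recursion of [boundary_terms], two pieces differentiate
    [Dmix], the third differentiates x^(j), and the new pair (k, 0) is the end-point term of
    Leibniz' rule. *)
Lemma solution_derivn k : (k <= n)%N ->
  (forall j t, S t -> (j < k)%N -> has_deriv 0 T (derivn_on T x j) t (derivn_on T x j.+1 t)) /\
  (forall t, S t -> derivn_on T x k t = derivn_on T f k t + Kx k t +
     \sum_(j < k) boundary_sum T H (boundary_terms k j) t * derivn_on T x j t).
Proof.
elim: k => [|k IH] kn.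
  split => // t St; rewrite big_ord0 addr0 /=.
  by have := xsol (S_sub St); lra.
have [IHd IHf] := IH (ltnW kn).
pose l t := derivn_on T f k.+1 t + (U k t t * x t + Kx k.+1 t) +
  \sum_(j < k) ((boundary_sum T H [seq (p.1.+1, p.2) | p <- boundary_terms k j] t +
     boundary_sum T H [seq (p.1, p.2.+1) | p <- boundary_terms k j] t) * derivn_on T x j t +
     boundary_sum T H (boundary_terms k j) t * derivn_on T x j.+1 t).
have dl t : S t -> has_deriv 0 T (derivn_on T x k) t (l t).
  move=> St; have [lo [d0 [d00 _ near_lo loS _]]] := S_open St.
  have H1 : has_deriv 0 T (fun t => derivn_on T f k t + Kx k t +
     \sum_(j < k) boundary_sum T H (boundary_terms k j) t * derivn_on T x j t) t (l t).
    apply: has_derivD; first by apply: has_derivD; [exact: Hf|exact: has_deriv_Kx].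
    apply: (has_deriv_sum (F := fun j t => boundary_sum T H (boundary_terms k j) t * derivn_on T x j t)
      (L := fun j => (boundary_sum T H [seq (p.1.+1, p.2) | p <- boundary_terms k j] t +
     boundary_sum T H [seq (p.1, p.2.+1) | p <- boundary_terms k j] t) * derivn_on T x j t +
     boundary_sum T H (boundary_terms k j) t * derivn_on T x j.+1 t)) => j jk.
    apply: has_derivM; last exact: IHd.
    apply: has_deriv_boundary_sum => p /boundary_terms_order E; apply: HD => //.
    by rewrite (leq_ltn_trans _ kn)// -E leq_add2l.
  apply: (has_deriv_near d00) H1; first by rewrite IHf.
  move=> u uT ud; split => //; rewrite IHf//; apply: loS.
  by rewrite near_lo//; case/andP: uT.
have xl t : S t -> derivn_on T x k.+1 t = l t.
  by move=> St; apply: (has_deriv_deriv_on T0 (S_sub St)); exact: dl.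
split.
  move=> j t St; rewrite ltnS leq_eqVlt => /orP[/eqP ->|]; last exact: IHd.
  by rewrite xl//; exact: dl.
move=> t St; rewrite xl// /l.
have split_terms j : boundary_sum T H (boundary_terms k.+1 j) t =
    (boundary_sum T H [seq (p.1.+1, p.2) | p <- boundary_terms k j] t +
     boundary_sum T H [seq (p.1, p.2.+1) | p <- boundary_terms k j] t) +
    boundary_sum T H (if j is j'.+1 then boundary_terms k j' else [:: (k, 0%N)]) t.
  by rewrite /boundary_sum /= !big_cat /= addrA.
under [in RHS]eq_bigr => j _ do rewrite split_terms mulrDl.
have bs0 : boundary_sum T H [::] t = 0 by rewrite /boundary_sum big_nil.
(* The first sum loses its empty term j = k; the second is shifted by one after its term j = 0 is
   split off. *)
rewrite !big_split /= [X in _ = _ + (X + _)]big_ord_recr /= boundary_terms_nil//.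
rewrite [X in _ = _ + (_ + X)]big_ord_recl /= !bs0 addr0 mul0r addr0.
have -> : boundary_sum T H [:: (k, 0%N)] t = U k t t by rewrite /boundary_sum big_seq1.
have -> : \sum_(i < k) boundary_sum T H (boundary_terms k i) t * derivn_on T x i.+1 t =
  \sum_(i < k) boundary_sum T H (boundary_terms k i) t * derivn_on T x (bump 0 i) t by [].
ring.
Qed.

End Region.
End SolutionDerivatives.

(** * Bounds from the recursion for the derivatives *)

Section Bounds.
Variable R : realType.
Notation mu := (@lebesgue_measure R).

Lemma geometric_convolution (q M : R) k : 0 <= q -> q <= M / 2 ->
  \sum_(j < k.+1) q ^+ (k - j) * M ^+ j <= 2 * M ^+ k.
Proof.
move=> q0 qM; have M0 : 0 <= M by lra.
elim: k => [|k IH].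
  by rewrite big_ord1 subnn !expr0; lra.
rewrite big_ord_recr /= subnn expr0 mul1r.
have -> : \sum_(i < k.+1) q ^+ (k.+1 - i) * M ^+ i = q * \sum_(i < k.+1) q ^+ (k - i) * M ^+ i.
  rewrite mulr_sumr; apply: eq_bigr => i _.
  by rewrite subSn ?exprS ?mulrA// -ltnS.
have Mk : 0 <= M ^+ k by rewrite exprn_ge0.
have := ler_wpM2l q0 IH.
rewrite exprS; nra.
Qed.

(** M is chosen for two purposes: 2 C1 <= M / 2, so that the sum over j is geometric and at most 2
    M^(k-1), and 4 C1 C3 <= M, so that the boundary terms contribute at most A M^k k! times the
    weight. W is either constantly 1, for orders up to r, or the weight at a fixed t. *)
Lemma derivn_recursion_bound (A B C1 C3 : R) : 0 <= A -> 0 <= B -> 1 <= C1 -> 1 <= C3 ->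
  let M := B + 4 * C1 * C3 in
  forall (T t : R) (H : R -> R -> R) (W fk xk : nat -> R) n,
  (forall k, 0 <= W k) ->
  (forall a b, (a + b <= n)%N -> W a * W b <= C3 * W (a + b)%N) ->
  (forall k, (k <= n)%N -> `|fk k| <= geom_fact A B k * W k) ->
  (forall i j, (i + j < n)%N -> `|Dmix T H i j t| <= (i + j)`!%:R * C1 ^+ (i + j).+1 * W (i + j).+1) ->
  (forall k, (k <= n)%N -> xk k = fk k +
     \sum_(j < k) boundary_sum T H (boundary_terms k j) t * xk j) ->
  forall k, (k <= n)%N -> `|xk k| <= geom_fact (2 * A) M k * W k.
Proof.
move=> A0 B0 C11 C31 M T t H W fk xk n W0 WM Hf HD Hx.
have C10 : 0 <= C1 by exact: le_trans C11.
have C30 : 0 <= C3 by exact: le_trans C31.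
have BM : B <= M by rewrite /M lerDl !mulr_ge0.
have M0 : 0 <= M by exact: le_trans BM.
have A20 : 0 <= 2 * A by rewrite mulr_ge0.
elim/ltn_ind => k IH kn.
rewrite Hx// (le_trans (ler_normD _ _))//.
have term j : (j < k)%N ->
    `|boundary_sum T H (boundary_terms k j) t * xk j| <=
    k`!%:R * W k * (2 * A) * (C3 * C1) * ((2 * C1) ^+ (k - j.+1) * M ^+ j).
  move=> jk; set m := (k - j.+1)%N.
  have mk : (m + j.+1)%N = k by rewrite /m subnK.
  have m1j : (m.+1 + j)%N = k by rewrite addSnnS.
  have Hb : `|boundary_sum T H (boundary_terms k j) t| <=
      (2 ^ m * 'C(k, j.+1))%N%:R * (m`!%:R * C1 ^+ m.+1 * W m.+1).
    rewrite (@le_trans _ _ ((size (boundary_terms k j))%:R * (m`!%:R * C1 ^+ m.+1 * W m.+1)))//; last first.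
      rewrite ler_wpM2r ?ler_nat ?size_boundary_terms//.
      by rewrite mulr_ge0// mulr_ge0// exprn_ge0.
    rewrite /boundary_sum (le_trans (ler_norm_sum _ _ _))//.
    have : forall p, p \in boundary_terms k j -> `|Dmix T H p.1 p.2 t| <= m`!%:R * C1 ^+ m.+1 * W m.+1.
      move=> p /boundary_terms_order E.
      have pm : (p.1 + p.2)%N = m by rewrite /m -E addnK.
      by rewrite -pm; apply: HD; rewrite pm (leq_trans _ kn)// -mk addnS ltnS leq_addr.
    elim: (boundary_terms k j) => [|p l IHl] Hl; first by rewrite big_nil mul0r.
    rewrite big_cons /= -natr1 [leRHS]mulrDl mul1r addrC; apply: lerD.
      by apply: IHl => q ql; apply: Hl; rewrite inE ql orbT.
    by apply: Hl; rewrite mem_head.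
  have Hxj := IH j jk (leq_trans (ltnW jk) kn).
  rewrite normrM (le_trans (ler_pM _ _ Hb Hxj))//.
  have Hw : W m.+1 * W j <= C3 * W k by rewrite -m1j; apply: WM; rewrite m1j.
  (* The number of terms and the two factorials fit under k!, as 'C(k, j+1) (j+1)! m! = k!. *)
  have Hfact : (('C(k, j.+1) * m`! * j`!)%N%:R : R) <= k`!%:R.
    rewrite ler_nat -(bin_fact jk) -/m -mulnA leq_mul2l; apply/orP; right.
    by rewrite [leqLHS]mulnC factS -mulnA leq_pmull.
  rewrite /geom_fact natrM natrX.
  rewrite [leLHS](_ : _ = (('C(k, j.+1) * m`! * j`!)%N%:R * (W m.+1 * W j)) *
     ((2 * A) * C1 * ((2 * C1) ^+ m * M ^+ j))); last first.
    by rewrite !natrM exprMn exprS; ring.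
  rewrite [leRHS](_ : _ = (k`!%:R * (C3 * W k)) * ((2 * A) * C1 * ((2 * C1) ^+ m * M ^+ j))); last by ring.
  apply: ler_wpM2r.
    by rewrite mulr_ge0 ?mulr_ge0 ?exprn_ge0 ?mulr_ge0.
  by apply: ler_pM => //; rewrite mulr_ge0.
have Hsum : `|\sum_(j < k) boundary_sum T H (boundary_terms k j) t * xk j| <=
    k`!%:R * W k * A * M ^+ k.
  case: k IH kn term => [|k] IH kn term.
    by rewrite big_ord0 normr0 !mulr_ge0 ?exprn_ge0.
  rewrite (le_trans (ler_norm_sum _ _ _))//.
  apply: (@le_trans _ _ (\sum_(j < k.+1) k.+1`!%:R * W k.+1 * (2 * A) * (C3 * C1) *
      ((2 * C1) ^+ (k.+1 - j.+1) * M ^+ j))).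
    by apply: ler_sum => j _; exact: term.
  rewrite -mulr_sumr.
  have CC : C1 <= C1 * C3 by rewrite ler_peMr.
  have q0 : 0 <= 2 * C1 by rewrite mulr_ge0.
  have qM : 2 * C1 <= M / 2 by rewrite /M; lra.
  have X0 : 0 <= k.+1`!%:R * W k.+1 * (2 * A) * (C3 * C1).
    by rewrite mulr_ge0 ?mulr_ge0.
  apply: (le_trans (ler_wpM2l X0 (geometric_convolution k q0 qM))).
  rewrite exprS (_ : _ * (2 * M ^+ k) = k.+1`!%:R * W k.+1 * A * ((4 * C1 * C3) * M ^+ k)); last by ring.
  apply: ler_wpM2l; first by rewrite mulr_ge0 ?mulr_ge0.
  by rewrite ler_wpM2r ?exprn_ge0// /M lerDr.
apply: (le_trans (lerD (Hf k kn) Hsum)).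
rewrite /geom_fact.
have BMk : B ^+ k <= M ^+ k by rewrite lerXn2r ?nnegrE.
rewrite [leRHS](_ : _ = A * M ^+ k * k`!%:R * W k + k`!%:R * W k * A * M ^+ k); last by ring.
rewrite lerD2r ler_wpM2r// ler_wpM2r//; exact: ler_wpM2l.
Qed.

End Bounds.

(** * Existence and regularity of the solution *)

Section RegularSolution.
Variables (R : realType) (T : R) (r : nat) (zeta : R).
Hypotheses (T0 : 0 < T) (r0 : (0 < r)%N) (zeta0 : 0 <= zeta) (zeta1 : zeta < 1).
Notation mu := (@lebesgue_measure R).

(** The exponent at a + b exceeds the sum of the exponents at a and b by some d with 0 <= d <= r +
    1, the extreme case being d = r + zeta when both orders exceed r. Then t^d <= (1 + T)^(r+1). *)
Lemma weightM a b t : 0 < t <= T ->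
  weight r zeta a t * weight r zeta b t <= (1 + T) ^+ r.+1 * weight r zeta (a + b) t.
Proof.
move=> /andP[t0 tT].
pose e k : R := if (k <= r)%N then 0 else k%:R - r%:R - zeta.
have wE k : weight r zeta k t = t `^ (- e k).
  rewrite /weight /e; case: ifP => _; first by rewrite oppr0 powRr0.
  by rewrite powRN.
have tn : t != 0 by rewrite gt_eqF.
rewrite !wE -powRD ?tn ?implybT// mulrC -ler_pdivrMl ?powR_gt0// -powRN opprK.
rewrite -powRD ?tn ?implybT//.
set d := _ + _.
have rr : 0 <= r%:R :> R by [].
have [d0 dr] : 0 <= d /\ d <= r.+1%:R.
  rewrite /d /e -natr1; case: leqP => abr; case: leqP => ar; case: leqP => br.
  - split; lra.
  - by move: (leq_trans br (leq_trans (leq_addl a b) abr)); rewrite ltnn.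
  - by move: (leq_trans ar (leq_trans (leq_addr b a) abr)); rewrite ltnn.
  - by move: (leq_trans br (leq_trans (leq_addl a b) abr)); rewrite ltnn.
  - have h1 : a%:R <= r%:R :> R by rewrite ler_nat.
    have h2 : b%:R <= r%:R :> R by rewrite ler_nat.
    have h3 : r.+1%:R <= (a + b)%:R :> R by rewrite ler_nat.
    move: zeta0 zeta1; rewrite -natr1 in h3; rewrite natrD in h3 *; split; lra.
  - have h1 : a%:R <= r%:R :> R by rewrite ler_nat.
    have h2 : 0 <= a%:R :> R by [].
    rewrite natrD; split; lra.
  - have h1 : b%:R <= r%:R :> R by rewrite ler_nat.
    have h2 : 0 <= b%:R :> R by [].
    rewrite natrD; split; lra.
  - move: zeta0 zeta1; rewrite natrD; split; lra.
have T1 : 1 <= 1 + T by rewrite lerDl ltW.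
apply: (@le_trans _ _ ((1 + T) `^ d)).
  apply: ge0_ler_powR => //; rewrite ?nnegrE ?(ltW t0)//; lra.
rewrite -powR_mulrn; last by lra.
by apply: ler_powR.
Qed.

Lemma regular_lipschitz s A B g x y : regular T r zeta s A B g ->
  0 <= x <= T -> 0 <= y <= T -> `|g y - g x| <= geom_fact A B 1 * `|y - x|.
Proof.
move=> Hg xT yT.
have := @taylor_bound R 0 T (fun i => derivn_on T g i) 1 (geom_fact A B 1) x y _ _ xT yT.
rewrite big_ord1 /= fact0 expr0 expr1 !divr1 mulr1; apply.
  move=> i t; rewrite ltnS leqn0 => /eqP -> tT.
  by have H1 := regular_has_deriv_low Hg r0 tT; exact: H1.
by move=> t tT; case: Hg => _ _ H3 _; have H1 := H3 1%N t r0 tT; exact: H1.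
Qed.

Lemma regular_cont s A B g : regular T r zeta s A B g -> cont_on 0 T g.
Proof.
by move=> Hg; apply: lipschitz_cont_on => x y; exact: regular_lipschitz Hg.
Qed.

Lemma regular_volterra s A B H f : 0 <= A ->
  separately T (regular T r zeta s A B) H -> regular T r zeta s A B f ->
  exists x, unique_volterra_solution T H f x.
Proof.
move=> A0 HH Hf.
have HA t tau : 0 <= t <= T -> 0 <= tau <= T -> `|H t tau| <= A.
  exact: regular_kernel_bound HH.
have Hlip t t' tau : 0 <= t <= T -> 0 <= t' <= T -> 0 <= tau <= T ->
    `|H t' tau - H t tau| <= geom_fact A B 1 * `|t' - t|.
  by move=> tT tT' tauT; case: HH => + _; move=> /(_ tau tauT) H1; exact: (regular_lipschitz H1).
have Hc t : 0 <= t <= T -> cont_on 0 T (H t).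
  by move=> tT; case: HH => _ /(_ t tT); exact: regular_cont.
have [x xc xs] := volterra_exists T0 A0 HA Hlip Hc (regular_cont Hf).
exists x; split; first by split => //; exact/cont_onP.
move=> y [/cont_onP yc ys].
exact: (volterra_unique T0 A0 HA Hc xc yc xs ys).
Qed.

(** C and M are fixed before s, H and f. This uniformity in s is what allows infinitely many
    derivatives to be bounded with one constant. *)
Lemma regular_solution A B Y : 0 <= A -> 1 <= B -> 0 <= Y ->
  exists C M : R, [/\ 0 <= C, 1 <= M & forall s H f x, (r < s)%N ->
    separately T (regular T r zeta s A B) H -> regular T r zeta s A B f ->
    volterra_solution T H f x -> (forall t, 0 <= t <= T -> `|x t| <= Y) ->
    regular T r zeta s C M x].
Proof.
move=> A0 B1 Y0; have B0 : 0 <= B by exact: le_trans B1.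
have [C1 C11 HC1] := Dmix_bound T0 r0 zeta0 zeta1 A0 B1.
pose C3 := (1 + T) ^+ r.+1.
have C31 : 1 <= C3 by rewrite exprn_ege1// lerDl ltW.
(* Bounds f^(k) together with the integral of the k-th partial derivative of H against x, where |x|
   <= Y on an interval of length at most T. *)
pose A' := A + T * Y * A.
have TY0 : 0 <= T * Y by rewrite mulr_ge0// ltW.
have A'0 : 0 <= A' by rewrite addr_ge0// mulr_ge0.
pose M := B + 4 * C1 * C3.
have C10 : 0 <= C1 by exact: le_trans C11.
have C30 : 0 <= C3 by exact: le_trans C31.
have M1 : 1 <= M by rewrite (le_trans B1)// /M lerDl !mulr_ge0.
exists (2 * A'), M; split => //; first by rewrite mulr_ge0.
move=> s H f x rs HH Hf [/cont_onP xc xs] xY.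
have [HDlow HDhigh] := HC1 s H HH.
pose U k t tau := derivn_on T (fun y => H y tau) k t.
pose Kx k t := \int[mu]_(tau in `[0, t]) (U k t tau * x tau).
have xm : bmeas 0 T x Y by split => //; exact: cont_on_measurable.
have HH1 tau : 0 <= tau <= T -> regular T r zeta s A B (fun t => H t tau) by case: HH => + _; apply.
have Hcont t : 0 <= t <= T -> cont_on 0 T (H t).
  by move=> tT; case: HH => _ /(_ t tT); exact: regular_cont.
have Kbound k t Wk : 0 <= t <= T -> measurable_fun `[0, T]%classic (U k t) ->
    (forall tau, 0 <= tau <= T -> `|U k t tau| <= geom_fact A B k * Wk) ->
    `|derivn_on T f k t| <= geom_fact A B k * Wk ->
    `|derivn_on T f k t + Kx k t| <= geom_fact A' B k * Wk.
  move=> tT mU UW fW; case/andP: (tT) => t0 tT1.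
  have Hm : bmeas 0 T (U k t) (geom_fact A B k * Wk) by split.
  have GW0 : 0 <= geom_fact A B k * Wk by exact: le_trans fW.
  have H1 := integral_bound t0 (bmeas_sub (lexx 0) tT1 (bmeasM Hm xm)).
  rewrite (le_trans (ler_normD _ _))// (le_trans (lerD fW H1))// subr0.
  rewrite [leRHS](_ : _ = geom_fact A B k * Wk + geom_fact A B k * Wk * Y * T); last first.
    by rewrite /geom_fact /A'; ring.
  by rewrite lerD2l ler_wpM2l// mulr_ge0.
have low_open t : 0 <= t <= T -> exists lo d0, [/\ 0 < d0, 0 <= lo <= t,
  forall u, 0 <= u <= T -> `|u - t| < d0 -> lo <= u,
  forall u, lo <= u <= T -> 0 <= u <= T &
  (exists u, lo <= u <= T /\ u != t) /\
  forall k, (k <= r)%N -> exists2 M, 0 <= M & forall u tau, lo <= u <= T -> 0 <= tau <= T -> `|U k u tau| <= M].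
  move=> tT; exists 0, 1; split => //; first by rewrite lexx; case/andP: tT.
    by move=> u /andP[].
  split.
    have [->|t0] := eqVneq t 0; [exists T|exists 0].
      by rewrite lexx ltW// gt_eqF.
    by rewrite lexx ltW// eq_sym.
  move=> k kr; exists (geom_fact A B k); first exact: geom_fact_ge0.
  by move=> u tau uT tauT; case: (HH1 tau tauT) => _ _ H3 _; exact: H3.
have high_open t : 0 < t <= T -> exists lo d0, [/\ 0 < d0, 0 <= lo <= t,
  forall u, 0 <= u <= T -> `|u - t| < d0 -> lo <= u,
  forall u, lo <= u <= T -> 0 < u <= T &
  (exists u, lo <= u <= T /\ u != t) /\
  forall k, (k <= s)%N -> exists2 M, 0 <= M & forall u tau, lo <= u <= T -> 0 <= tau <= T -> `|U k u tau| <= M].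
  move=> /andP[t0 tT]; have t20 : 0 < t / 2 by rewrite divr_gt0.
  exists (t / 2), (t / 2); split => //.
  - by apply/andP; split; lra.
  - by move=> u _; rewrite ltr_norml => /andP[]; lra.
  - by move=> u /andP[u1 ->]; rewrite (lt_le_trans t20).
  split.
    exists (t / 2); split; first by rewrite lexx; lra.
    by rewrite lt_eqF//; lra.
  move=> k ks; exists (geom_fact A B k * weight r zeta k (t / 2)).
    by rewrite mulr_ge0 ?geom_fact_ge0// ltW// weight_gt0.
  move=> u tau /andP[u1 u2] tauT.
  have uT : 0 < u <= T by rewrite u2 (lt_le_trans t20).
  apply: (le_trans (regular_bound (HH1 tau tauT) ks uT)).
  by rewrite ler_wpM2l ?geom_fact_ge0// weight_le// t20.
have [lowd lowf] : (forall j t, 0 <= t <= T -> (j < r)%N -> has_deriv 0 T (derivn_on T x j) t (derivn_on T x j.+1 t)) /\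
  (forall k t, (k <= r)%N -> 0 <= t <= T -> derivn_on T x k t = derivn_on T f k t + Kx k t +
     \sum_(j < k) boundary_sum T H (boundary_terms k j) t * derivn_on T x j t).
  have key k (kr : (k <= r)%N) := @solution_derivn R T H f x (fun t => 0 <= t <= T) r T0
    (fun t tT => tT) low_open
    (fun k t tau tT kr tauT => regular_has_deriv_low (HH1 tau tauT) kr tT)
    (fun k t tT kr => regular_has_deriv_low Hf kr tT)
    (fun i j t tT ij => let: And3 h _ _ := coarse_expansion T0 r0 zeta0 zeta1 A0 B0 HH in h i j t ij tT)
    Hcont xc xs k kr.
  by split; [move=> j t; case: (key r (leqnn r)) => + _; apply|move=> k t kr; case: (key k kr) => _; apply].
have [highd highf] : (forall j t, 0 < t <= T -> (j < s)%N -> has_deriv 0 T (derivn_on T x j) t (derivn_on T x j.+1 t)) /\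
  (forall k t, (k <= s)%N -> 0 < t <= T -> derivn_on T x k t = derivn_on T f k t + Kx k t +
     \sum_(j < k) boundary_sum T H (boundary_terms k j) t * derivn_on T x j t).
  have pos t : 0 < t <= T -> 0 <= t <= T by move=> /andP[/ltW -> ->].
  have key k (ks : (k <= s)%N) := @solution_derivn R T H f x (fun t => 0 < t <= T) s T0
    pos high_open
    (fun k t tau tT ks tauT => regular_has_deriv (HH1 tau tauT) ks tT)
    (fun k t tT ks => regular_has_deriv Hf ks tT)
    (fun i j t tT ij => Dmix_has_deriv T0 zeta1 A0 B0 HH ij tT)
    (fun t tT => Hcont t (pos t tT)) xc xs k ks.
  by split; [move=> j t; case: (key s (leqnn s)) => + _; apply|move=> k t ks; case: (key k ks) => _; apply].
split.
- by move=> k t kr tT; apply: has_deriv_derivable_on (lowd k t tT kr).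
- by move=> k t /andP[_ ks] tT; apply: has_deriv_derivable_on (highd k t tT ks).
- move=> k t kr tT.
  rewrite -[leRHS]mulr1.
  apply: (derivn_recursion_bound A'0 B0 C11 C31 (T := T) (t := t) (H := H) (W := fun=> 1)
    (fk := fun k => derivn_on T f k t + Kx k t) (xk := fun k => derivn_on T x k t) (n := r)) => //.
  + by move=> a b _; rewrite !mulr1.
  + move=> m mr; apply: Kbound => //.
    * apply: (@partial_measurable R T H (fun t => 0 <= t <= T) r T0 (fun t tT => tT) low_open) => //.
      by move=> k' t' tau' tT' kr' tauT'; exact: (regular_has_deriv_low (HH1 tau' tauT')).
    * by move=> tau tauT; rewrite mulr1; case: (HH1 tau tauT) => _ _ H3 _; exact: H3.
    * by rewrite mulr1; case: Hf => _ _ H3 _; exact: H3.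
  + by move=> i j ij; rewrite mulr1; exact: HDlow.
  + by move=> m mr; exact: lowf.
- move=> k t /andP[rk ks] tT.
  have -> : geom_fact (2 * A') M k / t `^ (k%:R - r%:R - zeta) = geom_fact (2 * A') M k * weight r zeta k t.
    by rewrite /weight leqNgt rk.
  have pos u : 0 < u <= T -> 0 <= u <= T by move=> /andP[/ltW -> ->].
  apply: (derivn_recursion_bound A'0 B0 C11 C31 (T := T) (t := t) (H := H) (W := fun k => weight r zeta k t)
    (fk := fun k => derivn_on T f k t + Kx k t) (xk := fun k => derivn_on T x k t) (n := s)) => //.
  + by move=> m; apply/ltW/weight_gt0; case/andP: tT.
  + by move=> a b _; exact: weightM.
  + move=> m ms; apply: Kbound => //.
    * exact: pos.
    * apply: (@partial_measurable R T H (fun t => 0 < t <= T) s T0 pos high_open) => //.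
        by move=> k' t' tau' tT' kr' tauT'; exact: (regular_has_deriv (HH1 tau' tauT')).
      by move=> t' tT'; exact: Hcont (pos _ tT').
    * by move=> tau tauT; exact: (regular_bound (HH1 tau tauT)).
    * exact: (regular_bound Hf).
  + by move=> i j ij; exact: HDhigh.
  + by move=> m ms; exact: highf.
Qed.

End RegularSolution.

(** * The classes Q^* and B^* *)

Section Classes.
Variable R : realType.
Implicit Types (T gamma zeta M A B : R) (r s k : nat) (g : R -> R).

Lemma Q_zeta_bounds gamma : 0 < gamma -> 0 <= Q_zeta gamma < 1.
Proof.
move=> g0; rewrite /Q_zeta; case: ifPn => [_|gi]; first by rewrite lexx ltr01.
have /andP[h1 h2] := truncn_itv (ltW g0).
have h3 : (Num.truncn gamma)%:R != gamma.
  by apply: contraNneq gi => <-; rewrite natr_int.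
have h4 : (Num.truncn gamma)%:R < gamma by rewrite lt_neqAle h3.
rewrite -natr1 in h2; apply/andP; split; lra.
Qed.

Lemma Q_order_gt r gamma : 0 < gamma -> (r < Q_order r gamma)%N.
Proof.
move=> g0; rewrite /Q_order; case: ifPn => [gi|_]; last by rewrite addn1 ltnS leq_addr.
rewrite -[X in (X < _)%N]addn0 ltn_add2l.
have := truncn_itv (ltW g0); case: (Num.truncn gamma) => // /andP[_ g1].
move: gi => /intrP[m gm]; move: g0 g1; rewrite gm ltr0z ltrz1.
by case: m {gm} => [[|m]|m].
Qed.

Lemma geom_fact_mono A B A' B' k : 0 <= A <= A' -> 0 <= B <= B' ->
  geom_fact A B k <= geom_fact A' B' k.
Proof.
move=> /andP[A0 AA] /andP[B0 BB]; rewrite ler_wpM2r// ler_pM ?exprn_ge0//.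
by rewrite lerXn2r ?nnegrE// (le_trans B0).
Qed.

Lemma Qstar_regular T r gamma g : 0 < gamma -> Qstar T r gamma 1 g ->
  regular T r (Q_zeta gamma) (Q_order r gamma) 1 1 g.
Proof.
move=> g0 [H1 H2 H3 H4].
have fk k : 1 <= geom_fact 1 1 k by rewrite /geom_fact expr1n !mul1r ler1n fact_gt0.
split => //.
- by move=> k t kr tT; apply: (le_trans (H3 k t kr tT)); exact: fk.
- move=> k t kr tT; apply: (le_trans (H4 k t kr tT)).
  by rewrite ler_wpM2r// invr_ge0 powR_ge0.
Qed.

Lemma regular_Qstar T r gamma M A B g :
  (forall k, (k <= Q_order r gamma)%N -> geom_fact A B k <= M) ->
  (r <= Q_order r gamma)%N ->
  regular T r (Q_zeta gamma) (Q_order r gamma) A B g -> Qstar T r gamma M g.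
Proof.
move=> HM rQ [H1 H2 H3 H4]; split => //.
- by move=> k t kr tT; apply: (le_trans (H3 k t kr tT)); apply: HM; exact: leq_trans kr rQ.
- move=> k t kr tT; apply: (le_trans (H4 k t kr tT)).
  by rewrite ler_wpM2r ?invr_ge0 ?powR_ge0// HM//; case/andP: kr.
Qed.

(** k^k is at most 2k (2k - 1) ... (k + 1) = 'C(2k, k) k!. *)
Lemma expnn_le k : (k ^ k <= 4 ^ k * k`!)%N.
Proof.
have h1 : (k ^ k <= (k + k) ^_ k)%N.
  rewrite ffact_prod -[X in (_ ^ X <= _)%N]card_ord -prod_nat_const.
  by apply: leq_prod => i _; rewrite -addnBA ?leq_addr// ltnW.
apply: (leq_trans h1); rewrite -bin_ffact leq_mul2r; apply/orP; right.
by rewrite (leq_trans (bin_le_exp2 _ _))// addnn -mul2n expnM.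
Qed.

Lemma fact_le_expnn k : (k`! <= k ^ k)%N.
Proof.
rewrite fact_prod big_add1 /= big_mkord -[X in (_ <= _ ^ X)%N]card_ord -prod_nat_const.
by apply: leq_prod => i _; exact: ltn_ord.
Qed.

(** The 4 converts k^k into k!, and 1 + A covers both the bound A at order 0 and the prefactor 1 at
    positive orders. *)
Lemma Bstar_regular T r gamma A s g : 0 < A -> (0 < r)%N -> Bstar T r gamma A g ->
  regular T r (1 - gamma) s (1 + A) (4 * A) g.
Proof.
move=> A0 r0 [H1 H2 H3 H4 H5].
have kk k : A ^+ k * k%:R ^+ k <= geom_fact (1 + A) (4 * A) k.
  rewrite /geom_fact exprMn -[leLHS]mul1r.
  rewrite [leRHS](_ : _ = (1 + A) * (A ^+ k * (4 ^+ k * k`!%:R))); last by ring.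
  apply: ler_pM => //; first by rewrite mulr_ge0 ?exprn_ge0// ltW.
    by rewrite lerDl ltW.
  rewrite ler_wpM2l ?exprn_ge0 ?(ltW A0)//.
  by rewrite -!natrX -natrM ler_nat expnn_le.
have ex k : k%:R - r%:R - (1 - gamma) = k%:R - r%:R - 1 + gamma by ring.
split => //.
- by move=> k t /andP[rk _]; exact: H2.
- move=> [|k] t kr tT.
    by apply: (le_trans (H3 t tT)); rewrite /geom_fact expr0 fact0 !mulr1 lerDr.
  by apply: (le_trans (H4 k.+1 t kr tT)).
- move=> k t /andP[rk _] tT; apply: (le_trans (H5 k t rk tT)).
  by rewrite ex ler_wpM2r ?invr_ge0 ?powR_ge0.
Qed.

(** For k >= 1 the prefactor is absorbed by A <= (1 + A)^k; at order 0, B >= 1 gives A <= (1 + A)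
    B. *)
Lemma regular_Bstar T r gamma A B g : 0 <= A -> 1 <= B -> (0 < r)%N ->
  (forall s, (r < s)%N -> regular T r (1 - gamma) s A B g) ->
  Bstar T r gamma ((1 + A) * B) g.
Proof.
move=> A0 B1 r0 H.
have B0 : 0 <= B by exact: le_trans B1.
have A1 : 1 <= 1 + A by rewrite lerDl.
have kk k : (0 < k)%N -> geom_fact A B k <= ((1 + A) * B) ^+ k * k%:R ^+ k.
  move=> k0; rewrite /geom_fact exprMn.
  apply: ler_pM; rewrite ?mulr_ge0 ?exprn_ge0//.
    rewrite ler_wpM2r ?exprn_ge0//.
    apply: (@le_trans _ _ (1 + A)); first by rewrite lerDr.
    by case: k k0 => // k _; exact: le_exprS.
  by rewrite -natrX ler_nat fact_le_expnn.
have ex k : k%:R - r%:R - (1 - gamma) = k%:R - r%:R - 1 + gamma by ring.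
have [H1 _ H3 _] := H r.+1 (ltnSn r).
split => //.
- by move=> k t rk tT; have [_ H2 _ _] := H k.+1 rk; apply: H2; rewrite ?rk ?ltnSn.
- move=> t tT; apply: (le_trans (H3 0%N t (leq0n _) tT)).
  rewrite /geom_fact expr0 fact0 !mulr1.
  by rewrite (@le_trans _ _ (1 + A)) ?lerDr// ler_peMr// (le_trans ler01).
- by move=> k t /andP[k0 kr] tT; apply: (le_trans (H3 k t kr tT)); exact: kk.
- move=> k t rk tT; have [_ _ _ H4] := H k rk.
  apply: (le_trans (H4 k t _ tT)); first by rewrite rk leqnn.
  by rewrite ex ler_wpM2r ?invr_ge0 ?powR_ge0// kk// (leq_ltn_trans _ rk).
Qed.

Lemma regular_mono T r zeta s A B A' B' g : 0 <= A <= A' -> 0 <= B <= B' ->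
  regular T r zeta s A B g -> regular T r zeta s A' B' g.
Proof.
move=> AA BB [H1 H2 H3 H4]; split => //.
- by move=> k t kr tT; apply: (le_trans (H3 k t kr tT)); exact: geom_fact_mono.
- move=> k t kr tT; apply: (le_trans (H4 k t kr tT)).
  by rewrite ler_wpM2r ?invr_ge0 ?powR_ge0// geom_fact_mono.
Qed.

End Classes.

Theorem lemma1p1 (R : realType) (T : R) (r : nat) (hT : 0 < T) (hr : (1 <= r)%N) :
  (forall (gamma : R) (H : R -> R -> R) (f : R -> R),
     0 < gamma ->
     separately T (Qstar T r gamma 1) H ->
     Qstar T r gamma 1 f ->
     exists x : R -> R, unique_volterra_solution T H f x /\
       exists M : R, 0 < M /\ Qstar T r gamma M x) /\
  (forall (gamma A1 A2 : R) (H : R -> R -> R) (f : R -> R),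
     0 < gamma <= 1 -> 0 < A1 -> 0 < A2 ->
     separately T (Bstar T r gamma A1) H ->
     Bstar T r gamma A2 f ->
     exists x : R -> R, unique_volterra_solution T H f x /\
       exists A : R, Bstar T r gamma A x).
Proof.
split.
- move=> gamma H f g0 [HH1 HH2] Hf.
  have /andP[z0 z1] := Q_zeta_bounds g0.
  have rQ := Q_order_gt r g0.
  have HH : separately T (regular T r (Q_zeta gamma) (Q_order r gamma) 1 1) H.
    by split => u uT; apply: Qstar_regular => //; [exact: HH1|exact: HH2].
  have Hf' := Qstar_regular g0 Hf.
  have [x xsol] := regular_volterra hT hr ler01 HH Hf'.
  have [[xc xs] _] := xsol.
  have [Y Y0 xY] := cont_on_bounded (ltW hT) ((cont_onP _ _ _).1 xc).
  have [C [M [C0 M1 HCM]]] := regular_solution hT hr z0 z1 ler01 (lexx 1) Y0.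
  exists x; split => //.
  (* Only finitely many orders occur, and M >= 1 makes the bound at the highest order the largest;
     the added 1 gives positivity. *)
  exists (geom_fact C M (Q_order r gamma) + 1).
  have M0 : 0 <= M by exact: le_trans M1.
  split; first by rewrite ltr_wpDl// geom_fact_ge0.
  apply: (@regular_Qstar _ _ _ _ _ C M); [|exact: ltnW|exact: HCM rQ HH Hf' xsol.1 xY].
  move=> k kQ; apply: (@le_trans _ _ (geom_fact C M (Q_order r gamma))); last by rewrite lerDl.
  rewrite /geom_fact ler_pM ?mulr_ge0 ?exprn_ge0//.
    by rewrite ler_wpM2l// ler_weXn2l.
  by rewrite ler_nat leq_fact.
- move=> gamma A1 A2 H f /andP[g0 g1] A10 A20 [HH1 HH2] Hf.
  have z0 : 0 <= 1 - gamma by lra.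
  have z1 : 1 - gamma < 1 by lra.
  (* One pair of constants serves both H and f, and the 1 in [B'] secures B' >= 1. *)
  pose A := A1 + A2.
  pose A' := 1 + A; pose B' := 4 * A + 1.
  have A'0 : 0 <= A' by rewrite /A' /A; lra.
  have B'1 : 1 <= B' by rewrite /B' /A; lra.
  have HH s : separately T (regular T r (1 - gamma) s A' B') H.
    split => u uT.
      apply: (regular_mono _ _ (Bstar_regular s A10 hr (HH1 u uT))).
        by apply/andP; split; rewrite /A' /A; lra.
      by apply/andP; split; rewrite /B' /A; lra.
    apply: (regular_mono _ _ (Bstar_regular s A10 hr (HH2 u uT))).
      by apply/andP; split; rewrite /A' /A; lra.
    by apply/andP; split; rewrite /B' /A; lra.
  have Hf' s : regular T r (1 - gamma) s A' B' f.
    apply: (regular_mono _ _ (Bstar_regular s A20 hr Hf)).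
      by apply/andP; split; rewrite /A' /A; lra.
    by apply/andP; split; rewrite /B' /A; lra.
  (* The solution and its bound Y are obtained at s = r, before s varies. *)
  have [x xsol] := regular_volterra hT hr A'0 (HH r) (Hf' r).
  have [[xc xs] _] := xsol.
  have [Y Y0 xY] := cont_on_bounded (ltW hT) ((cont_onP _ _ _).1 xc).
  have [C [M [C0 M1 HCM]]] := regular_solution hT hr z0 z1 A'0 B'1 Y0.
  exists x; split => //; exists ((1 + C) * M).
  apply: regular_Bstar => // s rs.
  exact: HCM rs (HH s) (Hf' s) xsol.1 xY.
Qed.
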